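(* Let $T>0$, let $s=3$, and let $$b_1=b_3=\frac{1}{2-2^{1/3}},\qquad b_2=1-2b_1 .$$ Let $u$, the solution of the periodic initial-value problem for the KdV equation $$u_t+uu_x+u_{xxx}=0,\quad x\in[-\pi,\pi],\ 0\le t\le T,\qquad u(x,0)=u_0(x),$$ belong to $H^{\mu}$ for $0\le t\le T$, and let $\mu$ be sufficiently large. For integers $N\ge1$, $M\ge1$ put $k=T/M$, $t^n=nk$, let $u^N$ be the Fourier-Galerkin semidiscrete approximation of $u$ in $S_N$ (defined in the context), let $V^n=u^N(t^n)$ for $0\le n\le M$, and for $0\le n\le M-1$ let the real-valued functions $V^{n,i}\in S_N$, $0\le i\le 3$, satisfy $$V^{n,0}=V^n,\qquad V^{n,i}=V^{n,i-1}+kb_iF\left(\frac{V^{n,i}+V^{n,i-1}}{2}\right),\quad 1\le i\le 3 .$$ Let $\theta^n=u^N(t^{n+1})-V^{n,3}$, $0\le n\le M-1$, be the local temporal error. Suppose there exists a constant $C_1$ such that $kN\le C_1$. Then, for $k$ sufficiently small, there exists a constant $C$ independent of $k$ and $N$ such that $$\max_{0\le n\le M-1}\|\theta^n\|\le Ck^5 .$$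
   Context: All functions of $x$ are $2\pi$-periodic; $u_0$ is real-valued. $L^2=L^2(-\pi,\pi)$ has inner product $(v,w)=\int_{-\pi}^{\pi}v\overline{w}\,dx$ and norm $\|\cdot\|$. For real $\mu\ge 0$, $H^{\mu}$ is the $L^2$-based Sobolev space of periodic functions on $(-\pi,\pi)$ with norm $\|g\|_{\mu}=\left(\sum_{k\in\mathbb{Z}}(1+k^2)^{\mu}|\widehat g(k)|^2\right)^{1/2}$, where $\widehat g(k)=\frac1{2\pi}\int_{-\pi}^{\pi}e^{-ikx}g(x)\,dx$. ''The solution $u$ belongs to $H^\mu$ for $0\le t\le T$'' means that $u_0\in H^\mu$ and $u\in C([0,T];H^{\mu})$ is the (unique, real-valued) solution of the initial-value problem. For an integer $N\ge1$, $S_N=\mathrm{span}\{e^{ikx}: k\in\mathbb{Z},\ -N\le k\le N\}$, and $P_N$ is the $L^2$-projection onto $S_N$, $P_Nv=\sum_{|k|\le N}\widehat v(k)e^{ikx}$. The semidiscrete Fourier-Galerkin approximation is the real-valued map $u^N:[0,T]\to S_N$ satisfying $(u^N_t+u^Nu^N_x+u^N_{xxx},\chi)=0$ for all $\chi\in S_N$, $0\le t\le T$, and $u^N(0)=P_Nu_0$; it exists uniquely on $[0,T]$. For real-valued $v\in S_N$, $F(v)=-v_{xxx}-P_N\left(f(v)_x\right)$ with $f(v)=v^2/2$, so that $u^N_t=F(u^N)$. Functions $V^{n,i}$ as in the claim exist. Meaning of the quantifiers: there is an absolute $\mu_0$ such that, whenever $\mu\ge\mu_0$ and $C_1$ is given,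 there exist $k_0>0$ and $C$ (which may depend on $u,T,\mu,C_1$ but not on $k,N$) such that the estimate holds for all $N,M$ with $k=T/M\le k_0$ and $kN\le C_1$. *)

(* Defs.v *)
(* Conventions.
   - Functions of x are maps on the whole line, 2*pi-periodic.  The real line is
     an arbitrary [R : realType], the complex numbers are [R[i]].
   - A real-valued function is viewed in a complex function space through
     [toC]; a function of (t, x) is curried as [u t x], and its values for t
     outside [0, T] are irrelevant. *)
From HB Require Import structures.
From mathcomp Require Import all_boot all_order all_algebra.
From mathcomp Require Import all_classical all_reals all_analysis.
From mathcomp Require Import complex.

Set Implicit Arguments.
Unset Strict Implicit.
Unset Printing Implicit Defensive.
Import Order.TTheory GRing.Theory Num.Theory.
Import numFieldNormedType.Exports.
Local Open Scope classical_set_scope.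
Local Open Scope ring_scope.
Local Open Scope complex_scope.

Section PeriodicFunctions.
Variable R : realType.
Implicit Types (v w : R -> R[i]) (g : R -> R).

Definition toC g : R -> R[i] := fun x => (g x)%:C.

Definition cell : set R := `[- pi, pi].

(* \int_{-pi}^{pi} of a complex-valued function, componentwise (Lebesgue). *)
Definition cintegral v : R[i] :=
  Rintegral lebesgue_measure cell (fun x => complex.Re (v x)) +i*
  Rintegral lebesgue_measure cell (fun x => complex.Im (v x)).

Definition inner v w : R[i] := cintegral (fun x => v x * (w x)^*).

Definition L2norm v : R := Num.sqrt (complex.Re (inner v v)).

(* e^{ikx} *)
Definition expi (k : int) (x : R) : R[i] := cos (k%:~R * x) +i* sin (k%:~R * x).

Definition fourier v (k : int) : R[i] :=
  ((pi *+ 2)^-1)%:C * cintegral (fun x => expi (- k) x * v x).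

Definition inL2 v : Prop :=
  [/\ measurable_fun setT (fun x => complex.Re (v x)),
      measurable_fun setT (fun x => complex.Im (v x)) &
      (\int[lebesgue_measure]_(x in cell) ((Normc.normc (v x) ^+ 2)%:E)
        < +oo)%E].

Definition sobolev_sq (mu : R) v : \bar R :=
  \esum_(k in [set: int])
    (((1 + (k%:~R : R) ^+ 2) `^ mu * Normc.normc (fourier v k) ^+ 2)%:E).

(* Sound on [inH] only, since [fine] sends +oo to 0. *)
Definition Hnorm (mu : R) v : R := Num.sqrt (fine (sobolev_sq mu v)).

Definition inH (mu : R) v : Prop :=
  [/\ periodic v (pi *+ 2), inL2 v & (sobolev_sq mu v < +oo)%E].

(* u \in C([0,T]; H^mu) *)
Definition inCH (T mu : R) (u : R -> R -> R) : Prop :=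
  forall t : R, t \in `[0, T] ->
    inH mu (toC (u t)) /\
    Hnorm mu (toC (fun x => u s x - u t x)) @[s --> within `[0, T] (nbhs t)]
      --> (0 : R).

(* Sum over the integers k with -N <= k <= N. *)
Definition sumZ (N : nat) (a : int -> R[i]) : R[i] :=
  \sum_(j < N.*2.+1) a (j%:Z - N%:Z).

Definition inS (N : nat) v : Prop :=
  exists c : int -> R[i], forall x, v x = sumZ N (fun k => c k * expi k x).

Definition PN (N : nat) v : R -> R[i] :=
  fun x => sumZ N (fun k => fourier v k * expi k x).

End PeriodicFunctions.

Section Time.
Variable R : realType.
Implicit Types (T t : R) (f : R -> R).

(* Derivative on the interval [0, T], hence one-sided at 0 and at T. *)
Definition tquot f t : R -> R := fun s => (f s - f t) / (s - t).

Definition tderivable T f t : Prop :=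
  cvg (tquot f t s @[s --> within `[0, T] t^']).

Definition tderive T f t : R := lim (tquot f t s @[s --> within `[0, T] t^']).

End Time.

Section KdV.
Variable R : realType.
Implicit Types (T : R) (N : nat).

(* For large mu the solution in C([0,T]; H^mu) is classical, and each
   u t is identified with its smooth representative. *)
Definition kdv_solution T (mu : R) (u0 : R -> R) (u : R -> R -> R) : Prop :=
  [/\ inCH T mu u,
      (forall x, u 0 x = u0 x),
      (forall (t x : R) j, t \in `[0, T] -> (j < 3)%N ->
         derivable (derive1n j (u t)) x 1),
      (forall t x : R, t \in `[0, T] -> tderivable T (u^~ x) t) &
      (forall t x : R, t \in `[0, T] ->
         tderive T (u^~ x) t + u t x * derive1 (u t) x + derive1n 3 (u t) x = 0)].

Definition semidiscrete T N (u0 : R -> R) (uN : R -> R -> R) : Prop :=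
  [/\ (forall t : R, t \in `[0, T] -> inS N (toC (uN t))),
      (forall t x : R, t \in `[0, T] -> tderivable T (uN^~ x) t),
      (forall (t : R) chi, t \in `[0, T] -> inS N chi ->
         inner (toC (fun x => tderive T (uN^~ x) t
                              + uN t x * derive1 (uN t) x + derive1n 3 (uN t) x)) chi
         = 0) &
      (forall x, toC (uN 0) x = PN N (toC u0) x)].

Definition flux (v : R -> R) : R -> R := fun x => v x ^+ 2 / 2.

(* Real-valued when v is, but its expression through [PN] is complex. *)
Definition F N (v : R -> R) : R -> R[i] :=
  fun x => - toC (derive1n 3 v) x - PN N (toC (derive1 (flux v))) x.

Definition b1 : R := (2 - 2 `^ (1 / 3))^-1.

Definition b (i : nat) : R := if i == 2%N then 1 - 2 * b1 else b1.

Definition stages N (k : R) (M : nat) (uN : R -> R -> R)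
    (V : nat -> nat -> R -> R) : Prop :=
  forall n, (n < M)%N ->
  [/\ (forall i, (i <= 3)%N -> inS N (toC (V n i))),
      (forall x, V n 0%N x = uN (n%:R * k) x) &
      (forall i x, (1 <= i <= 3)%N ->
         toC (V n i) x = toC (V n i.-1) x
           + (k * b i)%:C * F N (fun y => (V n i y + V n i.-1 y) / 2) x)].

Definition local_error (k : R) (uN : R -> R -> R) (V : nat -> nat -> R -> R)
    (n : nat) : R -> R :=
  fun x => uN (n.+1%:R * k) x - V n 3%N x.

End KdV.

(* Main.v *)
Require Import Defs.
From HB Require Import structures.
From mathcomp Require Import all_boot all_order all_algebra.
From mathcomp Require Import all_classical all_reals all_analysis.
From mathcomp Require Import complex.
From mathcomp Require Import ring lra zify.
Set Implicit Arguments.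
Unset Strict Implicit.
Unset Printing Implicit Defensive.
Import Order.TTheory GRing.Theory Num.Theory.
Import numFieldNormedType.Exports.
Local Open Scope classical_set_scope.
Local Open Scope ring_scope.
Local Open Scope complex_scope.
Import Normc.

(** Everything is estimated on Fourier coefficients [a : int -> R[i]] with
    frequencies |k| <= N, in two norms: the weighted l1 norms
    [wnorm N m a], the sum of (1 + |k|)^m |a_k|, which measure smoothness, and the
    squared l2 norm [sqnorm N a], which measures errors.  In these coordinates the
    semidiscrete equation reads a' = [kdvF N a], a quadratic field, and two facts
    about it carry the proof.

    - It loses three derivatives, with constants that do not depend on N
      ([wnorm_dispersion], [wnorm_advection]).
    - It is one-sided Lipschitz in l2, with a constant that involves only one
      derivative of one of the two states compared ([energy]): the dispersive
      term is skew, and e e_x is orthogonal to a real function e.  Hence two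
      approximate solutions stay close by Gronwall's inequality ([flow_stable]),
      and an implicit midpoint step amplifies a perturbation by a bounded factor
      ([midpoint_stable]), however large k N^3 is.

    Uniform smoothness of u^N ([semidiscrete_bound]).  The Fourier coefficients of
    u(t) are bounded by a multiple of (1 + |k|)^-24, uniformly in t since [0, T] is
    compact ([uniform_decay]).  As u(t) is differentiable, its Fourier series
    converges to it pointwise, by Chernoff's telescoping argument
    ([fourier_inversion]), so that u and its first three derivatives are within a
    multiple of (N + 1)^-20 of those of P_N u ([fourier_approx]).  To follow u in
    time, it is sampled at 4N + 1 equidistant nodes: the discrete Fourier
    coefficients [dft N (u t)] are finite combinations of point values, hence
    differentiable in t, and the equation satisfied by u makes them solve
    a' = [kdvF N a] up to an error of order (N + 1)^-16 ([residual_le]).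
    Comparing them with the coefficients of u^N gives an l2 error of the same
    order, and the factor (N + 1)^-16 pays for fifteen derivatives of the error, a
    trigonometric polynomial of degree N.

    The local error.  Let v be the coefficients of u^N(t^n).  Along a polynomial of
    degree four in the step whose coefficients are combinations of the seven
    elementary differentials of order at most four at v, the field is computed
    exactly up to a remainder of order k^4 that is bounded in l2, because v has
    fifteen derivatives under control ([kdvF_series4], [wnorm_remainder]).  The
    Taylor polynomial of the exact flow solves the equation up to that remainder,
    and so do the polynomials that expand the three stages
    ([taylor_flow_close], [stages_close]); stability turns the residuals into l2
    errors of order k^5.  Finally 2 b1^3 + b2^3 = 0, and this makes the polynomial
    of the third stage equal to that of the flow ([stage_coef_order4]). *)

(** * Weighted norms of coefficients and the KdV field *)

Section Coefficients.
Variable R : realType.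
Local Notation C := (R[i]).
Implicit Types (a b c : int -> C) (N m : nat) (k : int).

(** The frequencies -N, ..., N, in the order in which [sumZ] runs over them. *)
Definition freq N (j : 'I_(N.*2.+1)) : int := j%:Z - N%:Z.

(** Unlike (1 + k^2)^(1/2), the weight 1 + |k| is submultiplicative with constant
    one ([weightD]). *)
Definition weight k : R := (absz k).+1%:R.

Lemma weight_ge1 k : 1 <= weight k.
Proof. by rewrite /weight ler1n. Qed.

Lemma weight_ge0 k : 0 <= weight k.
Proof. exact: le_trans ler01 (weight_ge1 k). Qed.

Lemma weightD k l : weight (k + l) <= weight k * weight l.
Proof. by rewrite /weight -natrM ler_nat; nia. Qed.

Lemma normc_int k : normc (k%:~R : C) = `|k%:~R : R|.
Proof.
have -> : (k%:~R : C) = (k%:~R : R)%:C by rewrite rmorph_int.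
by rewrite /normc /= expr0n addr0 sqrtr_sqr.
Qed.

Lemma normc_int_weight k : normc (k%:~R : C) <= weight k.
Proof.
by rewrite normc_int /weight -intr_norm -[_.+1%:R]/((_.+1)%:~R) ler_int; lia.
Qed.

Lemma normci : normc ('i%C : C) = 1.
Proof. by rewrite /normc /= expr0n expr1n add0r sqrtr1. Qed.

Lemma normcR (x : R) : normc x%:C = `|x|.
Proof. by rewrite /normc /= expr0n addr0 sqrtr_sqr. Qed.

Lemma normc_ge0 (z : C) : 0 <= normc z.
Proof. by case: z => x y; rewrite /normc sqrtr_ge0. Qed.

Lemma normc_sum (I : finType) (P : pred I) (f : I -> C) :
  normc (\sum_(i | P i) f i) <= \sum_(i | P i) normc (f i).
Proof.
elim/big_ind2 : _ => [|x1 x2 y1 y2 h1 h2|//]; first by rewrite normc0.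
exact: le_trans (le_normcD _ _) (lerD h1 h2).
Qed.

Lemma normc_re (z : C) : `|complex.Re z| <= normc z.
Proof.
case: z => x y /=; rewrite -sqrtr_sqr ler_wsqrtr// lerDl; exact: sqr_ge0.
Qed.

Lemma freq_inj N : injective (@freq N).
Proof. by move=> i j /addIr [] /val_inj. Qed.

Lemma freq_le N (j : 'I_(N.*2.+1)) : (`|freq j| <= N)%N.
Proof. by have := ltn_ord j; rewrite /freq; lia. Qed.

Lemma freq_rev N (j : 'I_(N.*2.+1)) : freq (rev_ord j) = - freq j.
Proof. by have := ltn_ord j; rewrite /freq /=; lia. Qed.

Lemma freq_surj N k : (`|k| <= N)%N -> exists j : 'I_(N.*2.+1), freq j = k.
Proof.
move=> kN; have h : (`|(k + N%:Z)%R| < N.*2.+1)%N by lia.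
by exists (Ordinal h); rewrite /freq /=; lia.
Qed.

(** This norm bounds the maxima of the first [m] derivatives of the trigonometric
    polynomial with coefficients [a]. *)
Definition wnorm N m a : R := \sum_(j < N.*2.+1) weight (freq j) ^+ m * normc (a (freq j)).

Definition sqnorm N a : R := \sum_(j < N.*2.+1) normc (a (freq j)) ^+ 2.

(** Coefficients of -v_xxx when [a] are those of v. *)
Definition dispersion a : int -> C := fun k => 'i%C * k%:~R ^+ 3 * a k.

Definition convolution N a b : int -> C := fun k =>
  \sum_(j < N.*2.+1) \sum_(l < N.*2.+1 | freq j + freq l == k) a (freq j) * b (freq l).

(** Coefficients of -P_N ((v w)_x) / 2 when [a] and [b] are those of v and w: half
    the second derivative of the quadratic part of the KdV field. *)
Definition advection N a b : int -> C := fun k => - ('i%C * k%:~R / 2) * convolution N a b k.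

Definition kdvF N a : int -> C := fun k => dispersion a k + advection N a a k.

Lemma wnorm_ge0 N m a : 0 <= wnorm N m a.
Proof. by apply: sumr_ge0 => j _; rewrite mulr_ge0 ?exprn_ge0 ?weight_ge0 ?normc_ge0. Qed.

Lemma sqnorm_ge0 N a : 0 <= sqnorm N a.
Proof. by apply: sumr_ge0 => j _; rewrite exprn_ge0 ?normc_ge0. Qed.

Lemma wnorm_mono N m m' a : (m <= m')%N -> wnorm N m a <= wnorm N m' a.
Proof.
move=> mm; apply: ler_sum => j _; rewrite ler_wpM2r ?normc_ge0 //.
by rewrite ler_weXn2l ?weight_ge1.
Qed.

Lemma wnormD N m a b : wnorm N m (fun k => a k + b k) <= wnorm N m a + wnorm N m b.
Proof.
rewrite /wnorm -big_split /=; apply: ler_sum => j _; rewrite -mulrDr.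
by apply: ler_wpM2l; rewrite ?exprn_ge0 ?weight_ge0 ?le_normcD.
Qed.

Lemma wnormZ N m (z : C) a : wnorm N m (fun k => z * a k) = normc z * wnorm N m a.
Proof. by rewrite /wnorm mulr_sumr; apply: eq_bigr => j _; rewrite normcM mulrCA. Qed.

Lemma wnorm_dispersion N m a : wnorm N m (dispersion a) <= wnorm N m.+3 a.
Proof.
apply: ler_sum => j _; rewrite /dispersion !normcM normci mul1r [leLHS]mulrA.
apply: ler_wpM2r; first exact: normc_ge0.
rewrite -addn3 exprD; apply: ler_wpM2l; first by rewrite exprn_ge0 ?weight_ge0.
by rewrite !exprS expr0 mulr1 !ler_pM ?mulr_ge0 ?normc_ge0 ?normc_int_weight.
Qed.

(** A pair of frequencies (j, l) contributes to the single frequency j + l, and the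
    weight of j + l is at most the product of the weights: summing over the pairs
    gives a product of two sums.  The extra power of the weight absorbs the
    derivative. *)
Lemma wnorm_advection N m a b : wnorm N m (advection N a b) <= wnorm N m.+1 a * wnorm N m.+1 b.
Proof.
rewrite {2}/wnorm mulr_suml.
(* The pairs with |j + l| > N are cut off by the projection. *)
have -> : \sum_(i < N.*2.+1) weight (freq i) ^+ m.+1 * normc (a (freq i)) * wnorm N m.+1 b =
  \sum_(i < N.*2.+1) \sum_(l < N.*2.+1) \sum_(k < N.*2.+1 | freq i + freq l == freq k)
     (weight (freq i) ^+ m.+1 * normc (a (freq i)) * (weight (freq l) ^+ m.+1 * normc (b (freq l))))
  + \sum_(i < N.*2.+1) \sum_(l < N.*2.+1 | (N < absz (freq i + freq l)%R)%N)
     (weight (freq i) ^+ m.+1 * normc (a (freq i)) * (weight (freq l) ^+ m.+1 * normc (b (freq l)))).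
  rewrite -big_split /=; apply: eq_bigr => i _; rewrite /wnorm mulr_sumr.
  rewrite [X in _ + X]big_mkcond /= -big_split /=; apply: eq_bigr => l _.
  case: ltnP => h; last first.
    have [k0 k0E] := freq_surj h.
    rewrite (big_pred1 k0) ?addr0// => k; rewrite -k0E eq_sym.
    by rewrite /= (inj_eq (@freq_inj N)).
  rewrite big_pred0 ?add0r// => k; apply/eqP => e.
  by have := freq_le k; rewrite -e leqNgt h.
rewrite ler_wpDr //.
  by do 2!apply: sumr_ge0 => ? _; rewrite !mulr_ge0 ?exprn_ge0 ?weight_ge0 ?normc_ge0.
under [leRHS]eq_bigr => i _ do under eq_bigr => l _ do rewrite big_mkcond.
under [leRHS]eq_bigr => i _ do rewrite exchange_big /=.
rewrite exchange_big /=; apply: ler_sum => k _.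
rewrite /advection /convolution normcM mulrA.
have -> : normc (- ('i%C * (freq k)%:~R / 2 : C)) = normc ((freq k)%:~R : C) / 2.
  rewrite normcN !normcM normci mul1r; congr (_ * _).
  by rewrite normcV -[2]/((2 : int)%:~R) normc_int ger0_norm.
have hk : weight (freq k) ^+ m * (normc ((freq k)%:~R : C) / 2) <= weight (freq k) ^+ m.+1.
  rewrite exprSr; apply: ler_wpM2l; first by rewrite exprn_ge0 ?weight_ge0.
  rewrite (le_trans _ (normc_int_weight _)) // ler_pdivrMr // ler_peMr ?normc_ge0 //.
  by rewrite ler1n.
apply: (le_trans (ler_wpM2r (normc_ge0 _) hk)).
apply: (le_trans (ler_wpM2l _ (normc_sum _ _))); first by rewrite exprn_ge0 ?weight_ge0.
rewrite mulr_sumr; apply: ler_sum => i _.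
apply: (le_trans (ler_wpM2l _ (normc_sum _ _))); first by rewrite exprn_ge0 ?weight_ge0.
rewrite mulr_sumr -big_mkcond /=; apply: ler_sum => l /eqP <-.
rewrite normcM mulrACA; apply: ler_wpM2r; first by rewrite mulr_ge0 ?normc_ge0.
by rewrite -exprMn lerXn2r ?nnegrE ?mulr_ge0 ?weight_ge0// weightD.
Qed.

Lemma convolutionDl N a b c k : convolution N (fun k => a k + b k) c k = convolution N a c k + convolution N b c k.
Proof.
rewrite /convolution -big_split /=; apply: eq_bigr => j _; rewrite -big_split /=.
by apply: eq_bigr => l _; rewrite mulrDl.
Qed.

Lemma convolutionZl N (z : C) a c k : convolution N (fun k => z * a k) c k = z * convolution N a c k.
Proof.
rewrite /convolution mulr_sumr; apply: eq_bigr => j _; rewrite mulr_sumr.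
by apply: eq_bigr => l _; rewrite mulrA.
Qed.

Lemma convolutionC N a b k : convolution N a b k = convolution N b a k.
Proof.
rewrite /convolution.
under eq_bigr => j _ do rewrite big_mkcond.
rewrite exchange_big /=; apply: eq_bigr => j _; rewrite [RHS]big_mkcond.
by apply: eq_bigr => l _; rewrite addrC mulrC.
Qed.

Lemma advectionDl N a b c k : advection N (fun k => a k + b k) c k = advection N a c k + advection N b c k.
Proof. by rewrite /advection convolutionDl mulrDr. Qed.

Lemma advectionZl N (z : C) a c k : advection N (fun k => z * a k) c k = z * advection N a c k.
Proof. by rewrite /advection convolutionZl mulrCA. Qed.

Lemma advectionC N a b k : advection N a b k = advection N b a k.
Proof. by rewrite /advection convolutionC. Qed.

Lemma advectionDr N a b c k : advection N c (fun k => a k + b k) k = advection N c a k + advection N c b k.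
Proof. by rewrite advectionC advectionDl advectionC (advectionC N b). Qed.

Lemma advectionZr N (z : C) a c k : advection N c (fun k => z * a k) k = z * advection N c a k.
Proof. by rewrite advectionC advectionZl advectionC. Qed.

Lemma eq_wnorm N m a a' : (forall k, (`|k| <= N)%N -> a k = a' k) ->
  wnorm N m a = wnorm N m a'.
Proof. by move=> h; apply: eq_bigr => j _; rewrite h ?freq_le. Qed.

End Coefficients.

(** * The energy inequality *)

Section Energy.
Variable R : realType.
Local Notation C := (R[i]).
Implicit Types (a b c e w : int -> C) (N m : nat) (k : int).

(** The functions with these coefficients are the real-valued ones. *)
Definition herm a := forall k, a (- k) = conjc (a k).

Definition reinner N a e : R := complex.Re (\sum_(j < N.*2.+1) a (freq j) * conjc (e (freq j))).

(** Up to a factor, the integral of the product of three functions; [tri_leibniz]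
    says that the integral of a derivative vanishes. *)
Let tri N a b c : C := \sum_(j < N.*2.+1) \sum_(l < N.*2.+1) \sum_(k < N.*2.+1)
  ((freq j + freq l + freq k == 0)%:R * (a (freq j) * b (freq l) * c (freq k))).

Let D a : int -> C := fun k => k%:~R * a k.

Let tri_swap12 N a b c : tri N a b c = tri N b a c.
Proof.
rewrite /tri exchange_big /=; apply: eq_bigr => j _; apply: eq_bigr => l _.
by apply: eq_bigr => k _; rewrite (addrC (freq l)) (mulrC (a _)).
Qed.

Let tri_swap23 N a b c : tri N a b c = tri N a c b.
Proof.
rewrite /tri; apply: eq_bigr => j _; rewrite exchange_big /=.
apply: eq_bigr => l _; apply: eq_bigr => k _.
by rewrite addrAC mulrAC.
Qed.

Let tri_leibniz N a b c : tri N (D a) b c + tri N a (D b) c + tri N a b (D c) = 0.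
Proof.
rewrite /tri -!big_split big1 //= => j _; rewrite -!big_split big1 //= => l _.
rewrite -!big_split big1 //= => k _; rewrite /D.
have [e|] := eqVneq; last by rewrite !mul0r !addr0.
have : (freq j)%:~R + (freq l)%:~R + (freq k)%:~R = 0 :> C by rewrite -!rmorphD /= e.
move: (freq j)%:~R (freq l)%:~R (freq k)%:~R => x y z xyz.
rewrite !mul1r; transitivity ((x + y + z) * (a (freq j) * b (freq l) * c (freq k))).
  by ring.
by rewrite xyz mul0r.
Qed.

Let conj_advection N a b e : herm e ->
  \sum_(k < N.*2.+1) advection N a b (freq k) * conjc (e (freq k)) = 'i%C / 2 * tri N a b (D e).
Proof.
move=> he; rewrite (reindex_inj rev_ord_inj) /=.
rewrite /tri mulr_sumr.
under [RHS]eq_bigr => j _ do rewrite exchange_big mulr_sumr /=.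
rewrite exchange_big /=; apply: eq_bigr => k _.
rewrite freq_rev -he opprK /advection /convolution /D rmorphN /= mulr_sumr mulr_suml.
apply: eq_bigr => j _; rewrite big_mkcond /= !mulr_sumr mulr_suml.
apply: eq_bigr => l _; rewrite -addr_eq0.
by case: eqP => _ /=; rewrite ?mul0r ?mulr0 ?mul0r//; ring.
Qed.

Let tri_le N a e : normc (tri N a e e) <= wnorm N 0 a * sqnorm N e.
Proof.
apply: le_trans (normc_sum _ _) _; rewrite /wnorm mulr_suml; apply: ler_sum => j _.
rewrite expr0 mul1r.
have one x (i : 'I_(N.*2.+1)) : 0 <= x ->
    \sum_(k < N.*2.+1) ((freq j + freq i + freq k == 0)%:R * x) <= x :> R.
  move=> x0; have [h|h] := leqP (absz (- (freq j + freq i))) N; last first.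
    rewrite big1 // => k _; case: eqP => [E|_]; last by rewrite mul0r.
    by have := freq_le k; lia.
  have [k0 k0E] := freq_surj h.
  rewrite (bigD1 k0) //= big1 => [|k kk0].
    by rewrite addr0 k0E addrN eqxx mul1r.
  rewrite addrC addr_eq0 -k0E (inj_eq (@freq_inj N)) (negbTE kk0) mul0r //.
have -> : normc (a (freq j)) * sqnorm N e =
  normc (a (freq j)) * ((sqnorm N e + sqnorm N e) / 2) by congr (_ * _); field.
apply: le_trans (_ : \sum_(l < N.*2.+1) \sum_(k < N.*2.+1)
    ((freq j + freq l + freq k == 0)%:R * (normc (a (freq j)) * (normc (e (freq l)) ^+ 2 / 2)) +
     (freq j + freq l + freq k == 0)%:R * (normc (a (freq j)) * (normc (e (freq k)) ^+ 2 / 2)))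
  <= _).
  apply: le_trans (normc_sum _ _) _; apply: ler_sum => l _.
  apply: le_trans (normc_sum _ _) _; apply: ler_sum => k _.
  rewrite -mulrDr !normcM; case: eqP => _; last by rewrite normc0 !mul0r.
  rewrite normc1 !mul1r -mulrA -mulrDr; apply: ler_wpM2l; first exact: normc_ge0.
  have := sqr_ge0 (normc (e (freq l)) - normc (e (freq k))); nra.
under eq_bigr => l _ do rewrite big_split /=.
rewrite big_split /= [X in _ + X]exchange_big /= [X in _ * X]mulrDl mulrDr.
apply: lerD; rewrite /sqnorm mulr_suml mulr_sumr; apply: ler_sum => l _.
  by apply: one; rewrite mulr_ge0 ?normc_ge0 ?divr_ge0 ?sqr_ge0.
under eq_bigr => k _ do rewrite addrAC.
by apply: one; rewrite mulr_ge0 ?normc_ge0 ?divr_ge0 ?sqr_ge0.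
Qed.

Let reinner_dispersion N e : reinner N (dispersion e) e = 0.
Proof.
rewrite /reinner (raddf_sum (@complex.Re R : Rcomplex R -> R)) big1 //= => k _; rewrite /dispersion.
have -> : ((freq k)%:~R : C) ^+ 3 = (((freq k)%:~R : R) ^+ 3)%:C by rewrite rmorphXn rmorph_int.
by case: (e _) => x y /=; ring.
Qed.

Lemma reinnerDl N a b e : reinner N (fun k => a k + b k) e = reinner N a e + reinner N b e.
Proof.
rewrite /reinner -(raddfD (@complex.Re R : Rcomplex R -> R)) -big_split /=.
by congr complex.Re; apply: eq_bigr => k _; rewrite mulrDl.
Qed.

(** With e = v - w, the difference of the fields is -e_xxx - (w e)_x - e e_x.  For
    real e the first and the last term are orthogonal to e, and two integrations by
    parts turn the middle one into -(w_x e, e) / 2. *)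
Lemma energy N w e : herm e ->
  `|reinner N (fun k => kdvF N (fun l => w l + e l) k - kdvF N w k) e| <= wnorm N 1 w * sqnorm N e.
Proof.
move=> he.
have -> : reinner N (fun k => kdvF N (fun l => w l + e l) k - kdvF N w k) e =
    reinner N (dispersion e) e + (reinner N (fun k => 2 * advection N w e k) e + reinner N (advection N e e) e).
  rewrite -!reinnerDl; congr reinner; apply/funext => k.
  rewrite /kdvF advectionDl !advectionDr /dispersion (advectionC N e w); ring.
have -> : reinner N (advection N e e) e = 0.
  rewrite /reinner conj_advection//.
  have h : tri N e e (D e) *+ 3 = 0.
    have := tri_leibniz N e e e.
    by rewrite (tri_swap12 N (D e)) (tri_swap23 N e (D e)) -mulr2n -mulrSr.
  by move/eqP : h; rewrite mulrn_eq0 /= => /eqP ->; rewrite mulr0.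
rewrite reinner_dispersion add0r addr0 /reinner.
have -> : \sum_(j < N.*2.+1) 2 * advection N w e (freq j) * conjc (e (freq j)) =
    - ('i%C / 2 * tri N (D w) e e).
  under eq_bigr => j _ do rewrite -mulrA.
  rewrite -mulr_sumr conj_advection//.
  have /eqP := tri_leibniz N w e e.
  rewrite (tri_swap23 N w (D e)) -addrA addr_eq0 => /eqP ->; field => //.
apply: le_trans (normc_re _) _; rewrite normcN !normcM normci mul1r.
have -> : normc (2^-1 : C) = 2^-1.
  by rewrite normcV -[2]/((2 : int)%:~R) normc_int ger0_norm.
apply: le_trans (_ : normc (tri N (D w) e e) <= _).
  by rewrite ler_piMl ?normc_ge0 ?invf_le1 ?ler1n.
apply: le_trans (tri_le _ _ _) _; apply: ler_wpM2r; first exact: sqnorm_ge0.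
apply: ler_sum => j _; rewrite expr0 expr1 mul1r /D normcM.
by apply: ler_wpM2r; rewrite ?normc_ge0 ?normc_int_weight.
Qed.


Lemma conjci : conjc ('i%C : C) = - 'i%C.
Proof. by apply/eqP; rewrite eq_complex /= oppr0 !eqxx. Qed.

Lemma conjcM (x y : C) : conjc (x * y) = conjc x * conjc y.
Proof. exact: rmorphM. Qed.

Lemma conjcN (x : C) : conjc (- x) = - conjc x.
Proof. exact: raddfN. Qed.

Lemma conjcD (x y : C) : conjc (x + y) = conjc x + conjc y.
Proof. exact: raddfD. Qed.

Lemma conjc_int k : conjc (k%:~R : C) = k%:~R.
Proof. exact: rmorph_int. Qed.

Lemma herm_dispersion a : herm a -> herm (dispersion a).
Proof.
move=> h k; rewrite /dispersion h !conjcM conjci conjc_int mulrNz; ring.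
Qed.

Lemma herm_advection N a b : herm a -> herm b -> herm (advection N a b).
Proof.
move=> ha hb k; rewrite /advection !conjcM conjcN !conjcM conjci conjc_int mulrNz.
rewrite (_ : conjc (2^-1 : C) = 2^-1); last by rewrite conjc_inv conjc_nat.
suff -> : convolution N a b (- k) = conjc (convolution N a b k) by ring.
rewrite /convolution [LHS](reindex_inj rev_ord_inj) /= rmorph_sum /=; apply: eq_bigr => j _.
rewrite [LHS](reindex_inj rev_ord_inj) /= rmorph_sum /=; apply: eq_big => [l|l _].
  by rewrite !freq_rev -opprD eqr_opp.
by rewrite !freq_rev ha hb rmorphM.
Qed.

Lemma herm_kdvF N a : herm a -> herm (kdvF N a).
Proof. by move=> h k; rewrite /kdvF herm_dispersion // herm_advection// rmorphD. Qed.

Lemma hermD a b : herm a -> herm b -> herm (fun k => a k + b k).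
Proof. by move=> ha hb k; rewrite ha hb rmorphD. Qed.

Lemma hermB a b : herm a -> herm b -> herm (fun k => a k - b k).
Proof. by move=> ha hb k; rewrite ha hb rmorphB. Qed.

End Energy.

(** * Expansion of the field along elementary differentials *)

Section Expansion.
Variables (R : realType) (N : nat) (v : int -> R[i]).
Local Notation C := (R[i]).
Implicit Types (x y : int -> C) (al : nat -> C) (h : C).

(** The derivative of the field at [v]. *)
Definition dkdvF x : int -> C := fun k => dispersion x k + 2 * advection N v x k.

(** The elementary differentials of the field f at [v], up to order four: f, f'f,
    f''(f,f)/2, f'f'f, f''(f,f'f)/2, f'f''(f,f)/2 and f'f'f'f.  The remaining tree of
    order four involves f''', which vanishes since the field is quadratic. *)
Definition elem_diff (i : nat) : int -> C :=
  let f := kdvF N v in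
  match i with
  | 1 => f
  | 2 => dkdvF f
  | 3 => advection N f f
  | 4 => dkdvF (dkdvF f)
  | 5 => advection N f (dkdvF f)
  | 6 => dkdvF (advection N f f)
  | _ => dkdvF (dkdvF (dkdvF f))
  end%N.

(** Both the exact flow and the stages of the method are expanded in this form; only
    the scalars [al 1], ..., [al 7] differ. *)
Definition series4 al h : int -> C := fun k =>
  v k + (h * al 1%N * elem_diff 1 k + h ^+ 2 * al 2%N * elem_diff 2 k
  + h ^+ 3 * (al 3%N * elem_diff 3 k + al 4%N * elem_diff 4 k)
  + h ^+ 4 * (al 5%N * elem_diff 5 k + al 6%N * elem_diff 6 k + al 7%N * elem_diff 7 k)).

(** Up to the remainder, the field along [series4 al h] is the combination of the
    elementary differentials with the scalars [rate al] ([kdvF_series4]).  The exact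
    flow then corresponds to the equation al' = [rate al], and a one-step method to
    the same method applied to that equation. *)
Definition rate al (i : nat) : C :=
  match i with
  | 1%N => 1
  | 2%N => al 1%N
  | 3%N => al 1%N ^+ 2
  | 4%N => al 2%N
  | 5%N => 2 * al 1%N * al 2%N
  | 6%N => al 3%N
  | _ => al 4%N
  end.

Definition field_series al h : int -> C := fun k =>
  rate al 1 * elem_diff 1 k + h * rate al 2 * elem_diff 2 k
  + h ^+ 2 * (rate al 3 * elem_diff 3 k + rate al 4 * elem_diff 4 k)
  + h ^+ 3 * (rate al 5 * elem_diff 5 k + rate al 6 * elem_diff 6 k + rate al 7 * elem_diff 7 k).

(** The parts of [series4] of order four and of order at least three,
    divided by h^4 and h^3. *)
Let tail4 al k := al 5%N * elem_diff 5 k + al 6%N * elem_diff 6 k + al 7%N * elem_diff 7 k.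
Let tail3 al h k := al 3%N * elem_diff 3 k + al 4%N * elem_diff 4 k + h * tail4 al k.

(** What the quadratic field produces along [series4] beyond the power h^3, divided
    by h^4. *)
Definition remainder al h : int -> C := fun k =>
  dkdvF (tail4 al) k + al 2%N ^+ 2 * advection N (elem_diff 2) (elem_diff 2) k
  + 2 * al 1%N * advection N (elem_diff 1) (tail3 al h) k
  + 2 * h * al 2%N * advection N (elem_diff 2) (tail3 al h) k
  + h ^+ 2 * advection N (tail3 al h) (tail3 al h) k.

Lemma dkdvFD x y k : dkdvF (fun k => x k + y k) k = dkdvF x k + dkdvF y k.
Proof. by rewrite /dkdvF advectionDr /dispersion; ring. Qed.

Lemma dkdvFZ (z : C) x k : dkdvF (fun k => z * x k) k = z * dkdvF x k.
Proof. by rewrite /dkdvF advectionZr /dispersion; ring. Qed.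

Lemma kdvF_add x k : kdvF N (fun k => v k + x k) k = kdvF N v k + dkdvF x k + advection N x x k.
Proof. by rewrite /kdvF advectionDl !advectionDr /dkdvF /dispersion (advectionC N x v); ring. Qed.

(** The Taylor expansion is exact, the field being quadratic. *)
Let kdvF_add3 (p q s : C) x y z k :
  kdvF N (fun k => v k + (p * x k + (q * y k + s * z k))) k =
  kdvF N v k + (p * dkdvF x k + q * dkdvF y k + s * dkdvF z k)
  + (p ^+ 2 * advection N x x k + 2 * p * q * advection N x y k + q ^+ 2 * advection N y y k
  + 2 * p * s * advection N x z k + 2 * q * s * advection N y z k + s ^+ 2 * advection N z z k).
Proof.
rewrite /kdvF /dkdvF /dispersion.
rewrite !(advectionDl, advectionDr) !(advectionZl, advectionZr).
rewrite (advectionC N y x) (advectionC N z x) (advectionC N z y) (advectionC N x v) (advectionC N y v) (advectionC N z v).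
by ring.
Qed.

Let dkdvF_tail3 al h k :
  dkdvF (tail3 al h) k = al 3%N * elem_diff 6 k + al 4%N * elem_diff 7 k + h * dkdvF (tail4 al) k.
Proof.
have E (p q s : C) x y z : dkdvF (fun k => p * x k + q * y k + s * z k) k =
    p * dkdvF x k + q * dkdvF y k + s * dkdvF z k by rewrite !dkdvFD !dkdvFZ.
exact: E.
Qed.

Lemma kdvF_series4 al h k : kdvF N (series4 al h) k = field_series al h k + h ^+ 4 * remainder al h k.
Proof.
have -> : series4 al h = fun k => v k +
    (h * al 1%N * elem_diff 1 k + (h ^+ 2 * al 2%N * elem_diff 2 k + h ^+ 3 * tail3 al h k)).
  by apply/funext => j; rewrite /series4 /tail3 /tail4; ring.
rewrite kdvF_add3 dkdvF_tail3.
rewrite -[advection N (elem_diff 1) (elem_diff 1) k]/(elem_diff 3 k) -[advection N (elem_diff 1) (elem_diff 2) k]/(elem_diff 5 k).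
rewrite -[dkdvF (elem_diff 1) k]/(elem_diff 2 k) -[dkdvF (elem_diff 2) k]/(elem_diff 4 k) -[kdvF N v k]/(elem_diff 1 k).
rewrite /field_series /remainder /rate.
have -> : dkdvF (tail4 al) k = al 5%N * dkdvF (elem_diff 5) k + al 6%N * dkdvF (elem_diff 6) k + al 7%N * dkdvF (elem_diff 7) k.
  have E (p q s : C) x y z : dkdvF (fun k => p * x k + q * y k + s * z k) k =
    p * dkdvF x k + q * dkdvF y k + s * dkdvF z k by rewrite !dkdvFD !dkdvFZ.
  exact: E.
move: (elem_diff 1 k) (elem_diff 2 k) (elem_diff 3 k) (elem_diff 4 k) (elem_diff 5 k) (elem_diff 6 k) (elem_diff 7 k)
 (advection N (elem_diff 2) (elem_diff 2) k) (advection N (elem_diff 1) (tail3 al h) k) (advection N (elem_diff 2) (tail3 al h) k)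
 (advection N (tail3 al h) (tail3 al h) k) (dkdvF (elem_diff 5) k) (dkdvF (elem_diff 6) k) (dkdvF (elem_diff 7) k) => *.
by ring.
Qed.

(** Each application of the field costs three derivatives: four of them build the
    elementary differentials, and a fifth one occurs in the remainder.  This is why
    fifteen derivatives of [v] are required. *)
Section Bounds.
Variable K : R.
Hypotheses (K0 : 0 <= K) (vK : wnorm N 15 v <= K).

Lemma wnormD_le m x y (p q : R) : wnorm N m x <= p -> wnorm N m y <= q ->
  wnorm N m (fun k => x k + y k) <= p + q.
Proof. by move=> hx hy; exact: le_trans (wnormD _ _ _ _) (lerD hx hy). Qed.

Lemma wnormZ_le m z x (p q : R) : normc z <= p -> wnorm N m x <= q ->
  wnorm N m (fun k => z * x k) <= p * q.
Proof. by move=> hz hx; rewrite wnormZ ler_pM ?wnorm_ge0 ?normc_ge0. Qed.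

Lemma wnorm_advection_le m x y (p q : R) : wnorm N m.+1 x <= p -> wnorm N m.+1 y <= q ->
  wnorm N m (advection N x y) <= p * q.
Proof.
by move=> hx hy; apply: le_trans (wnorm_advection _ _ _ _) _; rewrite ler_pM ?wnorm_ge0.
Qed.

Lemma wnorm_dkdvF_le m x (p : R) : (m < 15)%N -> wnorm N m.+3 x <= p ->
  wnorm N m (dkdvF x) <= p * (1 + 2 * K).
Proof.
move=> m15 hx.
have -> : p * (1 + 2 * K) = p + 2 * (K * p) by ring.
apply: wnormD_le; first exact: le_trans (wnorm_dispersion _ _ _) hx.
apply: wnormZ_le; first by rewrite -[2]/((2 : int)%:~R) normc_int ger0_norm.
apply: wnorm_advection_le; first by apply: le_trans vK; exact: wnorm_mono.
by apply: le_trans hx; apply: wnorm_mono; lia.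
Qed.

Let K1 := K + K * K.
Let G := 1 + 2 * K.

Let wnorm_elem1 : wnorm N 12 (elem_diff 1) <= K1.
Proof.
apply: wnormD_le; first exact: le_trans (wnorm_dispersion _ _ _) vK.
by apply: wnorm_advection_le; apply: le_trans vK; exact: wnorm_mono.
Qed.

Definition elem_diff_bound : R := K1 + K1 * G + K1 * K1 + K1 * G * G + K1 * (K1 * G) +
  K1 * K1 * G + K1 * G * G * G.

(** Three derivatives are kept for the remainder. *)
Lemma wnorm_elem_diff i : (0 < i)%N -> wnorm N 3 (elem_diff i) <= elem_diff_bound.
Proof.
have n1 m : (m <= 12)%N -> wnorm N m (elem_diff 1) <= K1.
  by move=> m12; exact: le_trans (wnorm_mono _ _ m12) wnorm_elem1.
have n2 m : (m <= 9)%N -> wnorm N m (elem_diff 2) <= K1 * G.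
  by move=> m12; apply: wnorm_dkdvF_le; [lia|apply: n1; lia].
have n4 m : (m <= 6)%N -> wnorm N m (elem_diff 4) <= K1 * G * G.
  by move=> m12; apply: wnorm_dkdvF_le; [lia|apply: n2; lia].
have n3 m : (m <= 11)%N -> wnorm N m (elem_diff 3) <= K1 * K1.
  by move=> m12; apply: wnorm_advection_le; apply: n1; lia.
have G0 : 0 <= G by rewrite addr_ge0 ?mulr_ge0.
have K10 : 0 <= K1 by rewrite addr_ge0 ?mulr_ge0.
have p1 : 0 <= K1 * G by exact: mulr_ge0.
have p2 : 0 <= K1 * K1 by exact: mulr_ge0.
have p3 : 0 <= K1 * G * G by exact: mulr_ge0.
have p4 : 0 <= K1 * (K1 * G) by exact: mulr_ge0.
have p5 : 0 <= K1 * K1 * G by exact: mulr_ge0.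
have p6 : 0 <= K1 * G * G * G by exact: mulr_ge0.
rewrite /elem_diff_bound.
case: i => [//|[|[|[|[|[|[|i]]]]]]] _.
- have := n1 3%N isT; lra.
- have := n2 3%N isT; lra.
- have := n3 3%N isT; lra.
- have := n4 3%N isT; lra.
- have : wnorm N 3 (elem_diff 5) <= K1 * (K1 * G) by apply: wnorm_advection_le; [exact: n1|exact: n2].
  lra.
- have : wnorm N 3 (elem_diff 6) <= K1 * K1 * G by apply: wnorm_dkdvF_le => //; exact: n3.
  lra.
- have : wnorm N 3 (elem_diff i.+3.+4) <= K1 * G * G * G by apply: wnorm_dkdvF_le => //; exact: n4.
  lra.
Qed.

Variable A : R.
Hypothesis A0 : 0 <= A.

Definition remainder_bound : R := let E := elem_diff_bound in
  (A * E + A * E + A * E) * G + A * A * (E * E) + 2 * A * (E * (5 * A * E))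
  + 2 * A * (E * (5 * A * E)) + 1 * (5 * A * E * (5 * A * E)).

Variables (al : nat -> C) (h : C).
Hypotheses (alA : forall i, normc (al i) <= A) (h1 : normc h <= 1).

Let wnorm_tail4 : wnorm N 3 (tail4 al) <= A * elem_diff_bound + A * elem_diff_bound + A * elem_diff_bound.
Proof. by do 2?[apply: wnormD_le]; apply: wnormZ_le; rewrite ?alA ?wnorm_elem_diff. Qed.

Let wnorm_tail3 : wnorm N 3 (tail3 al h) <= 5 * A * elem_diff_bound.
Proof.
have -> : 5 * A * elem_diff_bound = A * elem_diff_bound + A * elem_diff_bound +
    1 * (A * elem_diff_bound + A * elem_diff_bound + A * elem_diff_bound) by ring.
by do 2?[apply: wnormD_le]; apply: wnormZ_le; rewrite ?alA ?wnorm_elem_diff// wnorm_tail4.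
Qed.

Lemma wnorm_remainder : wnorm N 0 (remainder al h) <= remainder_bound.
Proof.
have n1 x (p : R) : wnorm N 3 x <= p -> wnorm N 1 x <= p.
  by apply: le_trans; exact: wnorm_mono.
have hM2 : normc (2 : C) = 2 by rewrite -[2]/((2 : int)%:~R) normc_int ger0_norm.
apply: wnormD_le; [apply: wnormD_le; [apply: wnormD_le; [apply: wnormD_le|]|]|].
- by apply: wnorm_dkdvF_le.
- apply: wnormZ_le; first by rewrite expr2 normcM ler_pM ?normc_ge0.
  by apply: wnorm_advection_le; apply: n1; rewrite wnorm_elem_diff.
- apply: wnormZ_le; first by rewrite normcM hM2 ler_wpM2l.
  by apply: wnorm_advection_le; apply: n1; rewrite ?wnorm_elem_diff.
- apply: wnormZ_le.
    rewrite !normcM hM2 -[2 * A]/(2 * A) -[X in X * A]mulr1.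
    by rewrite ler_pM ?mulr_ge0 ?normc_ge0 ?ler_wpM2l.
  by apply: wnorm_advection_le; apply: n1; rewrite ?wnorm_elem_diff.
- apply: wnormZ_le; last by apply: wnorm_advection_le; apply: n1.
  by rewrite expr2 normcM -[1]mulr1 ler_pM ?normc_ge0.
Qed.

Lemma wnorm_series4 : wnorm N 1 (series4 al h) <= K + 7 * (A * elem_diff_bound).
Proof.
have n1 x (p : R) : wnorm N 3 x <= p -> wnorm N 1 x <= p.
  by apply: le_trans; exact: wnorm_mono.
have hp n : normc (h ^+ n) <= 1.
  elim: n => [|n IH]; first by rewrite normc1.
  by rewrite exprS normcM mulr_ile1 ?normc_ge0.
have ha n i : normc (h ^+ n * al i) <= A.
  by rewrite normcM -[A]mul1r ler_pM ?normc_ge0.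
have E0 : 0 <= elem_diff_bound by apply: le_trans (wnorm_elem_diff (isT : (0 < 1)%N)); exact: wnorm_ge0.
apply: wnormD_le; first by apply: le_trans vK; exact: wnorm_mono.
have -> : 7 * (A * elem_diff_bound) = A * elem_diff_bound + A * elem_diff_bound +
   1 * (A * elem_diff_bound + A * elem_diff_bound) +
   1 * (A * elem_diff_bound + A * elem_diff_bound + A * elem_diff_bound) by ring.
apply: wnormD_le; [apply: wnormD_le; [apply: wnormD_le|]|].
- by apply: wnormZ_le; [rewrite -[h]expr1|apply: n1; rewrite wnorm_elem_diff].
- by apply: wnormZ_le => //; apply: n1; rewrite wnorm_elem_diff.
- apply: wnormZ_le => //.
  by apply: wnormD_le; apply: wnormZ_le; rewrite ?alA// n1// wnorm_elem_diff.
- by apply: wnormZ_le => //; apply: n1; exact: wnorm_tail4.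
Qed.

End Bounds.

Lemma herm_elem_diff i : herm v -> herm (elem_diff i).
Proof.
move=> hv; have hF := herm_kdvF N hv.
have hl x : herm x -> herm (dkdvF x).
  move=> hx; apply: hermD; first exact: herm_dispersion.
  by move=> k; rewrite [RHS]conjcM conjc_nat herm_advection.
have ha := herm_advection N hF hF.
by case: i => [|[|[|[|[|[|[|i]]]]]]]; [do 3!apply: (hl)| |exact: hl| |do 2!apply: (hl)
  |apply: herm_advection => //; exact: hl|exact: hl|do 3!apply: (hl)].
Qed.

Lemma herm_series4 al h : herm v -> conjc h = h -> (forall i, conjc (al i) = al i) ->
  herm (series4 al h).
Proof.
move=> hv hh ha.
have hz z x : conjc z = z -> herm x -> herm (fun k => z * x k).
  by move=> hz hx k; rewrite hx conjcM hz.
have hM (z w : C) : conjc z = z -> conjc w = w -> conjc (z * w) = z * w.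
  by move=> hz' hw; rewrite conjcM hz' hw.
have hp n : conjc (h ^+ n) = h ^+ n.
  by elim: n => [|n IH]; [rewrite conjc1|rewrite exprS hM].
have he i := herm_elem_diff i hv.
apply: (hermD hv); apply: hermD; [apply: hermD; [apply: hermD|]|].
- by apply: (hz); [exact: hM|exact: he].
- by apply: (hz); [exact: hM|exact: he].
- by apply: (hz) => //; apply: hermD; apply: (hz).
- by apply: (hz) => //; apply: hermD; [apply: hermD|]; apply: (hz).
Qed.

End Expansion.

(** * Order conditions and stability of the composed midpoint rule *)

Section Composition.
Variable R : realType.
Local Notation C := (R[i]).

(** This is 2 b1^3 + (1 - 2 b1)^3 = 0 expanded, with the sign changed; it holds since
    b1 = 1 / (2 - c) and 1 - 2 b1 = - c / (2 - c) with c^3 = 2. *)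
Lemma triple_jump : 6 * b1 R ^+ 3 - 12 * b1 R ^+ 2 + 6 * b1 R - 1 = 0.
Proof.
rewrite /b1; set c : R := 2 `^ (1 / 3).
have c3 : c ^+ 3 = 2.
  by rewrite -powR_mulrn ?powR_ge0// -powRrM -mulrA mulVf ?mulr1 ?mulr1 ?powRr1.
have c2 : 2 - c != 0.
  apply/eqP => h; have e : c = 2 by lra.
  by move: c3; rewrite e; lra.
have -> : 6 * (2 - c)^-1 ^+ 3 - 12 * (2 - c)^-1 ^+ 2 + 6 * (2 - c)^-1 - 1 =
   (c ^+ 3 - 2) * (2 - c)^-1 ^+ 3 by field.
by rewrite c3 subrr mul0r.
Qed.

Definition mean2 (p q : nat -> C) (i : nat) : C := (q i + p i) / 2.

(** One implicit midpoint step of size [be] for the equation al' = [rate al].  Each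
    component of [rate] involves only earlier ones, so that the implicit equations
    are solved one after the other. *)
Definition substep (be : C) (p : nat -> C) : nat -> C :=
  let q1 := p 1%N + be in
  let m1 := (q1 + p 1%N) / 2 in
  let q2 := p 2%N + be * m1 in
  let m2 := (q2 + p 2%N) / 2 in
  let q3 := p 3%N + be * m1 ^+ 2 in
  let q4 := p 4%N + be * m2 in
  fun i => match i with
  | 1%N => q1
  | 2%N => q2
  | 3%N => q3
  | 4%N => q4
  | 5%N => p 5%N + be * (2 * m1 * m2)
  | 6%N => p 6%N + be * ((q3 + p 3%N) / 2)
  | _ => p 7%N + be * ((q4 + p 4%N) / 2)
  end.

Fixpoint stage_coef (n : nat) : nat -> C :=
  if n is n'.+1 then substep (b R n)%:C (stage_coef n') else fun=> 0.

(** The solution at time 1 of al' = [rate al] with al(0) = 0: the Taylor coefficients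
    of the exact flow. *)
Definition flow_coef (i : nat) : C :=
  match i with
  | 1%N => 1 | 2%N => 1 / 2 | 3%N => 1 / 3 | 4%N => 1 / 6
  | 5%N => 1 / 4 | 6%N => 1 / 12 | _ => 1 / 24
  end.

(** The conditions for f, f'f and f''(f,f'f) hold for every b1.  In the four others
    the difference of the two sides is a multiple of the cubic of [triple_jump]; the
    multipliers below are the quotients. *)
Lemma stage_coef_order4 i : (0 < i <= 7)%N -> stage_coef 3 i = flow_coef i.
Proof.
have cM (x y : R) : (x * y)%:C = x%:C * y%:C by exact: rmorphM.
have cD (x y : R) : (x + y)%:C = x%:C + y%:C by exact: rmorphD.
have cN (x : R) : (- x)%:C = - x%:C by exact: rmorphN.
have cn n : (n%:R : R)%:C = n%:R by exact: rmorph_nat.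
have c1 : (1 : R)%:C = 1 by [].
have cX (x : R) n : (x ^+ n)%:C = x%:C ^+ n by exact: rmorphXn.
set x := b1 R; have tj : 6 * x ^+ 3 - 12 * x ^+ 2 + 6 * x - 1 = 0 := triple_jump.
have E : 6 * x%:C ^+ 3 - 12 * x%:C ^+ 2 + 6 * x%:C - 1 = 0.
  rewrite -(cX x 3%N) -(cX x 2%N) -(cn 6%N) -(cn 12%N) -c1.
  rewrite -(cM 6 (x ^+ 3)) -(cM 12 (x ^+ 2)) -(cM 6 x) -(cN (12 * x ^+ 2)) -(cN 1).
  by rewrite -!cD tj.
have E2 : (1 - 2 * x)%:C = 1 - 2 * x%:C.
  by rewrite (cD 1 (- (2 * x))) (cN (2 * x)) (cM 2 x) (cn 2%N) c1.
rewrite /stage_coef /b /= -/x E2; move: x%:C E => be E {E2 tj x}.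
have lin0 x y (z : C) : x - y = z * (6 * be ^+ 3 - 12 * be ^+ 2 + 6 * be - 1) -> x = y.
  by rewrite E mulr0 => /eqP; rewrite subr_eq0 => /eqP.
case: i => [//|[|[|[|[|[|[|[|//]]]]]]]] _; cbv beta iota zeta delta [substep flow_coef].
- by field.
- by field.
- by apply: (lin0 _ _ (1 / 12)); field.
- by apply: (lin0 _ _ (- (1 / 12))); field.
- by field.
- by apply: (lin0 _ _ (- (1 / 24))); field.
- by apply: (lin0 _ _ (- (1 / 12))); field.
Qed.

Lemma conj_stage_coef n i : conjc (stage_coef n i) = stage_coef n i.
Proof.
elim: n i => [|n IH] i; first by rewrite conjc0.
rewrite [stage_coef _]/(substep (b R n.+1)%:C (stage_coef n)).
have hb : conjc (b R n.+1)%:C = (b R n.+1)%:C by rewrite conjc_real.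
have h2 : conjc (2^-1 : C) = 2^-1 by rewrite conjc_inv conjc_nat.
have r2 : conjc (2 : C) = 2 by rewrite conjc_nat.
have rM (z w : C) : conjc z = z -> conjc w = w -> conjc (z * w) = z * w.
  by move=> hz hw; rewrite conjcM hz hw.
have rD (z w : C) : conjc z = z -> conjc w = w -> conjc (z + w) = z + w.
  by move=> hz hw; rewrite conjcD hz hw.
by case: i => [|[|[|[|[|[|[|i]]]]]]]; rewrite /substep ?expr2;
  do ?[exact: hb | exact: IH | exact: h2 | exact: r2 | apply: (rM) | apply: (rD)].
Qed.

Variables (N : nat) (v : int -> C).

(** The expansions of two successive stages satisfy the midpoint equation up to
    the remainder of the field at their mean. *)
Lemma series4_stage (h : C) n k :
  series4 N v (stage_coef n.+1) h k = series4 N v (stage_coef n) h k +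
    h * (b R n.+1)%:C *
      (kdvF N (fun l => (series4 N v (stage_coef n.+1) h l + series4 N v (stage_coef n) h l) / 2) k
       - h ^+ 4 * remainder N v (mean2 (stage_coef n) (stage_coef n.+1)) h k).
Proof.
have -> : (fun l => (series4 N v (stage_coef n.+1) h l + series4 N v (stage_coef n) h l) / 2) =
    series4 N v (mean2 (stage_coef n) (stage_coef n.+1)) h.
  by apply/funext => l; rewrite /series4 /mean2; field.
rewrite kdvF_series4 [_ + _ - _]addrK /series4 /field_series /rate /mean2.
rewrite [stage_coef n.+1]/(substep (b R n.+1)%:C (stage_coef n)) /substep.
move: (stage_coef n) (b R n.+1)%:C => p be.
move: (elem_diff N v 1 k) (elem_diff N v 2 k) (elem_diff N v 3 k) (elem_diff N v 4 k) (elem_diff N v 5 k)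
  (elem_diff N v 6 k) (elem_diff N v 7 k) => *.
by field.
Qed.

(** These coefficients depend on b1 only, so that a maximum over finitely many of
    them is a bound. *)
Lemma stage_coef_bounded : exists2 A : R, 0 <= A &
  (forall n i, (n <= 3)%N -> normc (stage_coef n i) <= A) /\
  (forall n i, (n < 3)%N -> normc (mean2 (stage_coef n) (stage_coef n.+1) i) <= A).
Proof.
exists (\sum_(n < 4) \sum_(i < 8) normc (stage_coef n i)).
  by do 2!apply: sumr_ge0 => ? _; exact: normc_ge0.
have bd n i : (n <= 3)%N ->
    normc (stage_coef n i) <= \sum_(n < 4) \sum_(i < 8) normc (stage_coef n i).
  move=> n3; have [j jE] : exists j : 'I_8, stage_coef n i = stage_coef n j.
    have [i8|i8] := ltnP i 8; first by exists (Ordinal i8).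
    exists ord_max; case: n {n3} => [//|n].
    by do 8?[case: i i8 => // i i8].
  rewrite (bigD1 (Ordinal (n3 : (n < 4)%N))) //= (bigD1 j) //= jE -addrA lerDl.
  by rewrite addr_ge0 ?sumr_ge0 // => ? _; rewrite ?sumr_ge0 // => *; exact: normc_ge0.
split=> // n i n3; rewrite /mean2 normcM.
have -> : normc (2^-1 : C) = 2^-1 by rewrite normcV -[2]/((2 : int)%:~R) normc_int ger0_norm.
rewrite ler_pdivrMr //; apply: le_trans (le_normcD _ _) _.
by rewrite mulr_natr mulr2n lerD ?bd // ltnW.
Qed.

End Composition.

Section Midpoint.
Variables (R : realType) (N : nat).
Local Notation C := (R[i]).
Implicit Types (a e : int -> C).

Lemma normc2E (z : C) : normc z ^+ 2 = complex.Re z ^+ 2 + complex.Im z ^+ 2.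
Proof. by case: z => x y; rewrite /normc sqr_sqrtr // addr_ge0 ?sqr_ge0. Qed.

Lemma reinner_le a e : `|reinner N a e| <= wnorm N 0 a * Num.sqrt (sqnorm N e).
Proof.
apply: le_trans (normc_re _) _; apply: le_trans (normc_sum _ _) _.
rewrite /wnorm mulr_suml; apply: ler_sum => j _; rewrite expr0 mul1r normcM.
apply: ler_wpM2l; first exact: normc_ge0.
have -> : normc (conjc (e (freq j))) = normc (e (freq j)).
  by case: (e _) => x y; rewrite /normc /= sqrrN.
rewrite -[leLHS]ger0_norm ?normc_ge0// -sqrtr_sqr ler_wsqrtr //.
by rewrite /sqnorm (bigD1 j) //= lerDl sumr_ge0 // => *; exact: sqr_ge0.
Qed.

Lemma reinnerZl (x : R) a e : reinner N (fun k => x%:C * a k) e = x * reinner N a e.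
Proof.
rewrite /reinner; under eq_bigr => k _ do rewrite -mulrA.
by rewrite -mulr_sumr; case: (\sum_(_ < _) _) => ? ? /=; rewrite mul0r subr0.
Qed.

Lemma sqnorm_diff a a' : sqnorm N a' - sqnorm N a =
  reinner N (fun k => a' k - a k) (fun k => a' k + a k).
Proof.
rewrite /reinner (raddf_sum (@complex.Re R : Rcomplex R -> R)) /sqnorm -sumrB.
apply: eq_bigr => j _; rewrite !normc2E.
by case: (a _) (a' _) => [x y] [x' y'] /=; ring.
Qed.

Lemma sqnorm_mean a a' : sqnorm N (fun k => (a' k + a k) / 2) <= (sqnorm N a' + sqnorm N a) / 2.
Proof.
rewrite /sqnorm -big_split mulr_suml /=; apply: ler_sum => j _; rewrite !normc2E.
have -> : (a' (freq j) + a (freq j)) / 2 = (2^-1)%:C * (a' (freq j) + a (freq j)).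
  by rewrite mulrC fmorphV /= rmorph_nat.
case: (a _) (a' _) => [x y] [x' y'] /=; rewrite !mul0r addr0 subr0.
have := sqr_ge0 (x - x'); have := sqr_ge0 (y - y'); lra.
Qed.

Lemma eq_reinner a a' e : (forall k, (`|k| <= N)%N -> a k = a' k) -> reinner N a e = reinner N a' e.
Proof. by move=> h; rewrite /reinner; congr complex.Re; apply: eq_bigr => j _; rewrite h ?freq_le. Qed.

(** Testing the difference of the two equations with the sum of the new and the old
    perturbation telescopes the squared norms on the left; on the right the field
    is evaluated at states that differ by the mean of the perturbations, where
    [energy] applies.  No power of N enters. *)
Lemma midpoint_stable (x Q : R) (V V' W W' r : int -> C) :
  herm V -> herm V' -> herm W -> herm W' ->
  (forall k, (`|k| <= N)%N -> V' k = V k + x%:C * kdvF N (fun l => (V' l + V l) / 2) k) ->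
  (forall k, (`|k| <= N)%N -> W' k = W k + x%:C * (kdvF N (fun l => (W' l + W l) / 2) k - r k)) ->
  wnorm N 1 (fun l => (W' l + W l) / 2) <= Q -> `|x| * Q <= 1 / 4 ->
  sqnorm N (fun k => V' k - W' k) <= 3 * sqnorm N (fun k => V k - W k) + 4 * (x * wnorm N 0 r) ^+ 2.
Proof.
move=> hV hV' hW hW' eV eW nQ xQ.
set d := fun k => V k - W k; set d' := fun k => V' k - W' k.
set w := fun l => (W' l + W l) / 2 in nQ eW.
set e := fun l => (d' l + d l) / 2.
have he : herm e.
  by move=> k; rewrite /e /d /d' hV hV' hW hW' !(conjcM, conjcD, conjcN) conjc_inv conjc_nat.
have D : sqnorm N d' - sqnorm N d = x * (2 * (reinner N (fun k => kdvF N (fun l => w l + e l) k - kdvF N w k) e + reinner N r e)).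
  rewrite sqnorm_diff -reinnerDl.
  have -> : (fun k => d' k + d k) = (fun k => 2 * e k).
    by apply/funext => k; rewrite /e mulrC divfK.
  have ip2 u : reinner N u (fun k => 2 * e k) = reinner N (fun k => 2%:C * u k) e.
    rewrite /reinner; congr complex.Re; apply: eq_bigr => j _.
    by rewrite conjcM conjc_nat mulrCA mulrA rmorph_nat.
  rewrite ip2 -!reinnerZl; apply: eq_reinner => k kN.
  rewrite /d' /d eV // eW //.
  have -> : (fun l => w l + e l) = (fun l => (V' l + V l) / 2).
    by apply/funext => l; rewrite /w /e /d' /d; field.
  rewrite (rmorph_nat (real_complex R)); ring.
have E := energy N w he.
have I := reinner_le r e.
have M := sqnorm_mean d d'; rewrite -/e in M.
have s0 := sqrtr_ge0 (sqnorm N e).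
have s2 : Num.sqrt (sqnorm N e) ^+ 2 = sqnorm N e by rewrite sqr_sqrtr ?sqnorm_ge0.
have y0 := sqnorm_ge0 N d; have y1 := sqnorm_ge0 N d'; have y2 := sqnorm_ge0 N e.
have r0 := wnorm_ge0 N 0 r.
have B1 : x * reinner N (fun k => kdvF N (fun l => w l + e l) k - kdvF N w k) e <= 1 / 4 * sqnorm N e.
  apply: le_trans (ler_norm _) _; rewrite normrM.
  apply: le_trans (ler_wpM2l (normr_ge0 _) E) _; rewrite mulrA.
  apply: ler_wpM2r => //; apply: le_trans xQ.
  by apply: ler_wpM2l; rewrite ?normr_ge0.
have B2 : x * reinner N r e <= (x * wnorm N 0 r) ^+ 2 + 1 / 4 * sqnorm N e.
  apply: le_trans (ler_norm _) _; rewrite normrM.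
  apply: le_trans (ler_wpM2l (normr_ge0 _) I) _; rewrite mulrA.
  have -> : (x * wnorm N 0 r) ^+ 2 = (`|x| * wnorm N 0 r) ^+ 2.
    by rewrite !exprMn real_normK ?num_real.
  rewrite -[X in 1 / 4 * X]s2.
  move: (`|x| * wnorm N 0 r) (Num.sqrt _) => p q; have := sqr_ge0 (p - q / 2); nra.
lra.
Qed.

End Midpoint.

(** * Gronwall's inequality and stability of the flow *)

Section WithinContinuous.
Variables (R : realType) (A : set R).
Implicit Types f g : R -> R.

Lemma within_contD f g : {within A, continuous f} -> {within A, continuous g} ->
  {within A, continuous (fun x => f x + g x)}.
Proof. by move=> cf cg x; apply: cvgD; [exact: cf|exact: cg]. Qed.

Lemma within_contB f g : {within A, continuous f} -> {within A, continuous g} ->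
  {within A, continuous (fun x => f x - g x)}.
Proof. by move=> cf cg x; apply: cvgB; [exact: cf|exact: cg]. Qed.

Lemma within_contM f g : {within A, continuous f} -> {within A, continuous g} ->
  {within A, continuous (fun x => f x * g x)}.
Proof. by move=> cf cg x; apply: cvgM; [exact: cf|exact: cg]. Qed.

Lemma within_cont_sum (I : finType) (F : I -> R -> R) :
  (forall i, {within A, continuous (F i)}) ->
  {within A, continuous (fun x => \sum_i F i x)}.
Proof.
move=> cF; rewrite -fct_sumE; elim/big_ind : _ => [|f g cf cg|i _].
- by move=> x; exact: cvg_cst.
- exact: within_contD.
- exact: cF.
Qed.

Lemma within_derive f f' : (forall x : R, is_derive x 1 f (f' x)) ->
  {within A, continuous f}.
Proof.
move=> df; apply: continuous_subspaceT => x.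
by apply: differentiable_continuous; apply/derivable1_diffP; have [] := df x.
Qed.

End WithinContinuous.

Lemma is_derive_fsum (R : realType) (I : finType) (h : I -> R -> R) (dh : I -> R) (x : R) :
  (forall i, is_derive x 1 (h i) (dh i)) ->
  is_derive x 1 (fun y => \sum_i h i y) (\sum_i dh i).
Proof.
move=> H; rewrite -fct_sumE.
by elim/big_ind2 : _ => // [|] *; [exact: is_derive_cst|exact: is_deriveD].
Qed.

Section Gronwall.
Variable R : realType.
Implicit Types (f y : R -> R) (a t : R).

Lemma gronwall (y y' : R -> R) a e (L c : R) : 0 <= L -> 0 <= c ->
  {within `[a, e], continuous y} ->
  (forall t, t \in `]a, e[ -> is_derive t 1 y (y' t)) ->
  (forall t, t \in `]a, e[ -> y' t <= L * y t + c) ->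
  forall t, t \in `[a, e] -> y t <= (y a + c * (t - a)) * expR (L * (t - a)).
Proof.
move=> L0 c0 cy dy hy t tae.
pose g s := expR (- L * (s - a)).
pose z s := y s * g s - c * (s - a).
have dg (s : R) : is_derive s 1 g (g s * (- L)).
  have d1 : is_derive s 1 (fun s => - L * (s - a)) (- L).
    by apply: is_derive_eq; rewrite subr0 /GRing.scale /= mulr1.
  exact: (@is_derive1_comp _ expR (fun s => - L * (s - a))).
have dl (s : R) : is_derive s 1 (fun s => c * (s - a)) c.
  by apply: is_derive_eq; rewrite subr0 /GRing.scale /= mulr1.
have dz s : s \in `]a, e[ -> is_derive s 1 z (y s * (g s * (- L)) + g s * y' s - c).
  by move=> sae; have := dy _ sae => dys; apply: (is_deriveB (is_deriveM dys (dg s)) (dl s)).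
have cz : {within `[a, e], continuous z}.
  by apply: within_contB (within_derive dl); apply: within_contM (within_derive dg).
have zt : z t <= z a.
  have /andP[lat lte] : a <= t <= e by move: tae; rewrite in_itv.
  apply: (@ler0_derive1_nincr R z a e) => //.
    by move=> s sae; have [] := dz _ sae.
  move=> s sae; rewrite derive1E; have /@derive_val -> := dz _ sae.
  have g1 : g s <= 1.
    rewrite /g -expR0 ler_expR mulNr oppr_le0 mulr_ge0 // subr_ge0.
    by rewrite ltW // (itvP sae).
  have g0 : 0 < g s by exact: expR_gt0.
  have -> : y s * (g s * - L) + g s * y' s - c = g s * (y' s - L * y s) - c by ring.
  rewrite subr_le0; apply: le_trans (_ : g s * c <= _).
    by rewrite ler_pM2l // lerBlDl hy.
  by rewrite ler_piMl.
have {zt} : y t * g t <= y a + c * (t - a).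
  have ga : g a = 1 by rewrite /g subrr mulr0 expR0.
  by move: zt; rewrite /z ga subrr mulr0 mulr1 subr0; lra.
have -> : expR (L * (t - a)) = (g t)^-1 by rewrite /g -expRN mulNr opprK.
by rewrite ler_pdivlMr // expR_gt0.
Qed.

End Gronwall.

Section Flow.
Variables (R : realType) (N : nat).
Local Notation C := (R[i]).
Implicit Types (c p r : R -> int -> C).

(** A curve of coefficients with derivative [c']: continuity up to the end points and
    differentiability inside are what the mean value theorem asks for. *)
Definition coef_curve (a e : R) c c' := forall k, (`|k| <= N)%N ->
  [/\ {within `[a, e], continuous (fun t => complex.Re (c t k))},
      {within `[a, e], continuous (fun t => complex.Im (c t k))},
      forall t, t \in `]a, e[ -> is_derive t 1 (fun t => complex.Re (c t k)) (complex.Re (c' t k)) &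
      forall t, t \in `]a, e[ -> is_derive t 1 (fun t => complex.Im (c t k)) (complex.Im (c' t k))].

Lemma coef_curveB a e c c' p p' : coef_curve a e c c' -> coef_curve a e p p' ->
  coef_curve a e (fun t k => c t k - p t k) (fun t k => c' t k - p' t k).
Proof.
move=> hc hp k kN; have [cc1 cc2 cd1 cd2] := hc k kN; have [pc1 pc2 pd1 pd2] := hp k kN.
have re (z w : C) : complex.Re (z - w) = complex.Re z - complex.Re w by case: z w => ? ? [].
have im (z w : C) : complex.Im (z - w) = complex.Im z - complex.Im w by case: z w => ? ? [].
have reE : (fun t => complex.Re (c t k - p t k)) =
    (fun t => complex.Re (c t k) - complex.Re (p t k)) by apply/funext => t; exact: re.
have imE : (fun t => complex.Im (c t k - p t k)) =
    (fun t => complex.Im (c t k) - complex.Im (p t k)) by apply/funext => t; exact: im.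
rewrite reE imE; split.
- exact: within_contB cc1 pc1.
- exact: within_contB cc2 pc2.
- by move=> t tae; rewrite re; exact: is_deriveB (cd1 t tae) (pd1 t tae).
- by move=> t tae; rewrite im; exact: is_deriveB (cd2 t tae) (pd2 t tae).
Qed.

Lemma sqnorm_continuous a e c c' : coef_curve a e c c' ->
  {within `[a, e], continuous (fun t => sqnorm N (c t))}.
Proof.
move=> hc; rewrite /sqnorm.
apply: within_cont_sum => j; have [cc1 cc2 _ _] := hc _ (freq_le j).
have -> : (fun t => normc (c t (freq j)) ^+ 2) = (fun t =>
    complex.Re (c t (freq j)) * complex.Re (c t (freq j)) +
    complex.Im (c t (freq j)) * complex.Im (c t (freq j))).
  by apply/funext => t; rewrite normc2E !expr2.
by apply: within_contD; apply: within_contM.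
Qed.

Lemma sqnorm_derive a e c c' t : coef_curve a e c c' -> t \in `]a, e[ ->
  is_derive t 1 (fun t => sqnorm N (c t)) (2 * reinner N (c' t) (c t)).
Proof.
move=> hc tae; rewrite /reinner (raddf_sum (@complex.Re R : Rcomplex R -> R)) mulr_sumr.
have -> : (fun t => sqnorm N (c t)) = (fun t => \sum_(j < N.*2.+1)
    (complex.Re (c t (freq j)) * complex.Re (c t (freq j)) +
     complex.Im (c t (freq j)) * complex.Im (c t (freq j)))).
  by apply/funext => s; apply: eq_bigr => j _; rewrite normc2E !expr2.
apply: is_derive_fsum => j; have [_ _ cd1 cd2] := hc _ (freq_le j).
have d1 := cd1 t tae; have d2 := cd2 t tae.
have := is_deriveD (is_deriveM d1 d1) (is_deriveM d2 d2).
congr is_derive; rewrite /GRing.scale /=.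
by case: (c' t _) (c t _) => [x y] [x' y'] /=; ring.
Qed.

(** The parameter [delta] splits the product of the residual and the error.  Over a
    step of length k the choice [delta = k] yields an error of order k rho, where
    [delta = 1] would only give k^(1/2) rho. *)
Lemma flow_stable (a e Q rho delta : R) c p r : 0 < delta -> 0 <= Q ->
  (forall t, t \in `]a, e[ -> herm (c t)) ->
  (forall t, t \in `]a, e[ -> herm (p t)) ->
  coef_curve a e c (fun t => kdvF N (c t)) ->
  coef_curve a e p (fun t k => kdvF N (p t) k + r t k) ->
  (forall t, t \in `]a, e[ -> wnorm N 1 (p t) <= Q) ->
  (forall t, t \in `]a, e[ -> wnorm N 0 (r t) <= rho) ->
  forall t, t \in `[a, e] -> sqnorm N (fun k => c t k - p t k) <=
    (sqnorm N (fun k => c a k - p a k) + delta * rho ^+ 2 * (t - a))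
    * expR ((2 * Q + delta^-1) * (t - a)).
Proof.
move=> d0 Q0 hc hp dc dp pQ rr.
have hcp := coef_curveB dc dp.
apply: gronwall.
- by rewrite addr_ge0 ?mulr_ge0 ?invr_ge0 // ltW.
- by rewrite mulr_ge0 ?sqr_ge0 // ltW.
- exact: sqnorm_continuous hcp.
- move=> t tae; exact: sqnorm_derive hcp tae.
move=> t tae /=; set ee := fun k => c t k - p t k.
have he : herm ee by apply: hermB; [exact: hc|exact: hp].
have -> : reinner N (fun k => kdvF N (c t) k - (kdvF N (p t) k + r t k)) ee =
   reinner N (fun k => kdvF N (fun l => p t l + ee l) k - kdvF N (p t) k) ee
   + reinner N (fun k => (- 1)%:C * r t k) ee.
  rewrite -reinnerDl; congr reinner; apply/funext => k.
  have -> : (fun l => p t l + ee l) = c t by apply/funext => l; rewrite /ee addrC subrK.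
  by rewrite rmorphN1 mulN1r opprD addrA.
rewrite reinnerZl.
have E := energy N (p t) he.
have I := reinner_le N (r t) ee.
have := pQ t tae; have := rr t tae => r1 Q1.
have y0 := sqnorm_ge0 N ee.
have s0 := sqrtr_ge0 (sqnorm N ee).
have s2 : Num.sqrt (sqnorm N ee) ^+ 2 = sqnorm N ee by rewrite sqr_sqrtr.
have n0 := wnorm_ge0 N 0 (r t).
have {}E : reinner N (fun k => kdvF N (fun l => p t l + ee l) k - kdvF N (p t) k) ee <= Q * sqnorm N ee.
  apply: le_trans (ler_norm _) _; apply: le_trans E _.
  by rewrite ler_wpM2r.
have {I} I1 : -1 * reinner N (r t) ee <= rho * Num.sqrt (sqnorm N ee).
  rewrite mulN1r; apply: le_trans (ler_norm _) _; rewrite normrN.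
  by apply: le_trans I _; rewrite ler_wpM2r.
have I2 : 2 * (rho * Num.sqrt (sqnorm N ee)) <= delta * rho ^+ 2 + delta^-1 * sqnorm N ee.
  rewrite -[in X in _ <= _ + X]s2; move: (Num.sqrt _) => s.
  rewrite -subr_ge0.
  have -> : delta * rho ^+ 2 + delta^-1 * s ^+ 2 - 2 * (rho * s) = delta^-1 * (delta * rho - s) ^+ 2.
    by field; rewrite gt_eqF.
  by rewrite mulr_ge0 ?sqr_ge0 // invr_ge0 ltW.
have -> : (2 * Q + delta^-1) * sqnorm N ee + delta * rho ^+ 2 =
  2 * (Q * sqnorm N ee) + (delta * rho ^+ 2 + delta^-1 * sqnorm N ee) by ring.
lra.
Qed.

End Flow.

(** * Trigonometric polynomials and the discrete Fourier transform *)

Section Exponentials.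
Variable R : realType.
Local Notation C := (R[i]).
Implicit Types (k l : int) (x y : R).

Lemma expiDl k l x : expi (k + l) x = expi k x * expi l x.
Proof.
apply/eqP; rewrite eq_complex /= intrD mulrDl cosD sinD eqxx /=.
by apply/eqP; ring.
Qed.

Lemma expiDr k x y : expi k (x + y) = expi k x * expi k y.
Proof.
apply/eqP; rewrite eq_complex /= mulrDr cosD sinD eqxx /=.
by apply/eqP; ring.
Qed.

Lemma expi0 x : expi 0 x = 1 :> C.
Proof. by rewrite /expi mul0r cos0 sin0. Qed.

Lemma expiN k x : expi (- k) x = conjc (expi k x).
Proof. by rewrite /expi intrN mulNr cosN sinN. Qed.

Lemma normc_expi k x : normc (expi k x) = 1.
Proof. by rewrite /normc /expi cos2Dsin2 sqrtr1. Qed.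

Lemma expi_2pi k : expi k (pi *+ 2) = 1 :> C.
Proof.
have nat_case (n : nat) : expi n (pi *+ 2) = 1 :> C.
  elim: n => [|n IH]; first by rewrite expi0.
  by rewrite -addn1 PoszD expiDl IH mul1r /expi mul1r cos2pi sin2pi.
by case: k => n; rewrite ?NegzE ?expiN nat_case // conjc1.
Qed.

Lemma expi_neq1 k x : 0 < `|k%:~R * x| < pi *+ 2 -> expi k x <> 1 :> C.
Proof.
move=> /andP[h0 h1] [c1 _].
set y := k%:~R * x in h0 h1 c1.
have s0 : 0 < sin (`|y| / 2).
  by apply: sin_gt0_pi; rewrite divr_gt0 //= ltr_pdivrMr // mulr_natr.
have : cos `|y| = 1 by case: (ger0P y) => _; rewrite ?cosN.
have -> : `|y| = `|y| / 2 + `|y| / 2 by field.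
by rewrite cosD -!expr2 cos2sin2; nra.
Qed.

Lemma is_derive_coskx k x : is_derive x 1 (fun y => cos (k%:~R * y)) (- (k%:~R * sin (k%:~R * x))).
Proof.
have d1 : is_derive x 1 (fun y => k%:~R * y) (k%:~R : R).
  by apply: is_derive_eq; rewrite /GRing.scale /= mulr1.
have := @is_derive1_comp _ cos (fun y => k%:~R * y) x _ _ _ d1.
by move=> /(_ _ (is_derive_cos _)); rewrite mulNr mulrC.
Qed.

Lemma is_derive_sinkx k x : is_derive x 1 (fun y => sin (k%:~R * y)) (k%:~R * cos (k%:~R * x)).
Proof.
have d1 : is_derive x 1 (fun y => k%:~R * y) (k%:~R : R).
  by apply: is_derive_eq; rewrite /GRing.scale /= mulr1.
have := @is_derive1_comp _ sin (fun y => k%:~R * y) x _ _ _ d1.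
by move=> /(_ _ (is_derive_sin _)); rewrite mulrC.
Qed.

End Exponentials.

(** Trigonometric polynomials are indexed by an arbitrary finite type, so that the
    product of two of them is again one, indexed by pairs. *)
Section TrigPoly.
Variables (R : realType) (I : finType).
Local Notation C := (R[i]).
Implicit Types (c : I -> C) (kap : I -> int) (v : R -> R).

Definition trigpoly c kap (x : R) : C := \sum_i c i * expi (kap i) x.

Lemma Re_sum (J : finType) (P : pred J) (h : J -> C) :
  complex.Re (\sum_(j | P j) h j) = \sum_(j | P j) complex.Re (h j).
Proof. exact: (raddf_sum (@complex.Re R : Rcomplex R -> R)). Qed.

Lemma Im_sum (J : finType) (P : pred J) (h : J -> C) :
  complex.Im (\sum_(j | P j) h j) = \sum_(j | P j) complex.Im (h j).
Proof. exact: (raddf_sum (@complex.Im R : Rcomplex R -> R)). Qed.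

Lemma ReMexpi (z : C) k (x : R) : complex.Re (z * expi k x) =
  complex.Re z * cos (k%:~R * x) - complex.Im z * sin (k%:~R * x).
Proof. by case: z. Qed.

Lemma ImMexpi (z : C) k (x : R) : complex.Im (z * expi k x) =
  complex.Re z * sin (k%:~R * x) + complex.Im z * cos (k%:~R * x).
Proof. by case: z. Qed.

Definition deriv_trig c kap : I -> C := fun i => 'i%C * (kap i)%:~R * c i.

Let dtrigE c kap i : (deriv_trig c kap i) = (- ((kap i)%:~R * complex.Im (c i))) +i* ((kap i)%:~R * complex.Re (c i)).
Proof.
rewrite /deriv_trig (_ : ((kap i)%:~R : C) = ((kap i)%:~R : R)%:C); last by rewrite rmorph_int.
case: (c i) => a b; apply/eqP; rewrite eq_complex /=; apply/andP; split; apply/eqP; ring.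
Qed.

Lemma is_derive_Re_trig c kap (x : R) : is_derive x 1 (fun y => complex.Re (trigpoly c kap y))
  (complex.Re (trigpoly (deriv_trig c kap) kap x)).
Proof.
have -> : (fun y => complex.Re (trigpoly c kap y)) = (fun y => \sum_i
    (complex.Re (c i) * cos ((kap i)%:~R * y) - complex.Im (c i) * sin ((kap i)%:~R * y))).
  apply/funext => y; rewrite Re_sum; apply: eq_bigr => i _; exact: ReMexpi.
rewrite Re_sum; apply: is_derive_fsum => i.
have d1 := is_derive_coskx (kap i) x; have d2 := is_derive_sinkx (kap i) x.
apply: is_derive_eq; rewrite ReMexpi dtrigE /GRing.scale /=; ring.
Qed.

Lemma is_derive_Im_trig c kap (x : R) : is_derive x 1 (fun y => complex.Im (trigpoly c kap y))
  (complex.Im (trigpoly (deriv_trig c kap) kap x)).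
Proof.
have -> : (fun y => complex.Im (trigpoly c kap y)) = (fun y => \sum_i
    (complex.Re (c i) * sin ((kap i)%:~R * y) + complex.Im (c i) * cos ((kap i)%:~R * y))).
  apply/funext => y; rewrite Im_sum; apply: eq_bigr => i _; exact: ImMexpi.
rewrite Im_sum; apply: is_derive_fsum => i.
have d1 := is_derive_coskx (kap i) x; have d2 := is_derive_sinkx (kap i) x.
apply: is_derive_eq; rewrite ImMexpi dtrigE /GRing.scale /=; ring.
Qed.

Lemma trig_derive v c kap : (forall x, toC v x = trigpoly c kap x) ->
  (forall x : R, is_derive x 1 v (derive1 v x)) /\
  (forall x, toC (derive1 v) x = trigpoly (deriv_trig c kap) kap x).
Proof.
move=> h.
have vE : v = fun y => complex.Re (trigpoly c kap y) by apply/funext => y; rewrite -h.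
have i0 : (fun y => complex.Im (trigpoly c kap y)) = cst 0 by apply/funext => y; rewrite -h.
have D (x : R) : derive1 v x = complex.Re (trigpoly (deriv_trig c kap) kap x).
  by rewrite derive1E vE; have /@derive_val -> := is_derive_Re_trig c kap x.
split=> x; first by rewrite D {1}vE; exact: is_derive_Re_trig.
apply/eqP; rewrite eq_complex /= D eqxx /=.
have := is_derive_Im_trig c kap x; rewrite i0 => /@derive_val <-.
by rewrite derive_cst.
Qed.

Lemma trig_derive3 v c kap : (forall x, toC v x = trigpoly c kap x) ->
  forall x, toC (derive1n 3 v) x = trigpoly (deriv_trig (deriv_trig (deriv_trig c kap) kap) kap) kap x.
Proof.
move=> /trig_derive [_] /trig_derive [_] /trig_derive [_] h x.
by rewrite -h /derive1n.
Qed.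

Lemma conjc_sum (h : I -> C) : conjc (\sum_i h i) = \sum_i conjc (h i).
Proof. exact: (raddf_sum conjc). Qed.

End TrigPoly.

Section DiscreteFourier.
Variables (R : realType) (N : nat).
Local Notation C := (R[i]).
Implicit Types (f g : R -> R).

(** The 4N + 1 equidistant points of the period, all inside ]-pi, pi[.  Their number
    exceeds 3N, so that a frequency of a product (at most 2N) and one of a test
    function (at most N) are never aliased. *)
Definition node (m : 'I_(N.*2.*2.+1)) : R :=
  (freq m)%:~R * (pi *+ 2) / (N.*2.*2.+1)%:R.

Definition dft f (k : int) : C :=
  (N.*2.*2.+1)%:R^-1 * \sum_(m < N.*2.*2.+1) (f (node m))%:C * expi (- k) (node m).

Lemma node_bound m : - pi < node m < pi.
Proof.
have p0 := pi_gt0 R; rewrite /node -ltr_norml normrM normfV normrM.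
have p2 : 0 <= pi *+ 2 :> R by rewrite mulrn_wge0 // ltW.
rewrite (ger0_norm p2) normr_nat.
rewrite ltr_pdivrMr ?ltr0n // -[pi *+ 2]mulr_natr mulrCA ltr_pM2l //.
rewrite -intr_norm -natr_absz -natrM ltr_nat.
have := freq_le m; lia.
Qed.

(** A geometric sum over a full period: multiplication by the ratio [w], which is not
    1, shifts the terms cyclically. *)
Lemma sum_expi_node k : (`|k| < N.*2.*2.+1)%N ->
  \sum_(m < N.*2.*2.+1) expi k (node m) = (if k == 0 then (N.*2.*2.+1)%:R else 0) :> C.
Proof.
move=> kK; case: eqP => [->|/eqP k0].
  under eq_bigr do rewrite expi0.
  by rewrite sumr_const card_ord.
set K := N.*2.*2.+1.
pose w : C := expi k ((pi *+ 2) / K%:R).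
pose phi (m : nat) : C := expi k ((m%:Z - N.*2%:Z)%:~R * (pi *+ 2) / K%:R).
have phiS m : phi m.+1 = w * phi m.
  rewrite /phi /w -expiDr; congr expi.
  have -> : (m.+1%:Z - N.*2%:Z)%:~R = 1 + (m%:Z - N.*2%:Z)%:~R :> R.
    by rewrite -[1]/(1%:~R) -intrD; congr (_%:~R); lia.
  by rewrite mulrDl mulrDl mul1r.
have K0 : (K%:R : R) != 0 by rewrite pnatr_eq0.
have : \sum_(0 <= m < K) (phi m.+1 - phi m) = 0.
  rewrite telescope_sumr //.
  have -> : phi K = phi 0%N * expi k (pi *+ 2).
    rewrite /phi -expiDr; congr expi.
    have -> : (K%:Z - N.*2%:Z)%:~R = (0%:Z - N.*2%:Z)%:~R + K%:R :> R.
      by rewrite -[K%:R]/(K%:Z%:~R) -intrD; congr (_%:~R); lia.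
    by rewrite mulrDl mulrDl [K%:R * _]mulrC mulfK.
  by rewrite expi_2pi mulr1 subrr.
under eq_bigr do rewrite phiS -[X in _ - X]mul1r -mulrBl.
rewrite -mulr_sumr => /eqP; rewrite mulf_eq0 subr_eq0 => /orP[/eqP w1|/eqP S0].
  exfalso; apply: (@expi_neq1 R k ((pi *+ 2) / K%:R)) w1.
  have p0 : 0 < pi *+ 2 :> R by rewrite mulrn_wgt0 ?pi_gt0.
  rewrite normrM (@ger0_norm _ (_ / _)) ?divr_ge0 ?ltW // -intr_norm.
  apply/andP; split.
    apply: mulr_gt0; last by rewrite divr_gt0 ?ltr0n.
    by rewrite -natr_absz ltr0n absz_gt0.
  rewrite mulrCA -[ltRHS]mulr1 ltr_pM2l // ltr_pdivrMr ?ltr0n // mul1r.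
  by rewrite -natr_absz ltr_nat.
by rewrite -[RHS]S0 big_mkord.
Qed.

Lemma dft_trig (I : finType) (c : I -> C) (kap : I -> int) f k :
  (forall x, toC f x = trigpoly c kap x) ->
  (forall i, (`|(kap i - k)%R| < N.*2.*2.+1)%N) ->
  dft f k = \sum_(i | kap i == k) c i.
Proof.
move=> fE hk; rewrite /dft.
under eq_bigr => m _ do rewrite -/(toC f _) fE /trigpoly mulr_suml.
rewrite exchange_big /= mulr_sumr [RHS]big_mkcond /=; apply: eq_bigr => i _.
under eq_bigr => m _ do rewrite -mulrA -expiDl.
rewrite -mulr_sumr sum_expi_node // subr_eq0; case: eqP => _; last by rewrite !mulr0.
by rewrite mulrCA mulVf ?mulr1 // pnatr_eq0.
Qed.

Lemma dftB f g k : dft (fun x => f x - g x) k = dft f k - dft g k.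
Proof.
rewrite /dft -mulrBr -sumrB; congr (_ * _); apply: eq_bigr => m _.
by rewrite -mulrBl rmorphB.
Qed.

(** The discrete coefficients are averages of point values: bounds on the nodes
    are all that is used of the functions to be compared. *)
Lemma dft_bound f (e : R) k : (forall m, `|f (node m)| <= e) -> normc (dft f k) <= e.
Proof.
move=> h; rewrite /dft normcM normcV.
have -> : normc (N.*2.*2.+1%:R : C) = N.*2.*2.+1%:R.
  by rewrite -[N.*2.*2.+1%:R]/((N.*2.*2.+1%:Z)%:~R) normc_int ger0_norm // ler0z.
rewrite ler_pdivrMl ?ltr0n //; apply: le_trans (normc_sum _ _) _.
rewrite mulr_natl -[X in _ *+ X](card_ord N.*2.*2.+1) -sumr_const; apply: ler_sum => m _.
by rewrite normcM normc_expi mulr1 normcR.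
Qed.

Lemma herm_dft f : herm (dft f).
Proof.
move=> k; rewrite /dft conjcM conjc_inv conjc_nat conjc_sum; congr (_ * _).
by apply: eq_bigr => m _; rewrite conjcM conjc_real !expiN conjcK.
Qed.

End DiscreteFourier.

(** * Fourier coefficients on one period *)

Section CellIntegrals.
Variable R : realType.
Local Notation C := (R[i]).
Local Notation cell := (@cell R).
Local Notation mu := (@lebesgue_measure R).
Implicit Types (v w : R -> C) (k : int).

Definition ccont v : Prop :=
  {within cell, continuous (fun x => complex.Re (v x))} /\
  {within cell, continuous (fun x => complex.Im (v x))}.

Lemma cell_meas : measurable cell.
Proof. exact: measurable_itv. Qed.

Lemma within_integrable (f : R -> R) : {within cell, continuous f} ->
  mu.-integrable cell (EFin \o f).
Proof. by apply: continuous_compact_integrable; exact: segment_compact. Qed.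

Lemma within_cst (A : set R) (z : R) : {within A, continuous (fun _ => z)}.
Proof. by move=> x; exact: cvg_cst. Qed.

Lemma ccontD v w : ccont v -> ccont w -> ccont (fun x => v x + w x).
Proof.
move=> [v1 v2] [w1 w2].
have re (z z' : C) : complex.Re (z + z') = complex.Re z + complex.Re z' by case: z z' => ? ? [].
have im (z z' : C) : complex.Im (z + z') = complex.Im z + complex.Im z' by case: z z' => ? ? [].
split.
- by under eq_fun do rewrite re; exact: within_contD v1 w1.
- by under eq_fun do rewrite im; exact: within_contD v2 w2.
Qed.

Lemma ReMc (z w : C) : complex.Re (z * w) =
  complex.Re z * complex.Re w - complex.Im z * complex.Im w.
Proof. by case: z w => ? ? []. Qed.

Lemma ImMc (z w : C) : complex.Im (z * w) =
  complex.Re z * complex.Im w + complex.Im z * complex.Re w.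
Proof. by case: z w => ? ? []. Qed.

Lemma ccontM v w : ccont v -> ccont w -> ccont (fun x => v x * w x).
Proof.
move=> [v1 v2] [w1 w2]; split.
- under eq_fun do rewrite ReMc.
  by apply: within_contB; apply: within_contM.
- under eq_fun do rewrite ImMc.
  by apply: within_contD; apply: within_contM.
Qed.

Lemma ccont_cst (z : C) : ccont (fun=> z).
Proof. by split; exact: within_cst. Qed.

Lemma ccont_toC (f : R -> R) : {within cell, continuous f} -> ccont (toC f).
Proof. by move=> cf; split => //=; exact: within_cst. Qed.

Lemma ccont_expi k : ccont (expi k).
Proof.
split; [exact: (within_derive (is_derive_coskx k))|exact: (within_derive (is_derive_sinkx k))].
Qed.

Lemma ccont_conj v : ccont v -> ccont (fun x => conjc (v x)).
Proof.
move=> [v1 v2]; have re (z : C) : complex.Re (conjc z) = complex.Re z by case: z.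
have im (z : C) : complex.Im (conjc z) = 0 - complex.Im z by case: z => ? ?; rewrite sub0r.
split.
- by under eq_fun do rewrite re.
- by under eq_fun do rewrite im; apply: within_contB => //; exact: within_cst.
Qed.

Lemma ccont_sum (I : finType) (F : I -> R -> C) : (forall i, ccont (F i)) ->
  ccont (fun x => \sum_i F i x).
Proof.
move=> h; split.
- under eq_fun do rewrite Re_sum; apply: within_cont_sum => i; exact: (h i).1.
- under eq_fun do rewrite Im_sum; apply: within_cont_sum => i; exact: (h i).2.
Qed.

Lemma eq_cintegral v w : (forall x, x \in cell -> v x = w x) -> cintegral v = cintegral w.
Proof.
move=> h; rewrite /cintegral; congr (_ +i* _); apply: eq_Rintegral => x xc; by rewrite h.
Qed.

Lemma cintegralD v w : ccont v -> ccont w ->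
  cintegral (fun x => v x + w x) = cintegral v + cintegral w.
Proof.
move=> [v1 v2] [w1 w2]; rewrite /cintegral; apply/eqP; rewrite eq_complex /=.
apply/andP; split; apply/eqP.
- rewrite -RintegralD; [|exact: cell_meas|exact: within_integrable|exact: within_integrable].
  by apply: eq_Rintegral => x _; case: (v x) (w x) => ? ? [].
- rewrite -RintegralD; [|exact: cell_meas|exact: within_integrable|exact: within_integrable].
  by apply: eq_Rintegral => x _; case: (v x) (w x) => ? ? [].
Qed.

Lemma cintegralZ (z : C) v : ccont v -> cintegral (fun x => z * v x) = z * cintegral v.
Proof.
move=> [v1 v2]; rewrite /cintegral; apply/eqP; rewrite eq_complex ReMc ImMc /=.
have i1 := within_integrable v1; have i2 := within_integrable v2.
have I f (r : R) : {within cell, continuous f} -> mu.-integrable cell (EFin \o (fun x => r * f x)).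
  by move=> cf; apply: within_integrable; apply: within_contM => //; exact: within_cst.
apply/andP; split; apply/eqP.
- under eq_Rintegral do rewrite ReMc.
  by rewrite RintegralB ?RintegralZl //; [exact: cell_meas|exact: cell_meas|exact: cell_meas|exact: I|exact: I].
- under eq_Rintegral do rewrite ImMc.
  by rewrite RintegralD ?RintegralZl //; [exact: cell_meas|exact: cell_meas|exact: cell_meas|exact: I|exact: I].
Qed.

Lemma cintegral0 : cintegral (fun _ : R => 0 : C) = 0.
Proof.
by rewrite /cintegral /= !Rintegral_cst ?mul0r //; exact: cell_meas.
Qed.

Lemma cintegral_sum (I : finType) (F : I -> R -> C) : (forall i, ccont (F i)) ->
  cintegral (fun x => \sum_i F i x) = \sum_i cintegral (F i).
Proof.
move=> cF.
have [h _] : cintegral (fun x => \sum_i F i x) = \sum_i cintegral (F i) /\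
    ccont (fun x => \sum_i F i x).
  elim: (index_enum I) => [|i r [IH IH2]].
    under eq_fun do rewrite big_nil; rewrite big_nil; split; [exact: cintegral0|exact: ccont_cst].
  under eq_fun do rewrite big_cons; rewrite big_cons; split; last exact: ccontD.
  by rewrite cintegralD // IH.
exact: h.
Qed.

Lemma Rintegral_FTC (f g : R -> R) : (forall x : R, is_derive x 1 f (g x)) ->
  {within cell, continuous g} -> Rintegral mu cell g = f pi - f (- pi).
Proof.
move=> df cg; have ab : - pi < pi :> R by have := pi_gt0 R; lra.
have cf x : f @ x --> f x.
  by apply: differentiable_continuous; apply/derivable1_diffP; have [] := df x.
rewrite /Rintegral (@continuous_FTC2 _ g f _ _ ab) //.
- split.
  + by move=> x _; have [] := df x.
  + exact: cvg_at_right_filter.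
  + exact: cvg_at_left_filter.
- by move=> x _; rewrite derive1E; have /@derive_val -> := df x.
Qed.

Lemma cintegral_expi k : cintegral (@expi R k) = if k == 0 then (pi *+ 2)%:C else 0.
Proof.
case: eqP => [->|/eqP k0].
  rewrite (_ : expi 0 = fun=> 1); last by apply/funext => x; exact: expi0.
  rewrite /cintegral /= !Rintegral_cst ?mul0r ?mul1r //; try exact: cell_meas.
  have M : mu `[- pi, pi]%classic = (pi *+ 2)%:E.
    rewrite lebesgue_measure_itv /= lte_fin.
    have -> : - pi < pi :> R by have := pi_gt0 R; lra.
    by rewrite -EFinD opprK mulr2n.
  by congr (_ +i* _); exact: (congr1 fine M).
have k0' : k%:~R != 0 :> R by rewrite intr_eq0.
have s0 : sin (k%:~R * pi) = 0 :> R.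
  have := congr1 (@complex.Re R) (expi_2pi R k); rewrite /= mulr2n mulrDr cosD.
  have := cos2Dsin2 (k%:~R * pi : R) => h1 h2.
  by apply/eqP; rewrite -sqrf_eq0; apply/eqP; nra.
rewrite /cintegral /=; congr (_ +i* _).
- have D (x : R) : is_derive x 1 (fun x => (k%:~R)^-1 * sin (k%:~R * x)) (cos (k%:~R * x)).
    have d := is_derive_sinkx k x.
    by apply: is_derive_eq; rewrite /GRing.scale /= mulrA mulVf ?mul1r.
  rewrite (Rintegral_FTC D); last exact: (within_derive (is_derive_coskx k)).
  by rewrite mulrN sinN s0 oppr0 subrr.
- have D (x : R) : is_derive x 1 (fun x => - (k%:~R)^-1 * cos (k%:~R * x)) (sin (k%:~R * x)).
    have d := is_derive_coskx k x.
    by apply: is_derive_eq; rewrite /GRing.scale /= mulrNN mulrA mulVf ?mul1r.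
  rewrite (Rintegral_FTC D); last exact: (within_derive (is_derive_sinkx k)).
  by rewrite mulrN cosN subrr.
Qed.

Lemma ccont_trig (I : finType) (c : I -> C) (kap : I -> int) : ccont (trigpoly c kap).
Proof.
by apply: ccont_sum => i; apply: ccontM; [exact: ccont_cst|exact: ccont_expi].
Qed.

Lemma cintegral_trig (I : finType) (c : I -> C) (kap : I -> int) :
  cintegral (trigpoly c kap) = (pi *+ 2)%:C * \sum_(i | kap i == 0) c i.
Proof.
rewrite cintegral_sum; last first.
  by move=> i; apply: ccontM; [exact: ccont_cst|exact: ccont_expi].
rewrite [X in _ * X]big_mkcond mulr_sumr; apply: eq_bigr => i _.
rewrite cintegralZ; last exact: ccont_expi.
by rewrite cintegral_expi; case: eqP => _; rewrite ?mulr0 // mulrC.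
Qed.

Lemma pi2_neq0 : (pi *+ 2)%:C != 0 :> C.
Proof.
by rewrite eq_complex /= negb_and mulrn_eq0 /= gt_eqF ?pi_gt0.
Qed.

Lemma fourierE v k : fourier v k = (pi *+ 2)%:C^-1 * cintegral (fun x => expi (- k) x * v x).
Proof. by rewrite /fourier fmorphV. Qed.

Lemma fourier_trig (I : finType) (c : I -> C) (kap : I -> int) v k :
  (forall x, v x = trigpoly c kap x) -> fourier v k = \sum_(i | kap i == k) c i.
Proof.
move=> h; rewrite fourierE.
have -> : (fun x => expi (- k) x * v x) = trigpoly c (fun i => kap i - k).
  apply/funext => x; rewrite h /trigpoly mulr_sumr; apply: eq_bigr => i _.
  by rewrite expiDl mulrCA [expi (- k) x * _]mulrC.
rewrite cintegral_trig mulrA mulVf ?pi2_neq0 // mul1r.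
by apply: eq_bigl => i; rewrite subr_eq0.
Qed.

Lemma inner_expi v k : inner v (expi k) = (pi *+ 2)%:C * fourier v k.
Proof.
rewrite fourierE mulrA mulfV ?pi2_neq0 // mul1r /inner.
by congr cintegral; apply/funext => x; rewrite expiN mulrC.
Qed.

Lemma fourierD v w k : ccont v -> ccont w ->
  fourier (fun x => v x + w x) k = fourier v k + fourier w k.
Proof.
move=> cv cw; rewrite !fourierE -mulrDr -cintegralD; first last.
- exact: ccontM (ccont_expi _) cw.
- exact: ccontM (ccont_expi _) cv.
by congr (_ * cintegral _); apply/funext => x; rewrite mulrDr.
Qed.

Lemma fourierZ z v k : ccont v -> fourier (fun x => z * v x) k = z * fourier v k.
Proof.
move=> cv; rewrite !fourierE [RHS]mulrCA -[in RHS]cintegralZ; last exact: ccontM (ccont_expi _) cv.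
by congr (_ * cintegral _); apply/funext => x; rewrite mulrCA.
Qed.

Lemma fourier_shift v l k : fourier (fun x => expi l x * v x) k = fourier v (k - l).
Proof.
rewrite !fourierE; congr (_ * cintegral _); apply/funext => x.
by rewrite opprB mulrA -expiDl [- k + l]addrC.
Qed.

Lemma L2norm_trig N (c : int -> C) v : (forall x, v x = sumZ N (fun k => c k * expi k x)) ->
  L2norm v = Num.sqrt (pi *+ 2 * sqnorm N c).
Proof.
move=> h; rewrite /L2norm; congr Num.sqrt.
have -> : inner v v = cintegral (trigpoly
   (fun p : 'I_(N.*2.+1) * 'I_(N.*2.+1) => c (freq p.1) * conjc (c (freq p.2)))
   (fun p => freq p.1 - freq p.2)).
  rewrite /inner; congr cintegral; apply/funext => x; rewrite -[X in v x * X]/(conjc (v x)).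
  rewrite h /sumZ /trigpoly conjc_sum mulr_suml.
  rewrite -(pair_bigA _ (fun i j => c (freq i) * conjc (c (freq j)) * expi (freq i - freq j) x)) /=.
  apply: eq_bigr => i _; rewrite mulr_sumr; apply: eq_bigr => j _.
  rewrite conjcM (expiDl (freq i)) (expiN (freq j)); exact: mulrACA.
rewrite cintegral_trig.
have -> : \sum_(p : 'I_(N.*2.+1) * 'I_(N.*2.+1) | freq p.1 - freq p.2 == 0)
    c (freq p.1) * conjc (c (freq p.2)) = (sqnorm N c)%:C.
  rewrite big_mkcond -(pair_bigA _ (fun i j => if freq i - freq j == 0 then
    c (freq i) * conjc (c (freq j)) else 0)) /= /sqnorm rmorph_sum /=.
  apply: eq_bigr => i _; rewrite -big_mkcond (big_pred1 i) /=; last first.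
    by move=> j; rewrite /= subr_eq0 (inj_eq (@freq_inj N)) eq_sym.
  rewrite normc2E; case: (c _) => x y; apply/eqP; rewrite eq_complex /=.
  by apply/andP; split; apply/eqP; ring.
by rewrite ReMc /= mul0r subr0.
Qed.

Lemma fourier_sumZ N (c : int -> C) v k : (forall x, v x = sumZ N (fun k => c k * expi k x)) ->
  (`|k| <= N)%N -> fourier v k = c k.
Proof.
move=> h kN; rewrite (@fourier_trig _ (fun j : 'I_(N.*2.+1) => c (freq j)) (@freq N) v k h).
have [j0 <-] := freq_surj kN.
by rewrite (big_pred1 j0) // => j; rewrite (inj_eq (@freq_inj N)).
Qed.

End CellIntegrals.

(** * Pointwise Fourier inversion *)

Section FourierInversion.
Variable R : realType.
Local Notation C := (R[i]).
Local Notation cell := (@cell R).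
Implicit Types (v w : R -> C) (k : int).

Lemma sum_freqS (V : nmodType) N (F : int -> V) :
  \sum_(j < N.+1.*2.+1) F (freq j) =
  F (- N.+1%:Z) + \sum_(j < N.*2.+1) F (freq j) + F N.+1%:Z.
Proof.
rewrite big_ord_recl big_ord_recr /= addrA; congr (_ + _ + _).
- by congr F; rewrite /freq /=; lia.
- by apply: eq_bigr => j _; congr F; rewrite /freq lift0 !intS opprD addrACA subrr add0r.
- by congr F; rewrite /freq lift0 -[nat_of_ord _]/(N.*2.+1); lia.
Qed.

Lemma conjcMl (z : C) : conjc z * z = (normc z ^+ 2)%:C.
Proof.
rewrite normc2E; case: z => x y; apply/eqP; rewrite eq_complex /=.
by apply/andP; split; apply/eqP; ring.
Qed.

(** The square of the distance from [v] to its partial Fourier sum is nonnegative. *)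
Lemma bessel v N : ccont v ->
  pi *+ 2 * sqnorm N (fourier v) <= complex.Re (inner v v).
Proof.
move=> cv; set c := fourier v.
pose w := trigpoly (fun j : 'I_(N.*2.+1) => c (freq j)) (@freq N).
have cw : ccont w by exact: ccont_trig.
have cc (a b' : R -> C) : ccont a -> ccont b' -> ccont (fun x => a x * conjc (b' x)).
  by move=> ca cb; exact: (ccontM ca (ccont_conj cb)).
pose d := fun x => v x + (-1) * w x.
have cd : ccont d by apply: ccontD => //; apply: ccontM => //; exact: ccont_cst.
have h0 : 0 <= complex.Re (inner d d).
  apply: Rintegral_ge0 => x _; rewrite -[X in d x * X]/(conjc (d x)) ReMc.
  by case: (d x) => y z /=; rewrite mulrN opprK -!expr2 addr_ge0 ?sqr_ge0.
have vw : inner v w = (pi *+ 2)%:C * (sqnorm N c)%:C.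
  have -> : inner v w = cintegral (fun x => \sum_(j < N.*2.+1)
      conjc (c (freq j)) * (expi (- freq j) x * v x)).
    rewrite /inner; congr cintegral; apply/funext => x.
    rewrite -[X in v x * X]/(conjc (w x)) /w /trigpoly conjc_sum mulr_sumr.
    by apply: eq_bigr => j _; rewrite conjcM expiN mulrCA [v x * _]mulrC.
  have ce (j : 'I_(N.*2.+1)) : ccont (fun x => expi (- freq j) x * v x).
    exact: ccontM (ccont_expi _ _) cv.
  rewrite cintegral_sum; last by move=> j; apply: ccontM; [exact: ccont_cst|exact: ce].
  have -> : (sqnorm N c)%:C = \sum_(j < N.*2.+1) conjc (c (freq j)) * c (freq j).
    by rewrite /sqnorm (raddf_sum (real_complex R)); apply: eq_bigr => j _; exact/esym/conjcMl.
  rewrite mulr_sumr; apply: eq_bigr => j _; rewrite cintegralZ //.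
  have -> : cintegral (fun x => expi (- freq j) x * v x) = (pi *+ 2)%:C * c (freq j).
    by rewrite /c fourierE mulrA mulfV ?pi2_neq0 // mul1r.
  exact: mulrCA.
have ww : complex.Re (inner w w) = pi *+ 2 * sqnorm N c.
  have w0 : 0 <= complex.Re (inner w w).
    apply: Rintegral_ge0 => x _; rewrite -[X in w x * X]/(conjc (w x)) ReMc.
    by case: (w x) => y z /=; rewrite mulrN opprK -!expr2 addr_ge0 ?sqr_ge0.
  have n0 : 0 <= pi *+ 2 * sqnorm N c by rewrite mulr_ge0 ?sqnorm_ge0 // mulrn_wge0 // pi_ge0.
  have /(congr1 (fun z => z ^+ 2)) := @L2norm_trig R N c w (fun x => erefl).
  by rewrite /L2norm /= (sqr_sqrtr w0) (sqr_sqrtr n0).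
have dd : inner d d = (inner v v + (-1) * inner v w) + ((-1) * cintegral (fun x => w x * conjc (v x)) + inner w w).
  have c1 : ccont (fun x => v x * conjc (v x)) by exact: cc.
  have c2 : ccont (fun x => v x * conjc (w x)) by exact: cc.
  have c3 : ccont (fun x => w x * conjc (v x)) by exact: cc.
  have c4 : ccont (fun x => w x * conjc (w x)) by exact: cc.
  have cN (u : R -> C) : ccont u -> ccont (fun x => (-1) * u x).
    by move=> cu; apply: ccontM => //; exact: ccont_cst.
  have -> : inner d d = cintegral (fun x =>
     (v x * conjc (v x) + (-1) * (v x * conjc (w x))) +
     ((-1) * (w x * conjc (v x)) + w x * conjc (w x))).
    rewrite /inner; congr cintegral; apply/funext => x.
    by rewrite -[X in d x * X]/(conjc (d x)) /d conjcD conjcM conjcN conjc1; ring.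
  rewrite (cintegralD (ccontD c1 (cN _ c2)) (ccontD (cN _ c3) c4)).
  by rewrite (cintegralD c1 (cN _ c2)) (cintegralD (cN _ c3) c4) (cintegralZ _ c2) (cintegralZ _ c3).
have wv : complex.Re (cintegral (fun x => w x * conjc (v x))) = complex.Re (inner v w).
  rewrite /inner /cintegral /=; apply: eq_Rintegral => x _.
  rewrite -[X in v x * X]/(conjc (w x)) !ReMc.
  by case: (v x) (w x) => ? ? [? ?] /=; ring.
have reD (z z' : C) : complex.Re (z + z') = complex.Re z + complex.Re z' by case: z z' => ? ? [].
have reN (z : C) : complex.Re (- z) = - complex.Re z by case: z.
move: h0; rewrite dd !reD !mulN1r !reN wv vw ww ReMc /= mul0r subr0; lra.
Qed.

Lemma fourier_cvg0 v (e : R) : ccont v -> 0 < e ->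
  exists n0, forall n, (n0 <= n)%N ->
    normc (fourier v n%:Z) <= e /\ normc (fourier v (- n%:Z)) <= e.
Proof.
move=> cv e0; pose s n := sqnorm n (fourier v).
have sS n : s n.+1 = normc (fourier v (- n.+1%:Z)) ^+ 2 + s n + normc (fourier v n.+1%:Z) ^+ 2.
  exact: (sum_freqS n (fun k => normc (fourier v k) ^+ 2)).
have s_nd : nondecreasing_seq s.
  by apply/nondecreasing_seqP => n; rewrite sS; have := sqr_ge0 (normc (fourier v n.+1%:Z));
    have := sqr_ge0 (normc (fourier v (- n.+1%:Z))); lra.
have p2 : 0 < pi *+ 2 :> R by rewrite mulrn_wgt0 ?pi_gt0.
have s_ub : has_ubound (range s).
  exists ((pi *+ 2)^-1 * complex.Re (inner v v)) => _ [n _ <-].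
  by rewrite ler_pdivlMl //; exact: bessel.
have cs := nondecreasing_cvgn s_nd s_ub; set l := sup _ in cs.
have e2 : 0 < e ^+ 2 / 2 by rewrite divr_gt0 // exprn_gt0.
have /cvgrPdist_lt/(_ _ e2) [n0 _ hn0] := cs.
exists n0.+1; case=> [//|n] n0n.
have h1 := hn0 n n0n; have h2 := hn0 n.+1 (leqW n0n).
have {h1 h2} : s n.+1 - s n <= e ^+ 2.
  rewrite /= in h1 h2; move: h1 h2; rewrite !ltr_norml => /andP[a1 a2] /andP[a3 a4]; lra.
rewrite sS => h.
have q1 := sqr_ge0 (normc (fourier v n.+1%:Z)).
have q2 := sqr_ge0 (normc (fourier v (- n.+1%:Z))).
have sq (z : C) : normc z ^+ 2 <= e ^+ 2 -> normc z <= e.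
  by rewrite ler_pXn2r ?nnegrE ?normc_ge0 // ltW.
by split; apply: sq; lra.
Qed.

(** A Lipschitz bound with centre [x] bounds the derivative at [x]. *)
Lemma is_derive_bound (f : R -> R) (x d L : R) : - pi < x < pi ->
  is_derive x 1 f d ->
  (forall y, - pi < y < pi -> `|f y - f x| <= L * `|y - x|) -> `|d| <= L.
Proof.
move=> /andP[xl xr] /is_derive1_caratheodory [g [fg cg <-]] hL.
rewrite leNgt; apply/negP => Lg.
have e0 : 0 < `|g x| - L by rewrite subr_gt0.
have [r /= r0 hr] : exists2 r : R, 0 < r & forall y, `|x - y| < r -> `|g x - g y| < `|g x| - L.
  move/cvgrPdist_lt : cg => /(_ _ e0) [r /= r0 hr]; exists r => // y xy; exact: hr.
pose h := Num.min (r / 2) ((pi - x) / 2).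
have h0 : 0 < h by rewrite lt_min !divr_gt0 // subr_gt0.
have h1 : h <= r / 2 by rewrite ge_min lexx.
have h2 : h <= (pi - x) / 2 by rewrite ge_min lexx orbT.
have yI : - pi < x + h < pi by apply/andP; split; lra.
have := hL _ yI; rewrite fg normrM addrAC subrr add0r (gtr0_norm h0) ler_pM2r //.
have xh : `|x - (x + h)| < r by rewrite opprD addrA subrr sub0r normrN gtr0_norm //; lra.
have := hr _ xh; have := ler_normB (g x) (g x - g (x + h)).
have := lerB_dist (g x) (g x - g (x + h)).
rewrite subKr; lra.
Qed.

Let half_angle (x y : R) : (@expi R 1 y) * conjc (expi 1 x) - 1 =
  'i%C * (2 * sin ((y - x) / 2))%:C * (cos ((y - x) / 2) +i* sin ((y - x) / 2)).
Proof.
have -> : expi 1 y * conjc (expi 1 x) = expi 1 ((y - x) / 2 + (y - x) / 2) :> C.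
  have -> : (y - x) / 2 + (y - x) / 2 = y - x by field.
  by rewrite expiDr; congr (_ * _); rewrite /expi !mul1r cosN sinN.
rewrite /expi mul1r cosD sinD.
have := cos2Dsin2 ((y - x) / 2); move: (cos _) (sin _) => a c h.
apply/eqP; rewrite eq_complex /=; apply/andP; split; apply/eqP; last by ring.
lra.
Qed.

(** Chernoff's argument.  As f is differentiable at x0, the quotient g of f - f(x0)
    by e^(i(x - x0)) - 1 is continuous on the period.  The coefficients of
    f - f(x0) = (e^(i(x - x0)) - 1) g are differences of consecutive coefficients of
    g, up to phases, so that the partial sums at x0 telescope. *)
Lemma fourier_inversion_pt (f : R -> R) (x0 : R) : - pi < x0 < pi ->
  (forall x : R, derivable f x 1) ->
  exists2 g : R -> C, ccont g & forall n,
    sumZ n (fun k => fourier (toC f) k * expi k x0) - (f x0)%:C =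
    expi (- n%:Z - 1) x0 * fourier g (- n%:Z - 1) - expi n%:Z x0 * fourier g n%:Z.
Proof.
move=> /andP[x0l x0r] df.
have [a [fa ca _]] := (is_derive1_caratheodory _ _ _).1 (derivableP (df x0)).
pose S (x : R) := sin ((x - x0) / 2).
have dS (x : R) : is_derive x 1 S (cos ((x - x0) / 2) / 2).
  have d1 : is_derive x 1 (fun y => (y - x0) / 2) (2^-1 : R).
    by apply: is_derive_eq; rewrite /GRing.scale /=; ring.
  have := @is_derive1_comp _ sin (fun y => (y - x0) / 2) x _ _ (is_derive_sin _) d1.
  by [].
(* Both f - f(x0) and sin((x - x0)/2) are (x - x0) times a function continuous at
   x0; their quotient extends through the removable singularity. *)
have [s [Ss cs sx0]] := (is_derive1_caratheodory _ _ _).1 (dS x0).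
have S0 : S x0 = 0 by rewrite /S subrr mul0r sin0.
have {}Ss z : S z = s z * (z - x0) by rewrite -Ss S0 subr0.
have s_neq0 x : x \in cell -> s x != 0.
  rewrite /Defs.cell inE /= in_itv /= => /andP[xl xr].
  have [->|xx0] := eqVneq x x0; first by rewrite sx0 subrr mul0r cos0; lra.
  apply/eqP => sx; have : S x = 0 by rewrite Ss sx mul0r.
  rewrite /S.
  have [lt0|gt0|e] := ltgtP (x - x0) 0.
  - have : 0 < sin (- ((x - x0) / 2)) by apply: sin_gt0_pi; apply/andP; split; lra.
    by rewrite sinN => + e0; rewrite e0 oppr0 ltxx.
  - have : 0 < sin ((x - x0) / 2) by apply: sin_gt0_pi; apply/andP; split; lra.
    by move=> + e0; rewrite e0 ltxx.
  - by move/eqP : e; rewrite subr_eq0 (negbTE xx0).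
pose q x := a x / s x.
have cts_of (h : R -> R) (h' : R -> R) :
    (forall y : R, is_derive y 1 h (h' y)) -> continuous h.
  by move=> dh y; apply: differentiable_continuous; apply/derivable1_diffP; have [] := dh y.
have cf : continuous f.
  by apply: (cts_of _ (fun x => 'D_1 f x)) => y; exact: derivableP.
have cS : continuous S by exact: cts_of dS.
have csl (h hs : R -> R) x : x != x0 -> continuous h -> (forall z, h z - h x0 = hs z * (z - x0)) ->
    {for x, continuous hs}.
  move=> xx0 ch hE.
  have c2 : {for x, continuous (fun z => (h z - h x0) / (z - x0))}.
    apply: cvgM; first by apply: cvgB; [exact: ch|exact: cvg_cst].
    apply: cvgV; first by rewrite subr_eq0.
    by apply: cvgB; [exact: cvg_id|exact: cvg_cst].
  have hsE z : z != x0 -> hs z = (h z - h x0) / (z - x0).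
    by move=> zx0; rewrite hE mulfK // subr_eq0.
  apply/cvgrPdist_lt => e e0; near=> z.
  have zx0 : z != x0.
    by near: z; apply: (@open_nbhs_nbhs R); split; [exact: open_neq|exact: xx0].
  rewrite (hsE _ xx0) (hsE _ zx0); near: z.
  by move/cvgrPdist_lt : c2; apply.
have cq : {within cell, continuous q}.
  apply: continuous_in_subspaceT => x xc; apply: cvgM.
    by have [->|xx0] := eqVneq x x0; [exact: ca|exact: (csl f)].
  apply: cvgV; first exact: s_neq0.
  have [->|xx0] := eqVneq x x0; first exact: cs.
  by apply: (csl S) => // z; rewrite S0 subr0.
have cSin : {within cell, continuous S} by exact: continuous_subspaceT.
have cCos : {within cell, continuous (fun x => cos ((x - x0) / 2))}.
  apply: continuous_subspaceT; apply: (cts_of _ (fun x => - sin ((x - x0) / 2) / 2)) => x.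
  have d1 : is_derive x 1 (fun y => (y - x0) / 2) (2^-1 : R).
    by apply: is_derive_eq; rewrite /GRing.scale /=; ring.
  exact: (@is_derive1_comp _ cos (fun y => (y - x0) / 2) x _ _ (is_derive_cos _) d1).
(* 1 / (e^(iy) - 1) = - (1 + i cot(y/2)) / 2 *)
pose g (x : R) : C := (- (1 / 2) * (q x * S x)) +i* (- (1 / 2) * (q x * cos ((x - x0) / 2))).
have cg : ccont g.
  by split => /=; do 2?[apply: within_contM => //]; exact: within_cst.
exists g => // n.
have fE x : x \in cell -> toC f x = (f x0)%:C + (conjc (expi 1 x0) * (expi 1 x * g x) + (-1) * g x).
  move=> xc.
  have -> : conjc (expi 1 x0) * (expi 1 x * g x) + (-1) * g x =
      (expi 1 x * conjc (expi 1 x0) - 1) * g x by ring.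
  rewrite half_angle /toC -(subrK (f x0) (f x)) addrC.
  have -> : f x - f x0 = q x * S x.
    by rewrite fa /q Ss; field; exact: s_neq0.
  rewrite rmorphD; congr (_ + _); rewrite /g -/(S x).
  have := cos2Dsin2 ((x - x0) / 2); rewrite -/(S x); move: (cos _) (S x) (q x) => co si qq h.
  apply/eqP; rewrite eq_complex /=; apply/andP; split; apply/eqP; last by ring.
  by transitivity (qq * si * (co ^+ 2 + si ^+ 2)); [rewrite h mulr1|field].
have cc : ccont (fun x => conjc (expi 1 x0) * (expi 1 x * g x)).
  by apply: ccontM; [exact: ccont_cst|apply: ccontM => //; exact: ccont_expi].
have cm : ccont (fun x => (-1) * g x) by apply: ccontM => //; exact: ccont_cst.
have fk k : fourier (toC f) k =
    (if k == 0 then (f x0)%:C else 0) + (conjc (expi 1 x0) * fourier g (k - 1) - fourier g k).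
  have -> : fourier (toC f) k = fourier (fun x => (f x0)%:C +
     (conjc (expi 1 x0) * (expi 1 x * g x) + (-1) * g x)) k.
    by rewrite !fourierE; congr (_ * _); apply: eq_cintegral => x xc; rewrite fE.
  rewrite (@fourierD _ (fun=> (f x0)%:C) _ k (ccont_cst _) (ccontD cc cm)).
  rewrite (fourierD _ cc cm) !fourierZ //; last by apply: ccontM => //; exact: ccont_expi.
  rewrite fourier_shift mulN1r; congr (_ + _).
  rewrite (@fourier_trig _ unit (fun=> (f x0)%:C) (fun=> 0)); last first.
    by move=> x; rewrite /trigpoly big_const card_unit /= expi0 mulr1 addr0.
  by rewrite eq_sym; case: eqP => _; rewrite ?big_pred0_eq // big_const card_unit /= addr0.
pose psi k := expi k x0 * fourier g k.
have termE k : fourier (toC f) k * expi k x0 =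
    (if k == 0 then (f x0)%:C else 0) + (psi (k - 1) - psi k).
  rewrite fk mulrDl; congr (_ + _).
    by case: eqP => [->|_]; rewrite ?expi0 ?mulr1 ?mul0r.
  rewrite mulrBl /psi (expiDl k (-1)) expiN; congr (_ - _); last by rewrite mulrC.
  ring.
rewrite /sumZ; under eq_bigr => j _ do rewrite termE.
rewrite big_split /= -big_mkcond /= .
have -> : \sum_(j < n.*2.+1 | (j%:Z - n%:Z) == 0) (f x0)%:C = (f x0)%:C.
  have [j0 j0E] := @freq_surj n 0 isT.
  by rewrite (big_pred1 j0) // => j; rewrite -j0E (inj_eq (@freq_inj n)).
rewrite (addrC (f x0)%:C) addrK.
pose phi (j : nat) := - psi (j%:Z - n%:Z - 1).
rewrite (eq_bigr (fun j : 'I_n.*2.+1 => phi j.+1 - phi j)); last first.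
  move=> j _; rewrite /phi opprK addrC; congr (- psi _ + psi _); lia.
rewrite -(big_mkord xpredT (fun j => phi j.+1 - phi j)) telescope_sumr //.
rewrite /phi opprK addrC; congr (psi _ - psi _); lia.
Unshelve. all: by end_near.
Qed.

Lemma fourier_inversion (f : R -> R) (x0 e : R) : - pi < x0 < pi ->
  (forall x : R, derivable f x 1) -> 0 < e ->
  exists n0, forall n, (n0 <= n)%N ->
    normc (sumZ n (fun k => fourier (toC f) k * expi k x0) - (f x0)%:C) <= e.
Proof.
move=> x0I df e0; have [g cg gE] := fourier_inversion_pt x0I df.
have e2 : 0 < e / 2 by rewrite divr_gt0.
have [n0 hn0] := fourier_cvg0 cg e2.
exists n0 => n n0n; rewrite gE.
have -> : - n%:Z - 1 = - n.+1%:Z by lia.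
apply: le_trans (le_normcD _ _) _; rewrite normcN.
rewrite (normcM (expi _ _)) (normcM (expi n _)) !normc_expi !mul1r.
have [h1 _] := hn0 n n0n; have [_ h2] := hn0 n.+1 (leqW n0n).
by rewrite (le_trans (lerD h2 h1)) // -splitr.
Qed.

End FourierInversion.

(** * Approximation of smooth functions by partial sums *)

Section SmoothFourier.
Variable R : realType.
Local Notation C := (R[i]).
Implicit Types (a : int -> C) (k : int) (f : R -> R) (x : R).

(** Coefficients of the [j]-th derivative. *)
Definition deriv_coef (j : nat) a : int -> C := fun k => ('i%C * k%:~R) ^+ j * a k.

Definition trigsum a n x : C := sumZ n (fun k => a k * expi k x).

Lemma trigsumE a n x : trigsum a n x = trigpoly (fun j : 'I_(n.*2.+1) => a (freq j)) (@freq n) x.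
Proof. by []. Qed.

Lemma deriv_coef_trig j a n : (fun i : 'I_(n.*2.+1) => deriv_coef j.+1 a (freq i)) =
  deriv_trig (fun i => deriv_coef j a (freq i)) (@freq n).
Proof. by apply/funext => i; rewrite /deriv_coef /deriv_trig exprS mulrA. Qed.

Lemma herm_fourier f : {within @cell R, continuous f} -> herm (fourier (toC f)).
Proof.
move=> cf k.
have cv : ccont (fun x => expi (- k) x * toC f x).
  by apply: ccontM; [exact: ccont_expi|exact: ccont_toC].
rewrite !fourierE opprK conjcM conjc_inv conjc_real; congr (_ * _).
have [v1 v2] := cv.
rewrite /cintegral /=; congr (_ +i* _).
  by apply: eq_Rintegral => x _; rewrite /= intrN mulNr cosN sinN; ring.
rewrite -[RHS]mulN1r -RintegralZl; [|exact: cell_meas|exact: within_integrable].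
apply: eq_Rintegral => x _; rewrite /= intrN (mulNr k%:~R) cosN sinN; ring.
Qed.

Lemma trigsum_real a n x : herm a -> trigsum a n x = (complex.Re (trigsum a n x))%:C.
Proof.
move=> h; suff : conjc (trigsum a n x) = trigsum a n x.
  case: (trigsum a n x) => y z [] /eqP; rewrite -subr_eq0 -opprD oppr_eq0 -mulr2n mulrn_eq0 /=.
  by move=> /eqP ->.
rewrite /trigsum /sumZ conjc_sum [LHS](reindex_inj rev_ord_inj) /=.
apply: eq_bigr => j _; rewrite -/(freq _) -/(freq (rev_ord j)) freq_rev.
by rewrite conjcM -expiN opprK -h opprK.
Qed.

Lemma is_derive_trigsum j a n x : is_derive x 1 (fun y => complex.Re (trigsum (deriv_coef j a) n y))
  (complex.Re (trigsum (deriv_coef j.+1 a) n x)).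
Proof.
rewrite trigsumE deriv_coef_trig; exact: is_derive_Re_trig.
Qed.

Lemma weight_pow_gt0 m k : 0 < weight R k ^+ m.
Proof. by rewrite exprn_gt0 // (lt_le_trans ltr01) ?weight_ge1. Qed.

Section Decay.
Variables (a : int -> C) (A : R).
Hypothesis hA : forall k, weight R k ^+ 24 * normc (a k) <= A.

Let A0 : 0 <= A.
Proof. by apply: le_trans (hA 0); rewrite mulr_ge0 ?normc_ge0 ?ltW ?weight_pow_gt0. Qed.

Lemma deriv_coef_decay j k : (j <= 3)%N -> normc (deriv_coef j a k) <= A * (weight R k)^-1 ^+ 21.
Proof.
move=> j3; rewrite /deriv_coef normcM.
have h1 : normc (('i%C * k%:~R : C) ^+ j) <= weight R k ^+ 3.
  apply: le_trans (_ : weight R k ^+ j <= _); last by rewrite ler_weXn2l ?weight_ge1.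
  elim: j {j3} => [|j IH]; first by rewrite normc1.
  by rewrite exprS normcM exprS ler_pM ?normc_ge0 // normcM normci mul1r normc_int_weight.
apply: le_trans (ler_wpM2r (normc_ge0 _) h1) _.
rewrite exprVn ler_pdivlMr ?weight_pow_gt0 // mulrAC -exprD; exact: hA.
Qed.

(** A bound of the Fourier tails of the first three derivatives, under the decay
    of order 24 assumed in this section. *)
Definition tailbd n : R := 2 * A * (n.+1%:R)^-1 ^+ 20.

Lemma tailbd_ge0 n : 0 <= tailbd n.
Proof. by rewrite /tailbd !mulr_ge0 // exprn_ge0 // invr_ge0. Qed.

(** Passing from m to m + 1 adds two terms of size at most A (m + 2)^-21, and
    (m + 2)^-21 <= (m + 1)^-20 - (m + 2)^-20: the bound telescopes. *)
Lemma trigsum_tail j n m x : (j <= 3)%N -> (n <= m)%N ->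
  normc (trigsum (deriv_coef j a) m x - trigsum (deriv_coef j a) n x) <= tailbd n - tailbd m.
Proof.
move=> j3; elim: m => [|m IH].
  by rewrite leqn0 => /eqP ->; rewrite !subrr normc0.
rewrite leq_eqVlt => /orP[/eqP ->|]; first by rewrite !subrr normc0.
rewrite ltnS => nm.
have -> : trigsum (deriv_coef j a) m.+1 x - trigsum (deriv_coef j a) n x =
   (trigsum (deriv_coef j a) m x - trigsum (deriv_coef j a) n x) +
   (deriv_coef j a (- m.+1%:Z) * expi (- m.+1%:Z) x + deriv_coef j a m.+1%:Z * expi m.+1%:Z x).
  rewrite /trigsum /sumZ (sum_freqS m (fun k => deriv_coef j a k * expi k x)); ring.
apply: le_trans (le_normcD _ _) _.
have -> : tailbd n - tailbd m.+1 = (tailbd n - tailbd m) + (tailbd m - tailbd m.+1) by ring.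
apply: lerD; first exact: IH.
apply: le_trans (le_normcD _ _) _.
rewrite (normcM _ (expi _ _)) (normcM _ (expi m.+1 _)) !normc_expi !mulr1.
have d1 := deriv_coef_decay (- m.+1%:Z) j3; have d2 := deriv_coef_decay m.+1%:Z j3.
have w1 : weight R (- m.+1%:Z) = m.+2%:R by rewrite /weight abszN.
have w2 : weight R m.+1%:Z = m.+2%:R by [].
rewrite w1 in d1; rewrite w2 in d2.
apply: le_trans (lerD d1 d2) _; rewrite /tailbd.
set p : R := m.+1%:R^-1; set q : R := m.+2%:R^-1.
have q0 : 0 < q by rewrite invr_gt0.
have qp : q <= p by rewrite lef_pV2 ?posrE ?ltr0n // ler_nat.
have pq : p - q = p * q.
  have u0 : m.+1%:R != 0 :> R by rewrite pnatr_eq0.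
  have u1 : m.+1%:R + 1 != 0 :> R by rewrite natr1 pnatr_eq0.
  rewrite /p /q -(natr1 m.+1); move: (m.+1%:R) u0 u1 => u u0 u1.
  by field; rewrite u0 u1.
have p0 : 0 <= p by rewrite invr_ge0.
have p19 : q ^+ 19 <= p ^+ 19 by rewrite lerXn2r ?nnegrE // ltW.
have k1 : q ^+ 21 <= p ^+ 20 - q ^+ 20.
  apply: le_trans (_ : (p - q) * q ^+ 19 <= _).
    rewrite pq (exprS q 20) (exprS q 19) -mulrA ler_wpM2r //.
    by rewrite mulr_ge0 ?exprn_ge0 ?ltW.
  by rewrite (exprS p 19) (exprS q 19) mulrBl lerB // ler_wpM2l.
have -> : 2 * A * p ^+ 20 - 2 * A * q ^+ 20 = A * (p ^+ 20 - q ^+ 20) + A * (p ^+ 20 - q ^+ 20) by ring.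
by rewrite lerD // ler_wpM2l.
Qed.

Lemma trigsum_tail_le j n m x : (j <= 3)%N -> (n <= m)%N ->
  normc (trigsum (deriv_coef j a) m x - trigsum (deriv_coef j a) n x) <= tailbd n.
Proof.
move=> j3 nm; apply: le_trans (trigsum_tail _ j3 nm) _.
by rewrite lerBlDr lerDl tailbd_ge0.
Qed.

Lemma tailbd_small (e : R) n0 : 0 < e -> exists2 n, (n0 <= n)%N & tailbd n <= e.
Proof.
move=> e0; have [m hm] : exists m : nat, 2 * A / e < m%:R.
  by exists (Num.truncn (2 * A / e)).+1; exact: truncnS_gt.
exists (maxn n0 m); first by rewrite leq_maxl.
rewrite /tailbd; set p : R := (maxn n0 m).+1%:R.
have p1 : 1 <= p by rewrite ler1n.
have p0 : 0 < p by rewrite ltr0n.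
have mp : m%:R <= p by rewrite ler_nat leqW // leq_maxr.
apply: le_trans (_ : 2 * A * p^-1 <= _).
  have p0' : 0 <= p^-1 by rewrite invr_ge0 ltW.
  rewrite ler_wpM2l ?mulr_ge0 // exprS -[leRHS]mulr1 ler_wpM2l //.
  by rewrite exprn_ile1 // invf_le1.
rewrite ler_pdivrMr // -ler_pdivrMl // mulrC; apply: le_trans (ltW hm) mp.
Qed.

End Decay.

(** By induction on [j].  The differences of partial sums of order j have derivatives
    bounded by the tail of order j + 1, hence are Lipschitz with that constant; so is
    their limit, f^(j) minus a partial sum, and this bounds its derivative, which is
    known to exist. *)
Lemma fourier_approx (f : R -> R) (A : R) :
  (forall k, weight R k ^+ 24 * normc (fourier (toC f) k) <= A) ->
  (forall j x, (j < 3)%N -> derivable (derive1n j f) x 1) ->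
  forall j n x, (j <= 3)%N -> - pi < x < pi ->
    `|derive1n j f x - complex.Re (trigsum (deriv_coef j (fourier (toC f))) n x)| <= tailbd A n.
Proof.
move=> hA df j; set a := fourier (toC f).
have reB (z w : C) : complex.Re (z - w) = complex.Re z - complex.Re w by case: z w => ? ? [].
have le_eps (x y : R) : (forall e, 0 < e -> x <= y + e) -> x <= y.
  by move=> h; apply/ler_addgt0Pr => e; exact: h.
elim: j => [|j IH] n x j3 xI.
  have df0 y : derivable f y 1 by exact: (df 0%N y isT).
  apply: le_eps => e e0; have [n0 hn0] := fourier_inversion xI df0 e0.
  set m := maxn n n0; have h1 := hn0 m (leq_maxr _ _).
  have h2 := trigsum_tail_le hA x j3 (leq_maxl n n0 : (n <= m)%N).
  have d0 : deriv_coef 0 a = a by apply/funext => k; rewrite /deriv_coef expr0 mul1r.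
  rewrite d0 in h2 *.
  have := le_trans (normc_re _) h1; have := le_trans (normc_re _) h2.
  rewrite !reB /= => k2 k1.
  have -> : f x - complex.Re (trigsum a n x) = (complex.Re (trigsum a m x) - complex.Re (trigsum a n x))
     - (complex.Re (trigsum a m x) - f x) by ring.
  by apply: le_trans (ler_normB _ _) _; apply: lerD.
have j3' : (j <= 3)%N by exact: ltnW.
set phi := fun y => derive1n j f y - complex.Re (trigsum (deriv_coef j a) n y).
have dphi : is_derive x 1 phi (derive1n j.+1 f x - complex.Re (trigsum (deriv_coef j.+1 a) n x)).
  apply: is_deriveB; last exact: is_derive_trigsum.
  by rewrite derive1nS derive1E; apply: derivableP; exact: df.
apply: (is_derive_bound xI dphi) => y yI.
apply: le_eps => e e0.
have e2 : 0 < e / 2 by rewrite divr_gt0.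
have [m nm hm] := tailbd_small hA n e2.
have h1 := IH m y j3' yI; have h2 := IH m x j3' xI.
pose psi z := complex.Re (trigsum (deriv_coef j a) m z) - complex.Re (trigsum (deriv_coef j a) n z).
pose dpsi z := complex.Re (trigsum (deriv_coef j.+1 a) m z) - complex.Re (trigsum (deriv_coef j.+1 a) n z).
have Dpsi (z : R) : is_derive z 1 psi (dpsi z) by apply: is_deriveB; exact: is_derive_trigsum.
have bpsi z : `|dpsi z| <= tailbd A n.
  by rewrite /dpsi -reB; apply: le_trans (normc_re _) _; exact: trigsum_tail_le.
have mvt (u w : R) : u <= w -> `|psi w - psi u| <= tailbd A n * `|w - u|.
  move=> uw.
  have [c _ ->] := @MVT_segment R psi dpsi u w uw (fun z _ => Dpsi z) (within_derive Dpsi).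
  by rewrite normrM ler_wpM2r.
have {mvt} hpsi : `|psi y - psi x| <= tailbd A n * `|y - x|.
  have [xy|yx] := leP x y; first exact: mvt.
  by rewrite distrC [X in _ * X]distrC mvt // ltW.
have -> : phi y - phi x = (derive1n j f y - complex.Re (trigsum (deriv_coef j a) m y)) -
   (derive1n j f x - complex.Re (trigsum (deriv_coef j a) m x)) + (psi y - psi x).
  by rewrite /phi /psi; ring.
apply: le_trans (ler_normD _ _) _; rewrite addrC; apply: lerD => //.
apply: le_trans (ler_normB _ _) _.
by apply: le_trans (lerD h1 h2) _; rewrite [leRHS]splitr lerD.
Qed.

End SmoothFourier.

(** * Decay of the coefficients, uniformly in time *)

Section UniformDecay.
Variable R : realType.
Local Notation C := (R[i]).
Implicit Types (k : int) (mu M : R) (v w : R -> C).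

Let sob_w (mu : R) k : R := (1 + (k%:~R : R) ^+ 2) `^ mu.

Let sob_term mu v k : \bar R := (sob_w mu k * normc (fourier v k) ^+ 2)%:E.

Let sob_term_ge0 mu v k : (0 <= sob_term mu v k)%E.
Proof. by rewrite lee_fin mulr_ge0 ?powR_ge0 ?sqr_ge0. Qed.

Lemma sobolev_term mu v k : (((1 + (k%:~R : R) ^+ 2) `^ mu * normc (fourier v k) ^+ 2)%:E
  <= sobolev_sq mu v)%E.
Proof.
rewrite /sobolev_sq; apply: esum_ge; exists [set k].
  by split => //; exact: finite_set1.
by rewrite fsbig_set1.
Qed.

(** Because (1 + |k|)^2 <= 2 (1 + k^2). *)
Lemma weight_le mu k : 24 <= mu ->
  (weight R k ^+ 24) ^+ 2 <= 2 ^+ 24 * (1 + (k%:~R : R) ^+ 2) `^ mu.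
Proof.
move=> mu24; set s : R := 1 + (k%:~R : R) ^+ 2.
have s1 : 1 <= s by rewrite lerDl sqr_ge0.
have h1 : s ^+ 24 <= s `^ mu.
  by rewrite -powR_mulrn ?(le_trans ler01) // ler_powR.
apply: le_trans (_ : 2 ^+ 24 * s ^+ 24 <= _); last by rewrite ler_wpM2l ?exprn_ge0.
rewrite -exprM mulnC exprM -exprMn lerXn2r ?nnegrE ?sqr_ge0 ?mulr_ge0 ?(le_trans ler01 s1) //.
have -> : weight R k = `|k%:~R : R| + 1 by rewrite /weight -addn1 natrD natr_absz intr_norm.
have -> : s = 1 + `|k%:~R : R| ^+ 2 by rewrite real_normK ?num_real.
have := sqr_ge0 (`|k%:~R : R| - 1); lra.
Qed.

Lemma sobolev_decay mu M v k : 24 <= mu -> (sobolev_sq mu v <= M%:E)%E ->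
  weight R k ^+ 24 * normc (fourier v k) <= 2 ^+ 12 * Num.sqrt M.
Proof.
move=> mu24 vM.
have h := le_trans (sobolev_term mu v k) vM; rewrite lee_fin in h.
have M0 : 0 <= M by apply: le_trans h; rewrite mulr_ge0 ?powR_ge0 ?sqr_ge0.
rewrite -(@ler_pXn2r _ 2) ?nnegrE ?mulr_ge0 ?normc_ge0 ?exprn_ge0 ?weight_ge0 ?sqrtr_ge0 //.
rewrite (exprMn 2 (weight R k ^+ 24)) (exprMn 2 (2 ^+ 12)) (sqr_sqrtr M0) (_ : (2 ^+ 12) ^+ 2 = 2 ^+ 24 :> R); last by rewrite -exprM.
apply: le_trans (ler_wpM2r (sqr_ge0 _) (weight_le k mu24)) _.
by rewrite -mulrA ler_wpM2l ?exprn_ge0.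
Qed.

(** A small [Hnorm] bounds coefficients only once the sum that defines it is known
    to be finite. *)
Lemma sobolevB_lty mu v w : ccont v -> ccont w ->
  (sobolev_sq mu v < +oo)%E -> (sobolev_sq mu w < +oo)%E ->
  (sobolev_sq mu (fun x => (v x + (-1) * w x)%R) < +oo)%E.
Proof.
move=> cv cw fv fw.
have fE k : fourier (fun x => v x + (-1) * w x) k = fourier v k - fourier w k.
  rewrite (fourierD _ cv) ?fourierZ ?mulN1r //.
  by apply: ccontM => //; exact: ccont_cst.
apply: le_lt_trans (_ : (\esum_(k in [set: int])
   ((sob_term mu v k + sob_term mu v k) + (sob_term mu w k + sob_term mu w k)) < +oo)%E).
  apply: le_esum => k _; rewrite fE -!EFinD lee_fin -/(sob_w mu k).
  rewrite -!mulrDr ler_wpM2l ?powR_ge0 //.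
  have t := le_normcD (fourier v k) (- fourier w k); rewrite normcN in t.
  have n0 := normc_ge0 (fourier v k - fourier w k).
  move: t n0; set x := normc (_ + _); set y := normc (fourier v k).
  set z := normc (fourier w k) => xyz x0.
  have : x ^+ 2 <= (y + z) ^+ 2 by rewrite lerXn2r ?nnegrE // (le_trans x0).
  have := sqr_ge0 (y - z); lra.
rewrite !esumD => [|k _|k _|k _|k _|k _|k _]; rewrite ?adde_ge0 ?sob_term_ge0 //.
exact: (lte_add_pinfty (lte_add_pinfty fv fv) (lte_add_pinfty fw fw)).
Qed.

(** Near each time, the coefficients are those at that time plus a perturbation of
    Sobolev norm at most one; finitely many such neighbourhoods cover [0, T]. *)
Lemma uniform_decay (T mu : R) (u : R -> R -> R) : 24 <= mu -> inCH T mu u ->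
  (forall t, t \in `[0, T] -> ccont (toC (u t))) ->
  exists A, forall t k, t \in `[0, T] -> weight R k ^+ 24 * normc (fourier (toC (u t)) k) <= A.
Proof.
move=> mu24 uH cu.
pose P (A t : R) := t \in `[0, T] -> forall k, weight R k ^+ 24 * normc (fourier (toC (u t)) k) <= A.
have /compact_near_coveringP cpt : compact `[0, T]%classic := @segment_compact R 0 T.
have local : forall x, `[0, T]%classic x -> \forall x' \near x & i \near (pinfty_nbhs R), P i x'.
  move=> t0 /= t0T; have [[_ _ fin0] lim0] := uH t0 t0T.
  pose M0 := fine (sobolev_sq mu (toC (u t0))).
  pose A0 := 2 ^+ 12 * Num.sqrt 1 + 2 ^+ 12 * Num.sqrt M0.
  have near0 : \forall s \near t0, s \in `[0, T] -> forall k, weight R k ^+ 24 * normc (fourier (toC (u s)) k) <= A0.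
    have : \forall s \near within `[0, T] (nbhs t0), Hnorm mu (toC (fun x => u s x - u t0 x)) < 1.
      by move/cvgr_lt : lim0; apply.
    rewrite near_withinE => H; near=> s => sT k.
    have Hs : Hnorm mu (toC (fun x => u s x - u t0 x)) < 1.
      by move: sT; near: s; exact: H.
    have [[_ _ fins] _] := uH s sT.
    have cs := cu s sT; have c0 := cu t0 t0T.
    have dE : toC (fun x => u s x - u t0 x) = fun x => toC (u s) x + (-1) * toC (u t0) x.
      by apply/funext => x; rewrite /toC rmorphB mulN1r.
    rewrite dE in Hs.
    have fd := sobolevB_lty cs c0 fins fin0.
    set d := (fun x => toC (u s) x + (-1) * toC (u t0) x) in Hs fd.
    have sd0 : (0 <= sobolev_sq mu d)%E by apply: esum_ge0 => l _; exact: sob_term_ge0.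
    have sd1 : (sobolev_sq mu d <= 1%:E)%E.
      rewrite -(@fineK _ (sobolev_sq mu d)) ?ge0_fin_numE // lee_fin.
      have := Hs; rewrite /Hnorm -[X in _ < X]sqrtr1 ltr_sqrt // => /ltW; exact.
    have d1 := sobolev_decay k mu24 sd1.
    have d2 : weight R k ^+ 24 * normc (fourier (toC (u t0)) k) <= 2 ^+ 12 * Num.sqrt M0.
      have p0 : (0 <= sobolev_sq mu (toC (u t0)))%E.
        by apply: esum_ge0 => l _; exact: sob_term_ge0.
      have fin : sobolev_sq mu (toC (u t0)) \is a fin_num.
        rewrite (ge0_fin_numE p0); exact: fin0.
      apply: (sobolev_decay _ mu24); rewrite /M0 (fineK fin); exact: lexx.
    have -> : fourier (toC (u s)) k = fourier d k + fourier (toC (u t0)) k.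
      rewrite /d (fourierD _ cs) ?fourierZ ?mulN1r ?subrK //.
      by apply: ccontM => //; exact: ccont_cst.
    apply: le_trans (ler_wpM2l _ (le_normcD _ _)) _; first by rewrite exprn_ge0 ?weight_ge0.
    by rewrite mulrDr lerD.
  exists ([set s | s \in `[0, T] -> forall k, weight R k ^+ 24 * normc (fourier (toC (u s)) k) <= A0],
    [set A | A0 <= A]).
    by split; [exact: near0|apply: nbhs_pinfty_ge; rewrite num_real].
  move=> [s A] /= [hs A0A] sT k; exact: le_trans (hs sT k) A0A.
have H : \forall A \near (pinfty_nbhs R), `[0, T]%classic `<=` P A by apply: cpt.
have [A hA] := filter_ex H.
by exists A => t k tT; exact: hA.
Unshelve. all: by end_near.
Qed.

End UniformDecay.

(** * The semidiscrete equations in coefficients *)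

Section TimeDerivative.
Variables (R : realType) (T : R).
Implicit Types (f : R -> R) (t : R).

(** Caratheodory's form of the derivative, with the difference quotient extended by
    its limit. *)
Lemma tderivable_interior f t : t \in `]0, T[ -> tderivable T f t ->
  is_derive t 1 f (tderive T f t).
Proof.
rewrite in_itv /= => /andP[t0 tT] /cvgrPdist_lt H; set l := tderive T f t in H *.
apply/is_derive1_caratheodory.
pose g z := if z == t then l else (f z - f t) / (z - t).
exists g; split; last by rewrite /g eqxx.
  move=> z; rewrite /g; case: eqVneq => [->|zt]; first by rewrite !subrr mulr0.
  by rewrite divfK // subr_eq0.
apply/cvgrPdist_lt => e e0.
have := H e e0; rewrite near_withinE near_withinE => H1.
have H2 : \forall s \near t, 0 < s < T.
  near=> s; apply/andP; split; near: s; [exact: lt_nbhsr|exact: lt_nbhsl].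
near=> z; rewrite {1}/g eqxx /g; case: eqVneq => [_|zt]; first by rewrite subrr normr0.
have zI : 0 < z < T by near: z; exact: H2.
have zI' : z \in `[0, T] by move: zI; rewrite in_itv /= => /andP[? ?]; rewrite !ltW.
move: zt zI'; near: z; exact: H1.
Unshelve. all: by end_near.
Qed.

Lemma tderivable_continuous f : (forall t, t \in `[0, T] -> tderivable T f t) ->
  {within `[0, T], continuous f}.
Proof.
move=> H; apply/subspace_continuousP => t tT.
have /cvgrPdist_lt/(_ 1 ltr01) := H t tT; set l := lim _ => Hl.
move: Hl; rewrite near_withinE near_withinE => Hl.
apply/cvgrPdist_lt => e e0; rewrite near_withinE.
have c0 : 0 < `|l| + 1 by rewrite ltr_wpDl.
near=> s => sT.
have [->|st] := eqVneq s t; first by rewrite subrr normr0.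
have h1 : `|l - tquot f t s| < 1 by move: st sT; near: s; exact: Hl.
have h2 : `|t - s| < e / (`|l| + 1).
  by near: s; move: (@cvg_id _ (nbhs t)) => /cvgrPdist_lt; apply; rewrite divr_gt0.
have h3 : `|tquot f t s| <= `|l| + 1.
  have -> : tquot f t s = l - (l - tquot f t s) by rewrite subKr.
  by rewrite (le_trans (ler_normB _ _)) // lerD2l ltW.
have -> : f t - f s = tquot f t s * (t - s).
  by rewrite /tquot -[t - s]opprB mulrN divfK ?opprB // subr_eq0.
rewrite normrM; apply: le_lt_trans (ler_wpM2r (normr_ge0 _) h3) _.
by rewrite mulrC -ltr_pdivlMr.
Unshelve. all: by end_near.
Qed.

End TimeDerivative.

Section GalerkinCoefficients.
Variables (R : realType) (N : nat).
Local Notation C := (R[i]).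
Implicit Types (f g v : R -> R) (a c : int -> C) (k : int).

Lemma dftD f g k : dft N (fun x => f x + g x) k = dft N f k + dft N g k.
Proof.
rewrite /dft -mulrDr -big_split /=; congr (_ * _); apply: eq_bigr => m _.
by rewrite -mulrDl rmorphD.
Qed.

Lemma dftN f k : dft N (fun x => - f x) k = - dft N f k.
Proof.
rewrite /dft -mulrN -sumrN; congr (_ * _); apply: eq_bigr => m _.
by rewrite -mulNr rmorphN.
Qed.

Let wnode k (m : 'I_(N.*2.*2.+1)) : C := (N.*2.*2.+1)%:R^-1 * expi (- k) (node R m).

Let dft_wnode f k : dft N f k = \sum_m (f (node R m))%:C * wnode k m.
Proof. by rewrite /dft mulr_sumr; apply: eq_bigr => m _; rewrite /wnode mulrCA. Qed.

Let ReMr (r : R) (z : C) : complex.Re (r%:C * z) = complex.Re z * r.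
Proof. by case: z => x y /=; rewrite mul0r subr0 mulrC. Qed.

Let ImMr (r : R) (z : C) : complex.Im (r%:C * z) = complex.Im z * r.
Proof. by case: z => x y /=; rewrite mul0r addr0 mulrC. Qed.

(** The discrete coefficients are finite combinations of values at the nodes, so that
    differentiability in time at each point is enough. *)
Lemma coef_curve_dft T (U : R -> R -> R) :
  (forall t x, t \in `[0, T] -> tderivable T (U^~ x) t) ->
  coef_curve N 0 T (fun t => dft N (U t)) (fun t => dft N (fun x => tderive T (U^~ x) t)).
Proof.
move=> hU k kN.
have cU x : {within `[0, T], continuous (U^~ x)}.
  by apply: tderivable_continuous => t tT; exact: hU.
have dU x t : t \in `]0, T[ -> is_derive t 1 (U^~ x) (tderive T (U^~ x) t).
  move=> tT; apply: tderivable_interior => //; apply: hU.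
  by move: tT; rewrite !in_itv /= => /andP[? ?]; rewrite !ltW.
have reE : (fun t => complex.Re (dft N (U t) k)) =
    (fun t => \sum_m complex.Re (wnode k m) * U t (node R m)).
  by apply/funext => t; rewrite dft_wnode Re_sum; apply: eq_bigr => m _; exact: ReMr.
have imE : (fun t => complex.Im (dft N (U t) k)) =
    (fun t => \sum_m complex.Im (wnode k m) * U t (node R m)).
  by apply/funext => t; rewrite dft_wnode Im_sum; apply: eq_bigr => m _; exact: ImMr.
rewrite reE imE; split.
- by apply: within_cont_sum => m; apply: within_contM; [exact: within_cst|exact: cU].
- by apply: within_cont_sum => m; apply: within_contM; [exact: within_cst|exact: cU].
- move=> t tT; rewrite dft_wnode Re_sum; apply: is_derive_fsum => m.
  have d := dU (node R m) t tT.
  by rewrite ReMr; apply: is_derive_eq; rewrite /GRing.scale /=; ring.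
- move=> t tT; rewrite dft_wnode Im_sum; apply: is_derive_fsum => m.
  have d := dU (node R m) t tT.
  by rewrite ImMr; apply: is_derive_eq; rewrite /GRing.scale /=; ring.
Qed.

Lemma coef_curve_sub (a0 e0 a1 e1 : R) (c c' d' : R -> int -> C) : a0 <= a1 -> e1 <= e0 ->
  (forall t k, t \in `]a1, e1[ -> (`|k| <= N)%N -> c' t k = d' t k) ->
  coef_curve N a0 e0 c c' -> coef_curve N a1 e1 c d'.
Proof.
move=> a01 e10 cd h k kN; have [c1 c2 d1 d2] := h k kN.
have sub : `[a1, e1]%classic `<=` `[a0, e0]%classic by apply: subset_itv; rewrite bnd_simp.
have subo t : t \in `]a1, e1[ -> t \in `]a0, e0[.
  rewrite !in_itv /= => /andP[h1 h2].
  by rewrite (le_lt_trans a01 h1) (lt_le_trans h2 e10).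
split.
- exact: continuous_subspaceW sub c1.
- exact: continuous_subspaceW sub c2.
- by move=> t te; rewrite -cd //; apply: d1; exact: subo.
- by move=> t te; rewrite -cd //; apply: d2; exact: subo.
Qed.

Lemma dft_trigsum v a k : (forall x, toC v x = trigsum a N x) -> (`|k| <= N)%N -> dft N v k = a k.
Proof.
move=> h kN; rewrite (@dft_trig R N _ (fun j : 'I_(N.*2.+1) => a (freq j)) (@freq N) v k h); last first.
  by move=> i; have := freq_le i; lia.
have [j0 <-] := freq_surj kN.
by rewrite (big_pred1 j0) // => j; rewrite (inj_eq (@freq_inj N)).
Qed.

Lemma eq_trigsum a c x : (forall k, (`|k| <= N)%N -> a k = c k) -> trigsum a N x = trigsum c N x.
Proof. by move=> h; apply: eq_bigr => j _; rewrite (h (freq j)) ?freq_le. Qed.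

Lemma inS_dft v : inS N (toC v) -> forall x, toC v x = trigsum (dft N v) N x.
Proof.
move=> [c hc] x; rewrite hc -/(trigsum c N x); apply: eq_trigsum => k kN.
by rewrite (@dft_trigsum v c).
Qed.

(** The product v v_x, as a double sum over pairs of frequencies. *)
Let pairs_trig a (x : R) : C := trigpoly
   (fun p : 'I_(N.*2.+1) * 'I_(N.*2.+1) => a (freq p.1) * ('i%C * (freq p.2)%:~R * a (freq p.2)))
   (fun p => freq p.1 + freq p.2) x.

(** Exchanging the two frequencies of a pair symmetrizes i l into i (j + l) / 2. *)
Let pairs_advection a k : \sum_(p : 'I_(N.*2.+1) * 'I_(N.*2.+1) | freq p.1 + freq p.2 == k)
   a (freq p.1) * ('i%C * (freq p.2)%:~R * a (freq p.2)) = - advection N a a k.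
Proof.
set lhs := LHS.
pose B (j l : 'I_(N.*2.+1)) (z : C) := if freq j + freq l == k then z else 0.
have lE : lhs = \sum_j \sum_l B j l (a (freq j) * ('i%C * (freq l)%:~R * a (freq l))).
  rewrite /lhs big_mkcond -(pair_bigA _ (fun j l => B j l (a (freq j) * ('i%C * (freq l)%:~R * a (freq l))))).
  by [].
have lE2 : lhs = \sum_j \sum_l B j l (a (freq l) * ('i%C * (freq j)%:~R * a (freq j))).
  rewrite lE exchange_big /=; apply: eq_bigr => j _; apply: eq_bigr => l _.
  by rewrite /B addrC.
have : lhs + lhs = 'i%C * k%:~R * convolution N a a k.
  rewrite {1}lE lE2 -big_split /convolution mulr_sumr /=; apply: eq_bigr => j _.
  rewrite -big_split [in RHS]big_mkcond mulr_sumr /=; apply: eq_bigr => l _.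
  rewrite /B; case: eqP => [<-|_]; last by rewrite addr0 mulr0.
  by rewrite intrD; ring.
move=> h; have -> : lhs = (lhs + lhs) / 2 by field.
by rewrite h /advection; field.
Qed.

Lemma advection_trig v a : (forall x, toC v x = trigsum a N x) ->
  [/\ (forall x, toC (fun y => v y * derive1 v y) x = pairs_trig a x),
      (forall x, toC (derive1n 3 v) x = trigsum (deriv_coef 3 a) N x) &
      (forall x : R, is_derive x 1 v (derive1 v x))].
Proof.
move=> h; have h' x : toC v x = trigpoly (fun j : 'I_(N.*2.+1) => a (freq j)) (@freq N) x by exact: h.
have [d1 d2] := trig_derive h'.
split => // x.
- have -> : toC (fun y => v y * derive1 v y) x = toC v x * toC (derive1 v) x.
    exact: (rmorphM (real_complex R)).
  rewrite h d2 /pairs_trig /trigpoly.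
  rewrite /trigsum /sumZ mulr_suml.
  rewrite -(pair_bigA _ (fun j l => a (freq j) * ('i%C * (freq l)%:~R * a (freq l)) * expi (freq j + freq l) x)) /=.
  apply: eq_bigr => j _; rewrite mulr_sumr; apply: eq_bigr => l _.
  by rewrite /deriv_trig (expiDl (freq j)); exact: mulrACA.
- rewrite (trig_derive3 h') trigsumE; congr trigpoly.
  by rewrite !deriv_coef_trig; congr (deriv_trig (deriv_trig (deriv_trig _ _) _) _); apply/funext => i;
    rewrite /deriv_coef expr0 mul1r.
Qed.

Lemma dispersion_deriv_coef a k : dispersion a k = - deriv_coef 3 a k.
Proof.
rewrite /dispersion /deriv_coef exprMn.
have -> : ('i%C : C) ^+ 3 = - 'i%C by rewrite exprSr sqr_i mulN1r.
by ring.
Qed.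

(** The frequencies of v v_x are at most 2N: there is no aliasing, and the discrete
    transform computes the projection exactly. *)
Lemma dft_kdv v a k : (forall x, toC v x = trigsum a N x) -> (`|k| <= N)%N ->
  dft N (fun x => - (v x * derive1 v x) - derive1n 3 v x) k = kdvF N a k.
Proof.
move=> h kN; have [h1 h3 _] := advection_trig h.
rewrite dftD !dftN (dft_trigsum h3 kN) (dft_trig h1).
  by rewrite pairs_advection opprK addrC /kdvF dispersion_deriv_coef.
by move=> [i j] /=; have := freq_le i; have := freq_le j; lia.
Qed.

Lemma fourier_advection v a k : (forall x, toC v x = trigsum a N x) ->
  fourier (toC (fun y => v y * derive1 v y)) k = - advection N a a k.
Proof. by move=> /advection_trig [h1 _ _]; rewrite (fourier_trig k h1) pairs_advection. Qed.

Lemma fourier_trigsum v a k : (forall x, toC v x = trigsum a N x) -> (`|k| <= N)%N ->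
  fourier (toC v) k = a k.
Proof. by move=> h kN; exact: (@fourier_sumZ R N a). Qed.

(** The time derivative of u^N is itself a trigonometric polynomial of degree N, as
    derivative of the coefficients; testing with e^(ikx) isolates its k-th one. *)
Lemma galerkin_ode T u0 (uN : R -> R -> R) t k : semidiscrete T N u0 uN ->
  t \in `]0, T[ -> (`|k| <= N)%N ->
  dft N (fun x => tderive T (uN^~ x) t) k = kdvF N (dft N (uN t)) k.
Proof.
move=> [uS duN gal _] tI kN.
have tT : t \in `[0, T] by move: tI; rewrite !in_itv /= => /andP[? ?]; rewrite !ltW.
set c := dft N (uN t); set ut := fun x => tderive T (uN^~ x) t; set c' := dft N ut.
have uE x s : s \in `[0, T] -> uN s x = complex.Re (trigsum (dft N (uN s)) N x).
  by move=> sT; rewrite -(inS_dft (uS s sT)).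
have utE x : toC ut x = trigsum c' N x.
  rewrite trigsum_real; last exact: herm_dft.
  congr (_%:C).
  have d1 : is_derive t 1 (uN^~ x) (ut x) by apply: tderivable_interior => //; exact: duN.
  have d2 : is_derive t 1 (fun s => complex.Re (trigsum (dft N (uN s)) N x))
      (complex.Re (trigsum c' N x)).
    rewrite Re_sum.
    have -> : (fun s => complex.Re (trigsum (dft N (uN s)) N x)) = fun s => \sum_(j < N.*2.+1)
      (complex.Re (dft N (uN s) (freq j)) * cos ((freq j)%:~R * x) -
       complex.Im (dft N (uN s) (freq j)) * sin ((freq j)%:~R * x)).
      by apply/funext => s; rewrite Re_sum; apply: eq_bigr => j _; exact: ReMexpi.
    apply: is_derive_fsum => j; rewrite ReMexpi.
    have [_ _ r1 i1] := coef_curve_dft duN (freq_le j).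
    have rj := r1 t tI; have ij := i1 t tI.
    by apply: is_derive_eq; rewrite /GRing.scale /=; ring.
  have d3 : is_derive t 1 (uN^~ x) (complex.Re (trigsum c' N x)).
    apply: near_eq_is_derive d2; move: tI; rewrite in_itv /= => /andP[t0 tT'].
    near=> s; apply/esym/uE; rewrite in_itv /=.
    by apply/andP; split; apply: ltW; near: s; [exact: lt_nbhsr|exact: lt_nbhsl].
  by rewrite -(@derive_val _ _ _ _ _ _ _ d1) (@derive_val _ _ _ _ _ _ _ d3).
have vE := inS_dft (uS t tT); rewrite -/c in vE.
have [h1 h3 _] := advection_trig vE.
have ek : inS N (expi k : R -> C).
  exists (fun l => (l == k)%:R) => x; rewrite /sumZ.
  have [j0 j0E] := freq_surj kN.
  rewrite (bigD1 j0) //= big1 => [|j jj0].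
    by rewrite -/(freq j0) j0E eqxx mul1r addr0.
  by rewrite -/(freq j) -j0E (inj_eq (@freq_inj N)) (negbTE jj0) mul0r.
have := gal t (expi k) tT ek.
rewrite inner_expi => /eqP; rewrite mulf_eq0 (negbTE (pi2_neq0 R)) /=.
have -> : (toC (fun x => tderive T (uN^~ x) t + uN t x * (uN t)^`()%classic x + (uN t)^`(3)%classic x)) =
   (fun x => (toC ut x + toC (fun y => uN t y * derive1 (uN t) y) x) + toC (derive1n 3 (uN t)) x).
  by apply/funext => x; rewrite /toC !rmorphD.
have c1 : ccont (toC ut).
  by rewrite (_ : toC ut = trigsum c' N); [exact: ccont_trig|apply/funext].
have c2 : ccont (toC (fun y => uN t y * derive1 (uN t) y)).
  by rewrite (_ : toC _ = pairs_trig c); [exact: ccont_trig|apply/funext].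
have c3 : ccont (toC (derive1n 3 (uN t))).
  by rewrite (_ : toC _ = trigsum (deriv_coef 3 c) N); [exact: ccont_trig|apply/funext].
rewrite (fourierD _ (ccontD c1 c2) c3) (fourierD _ c1 c2).
rewrite (fourier_trigsum utE kN) (fourier_trigsum h3 kN) (fourier_advection _ vE) -addrA addr_eq0.
move=> /eqP ->; rewrite /kdvF dispersion_deriv_coef; ring.
Unshelve. all: by end_near.
Qed.

Lemma F_trigsum v a x : (forall x, toC v x = trigsum a N x) ->
  F N v x = trigsum (kdvF N a) N x.
Proof.
move=> h; have [h1 h3 dv] := advection_trig h.
have fE : derive1 (flux v) = fun y => v y * derive1 v y.
  apply/funext => y; rewrite derive1E.
  have d := dv y.
  have : is_derive y 1 (flux v) (v y * derive1 v y).
    have -> : flux v = fun z => (v z * v z) * 2^-1 by apply/funext => z; rewrite /flux expr2.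
    by apply: is_derive_eq; rewrite /GRing.scale /=; field.
  by move=> /@derive_val.
rewrite /F fE h3 /PN.
have -> : sumZ N (fun k => fourier (toC (fun y => v y * derive1 v y)) k * expi k x) =
    trigsum (fun k => - advection N a a k) N x.
  by apply: eq_trigsum => k _; rewrite (fourier_advection _ h).
rewrite /trigsum /sumZ -sumrN -sumrB; apply: eq_bigr => j _.
by rewrite /kdvF dispersion_deriv_coef; ring.
Qed.

Lemma stage_coefs (k : R) (v v' : R -> R) be : inS N (toC v) -> inS N (toC v') ->
  (forall x, toC v' x = toC v x + (k * be)%:C * F N (fun y => (v' y + v y) / 2) x) ->
  forall l, (`|l| <= N)%N -> dft N v' l = dft N v l +
    (k * be)%:C * kdvF N (fun l => (dft N v' l + dft N v l) / 2) l.
Proof.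
move=> hv hv' E l lN.
have Ev := inS_dft hv; have Ev' := inS_dft hv'.
set a := dft N v; set a' := dft N v' in Ev' *.
have mE x : toC (fun y => (v' y + v y) / 2) x = trigsum (fun l => (a' l + a l) / 2) N x.
  have -> : toC (fun y => (v' y + v y) / 2) x = (toC v' x + toC v x) / 2.
    by rewrite -[in RHS](rmorph_nat (real_complex R) 2) -fmorphV -rmorphD -rmorphM.
  rewrite Ev Ev'.
  rewrite /trigsum /sumZ -big_split mulr_suml /=; apply: eq_bigr => j _.
  by rewrite -/a; ring.
have E2 x : toC v' x = trigsum (fun l => a l + (k * be)%:C * kdvF N (fun l => (a' l + a l) / 2) l) N x.
  rewrite E (F_trigsum _ mE) Ev /trigsum /sumZ mulr_sumr -big_split /=; apply: eq_bigr => j _.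
  by rewrite -/a; ring.
exact: dft_trigsum E2 lN.
Qed.

End GalerkinCoefficients.

(** * Smoothness of the semidiscrete solution, uniformly in N *)

Section WeightedSums.
Variables (R : realType) (N : nat).
Local Notation C := (R[i]).
Implicit Types (a : int -> C) (A e : R).

Lemma sum_weight_inv2 : \sum_(j < N.*2.+1) (weight R (freq j))^-1 ^+ 2 <= 3.
Proof.
(* 1 / (n + 2)^2 <= 1 / (n + 1) - 1 / (n + 2), so that the sharper bound telescopes. *)
suff : \sum_(j < N.*2.+1) (weight R (freq j))^-1 ^+ 2 <= 3 - 2 / N.+1%:R.
  by move=> h; apply: le_trans h _; rewrite lerBlDr lerDl divr_ge0.
elim: N => [|n IH].
  by rewrite big_ord1 /freq /weight /= invr1 expr1n; lra.
rewrite (sum_freqS n (fun k => (weight R k)^-1 ^+ 2)).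
have -> : weight R (- n.+1%:Z) = n.+2%:R by rewrite /weight abszN.
have -> : weight R n.+1%:Z = n.+2%:R by [].
have u0 : 0 < n.+1%:R :> R by [].
rewrite -(natr1 n.+1) in IH *; move: (n.+1%:R) u0 IH => x x0 IH.
have xn : x != 0 by rewrite gt_eqF.
have x1 : 0 < x + 1 by lra.
have xn1 : x + 1 != 0 by rewrite gt_eqF.
have -> : 3 - 2 / (x + 1) = (3 - 2 / x) + 2 / (x * (x + 1)).
  by field; rewrite xn xn1.
have h : (x + 1)^-1 ^+ 2 <= 1 / (x * (x + 1)).
  rewrite expr2 -invfM mul1r lef_pV2 ?posrE ?mulr_gt0 //.
  by rewrite ler_pM2r // lerDl.
have -> : 2 / (x * (x + 1)) = 1 / (x * (x + 1)) + 1 / (x * (x + 1)) by field; rewrite xn xn1.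
lra.
Qed.

Lemma wnorm_decay m a A : (m <= 22)%N -> (forall k, weight R k ^+ 24 * normc (a k) <= A) ->
  wnorm N m a <= 3 * A.
Proof.
move=> m22 hA.
have A0 : 0 <= A by apply: le_trans (hA 0); rewrite mulr_ge0 ?normc_ge0 ?exprn_ge0 ?weight_ge0.
apply: le_trans (_ : (\sum_(j < N.*2.+1) (weight R (freq j))^-1 ^+ 2) * A <= _); last first.
  by rewrite ler_wpM2r // sum_weight_inv2.
rewrite mulr_suml; apply: ler_sum => j _.
have w0 : 0 < weight R (freq j) ^+ 2 by exact: weight_pow_gt0.
rewrite exprVn ler_pdivlMl // mulrA -exprD; apply: le_trans (hA (freq j)).
by rewrite ler_wpM2r ?normc_ge0 // ler_weXn2l ?weight_ge1.
Qed.

Lemma wnorm_sup m a e : (forall k, (`|k| <= N)%N -> normc (a k) <= e) ->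
  wnorm N m a <= 2 * (N.+1%:R ^+ m.+1 * e).
Proof.
move=> h.
have e0 : 0 <= e by apply: le_trans (h 0 isT); exact: normc_ge0.
apply: le_trans (_ : \sum_(j < N.*2.+1) N.+1%:R ^+ m * e <= _).
  apply: ler_sum => j _; apply: ler_pM; rewrite ?exprn_ge0 ?weight_ge0 ?normc_ge0 ?h ?freq_le //.
  by rewrite lerXn2r ?nnegrE ?weight_ge0 // /weight ler_nat ltnS freq_le.
rewrite sumr_const card_ord -[leLHS]mulr_natl exprS -!mulrA [leRHS]mulrA.
rewrite ler_wpM2r ?mulr_ge0 ?exprn_ge0 // -natrM ler_nat; lia.
Qed.

Lemma sqnorm_sup a e : (forall k, (`|k| <= N)%N -> normc (a k) <= e) ->
  sqnorm N a <= 2 * (N.+1%:R * e ^+ 2).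
Proof.
move=> h.
have e0 : 0 <= e by apply: le_trans (h 0 isT); exact: normc_ge0.
apply: le_trans (_ : \sum_(j < N.*2.+1) e ^+ 2 <= _).
  by apply: ler_sum => j _; rewrite lerXn2r ?nnegrE ?normc_ge0 // h ?freq_le.
rewrite sumr_const card_ord -[leLHS]mulr_natl mulrA ler_wpM2r ?sqr_ge0 //.
by rewrite -natrM ler_nat; lia.
Qed.

Lemma trigsum_wnorm j a n (x : R) : normc (trigsum (deriv_coef j a) n x) <= wnorm n j a.
Proof.
apply: le_trans (normc_sum _ _) _; apply: ler_sum => i _.
rewrite normcM normc_expi mulr1 normcM ler_wpM2r ?normc_ge0 //.
elim: j => [|j IH]; first by rewrite normc1.
by rewrite exprS normcM exprS ler_pM ?normc_ge0 // normcM normci mul1r normc_int_weight.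
Qed.

End WeightedSums.

(** In this section f is u(t) at a fixed time and [ft] its time derivative, a
    combination of space derivatives of f.  Everything is compared with [v], the
    partial Fourier sum P_N f, whose discrete and integral coefficients agree. *)
Section Residual.
Variables (R : realType) (N : nat) (f : R -> R) (A : R).
Local Notation C := (R[i]).
Hypothesis hA : forall k, weight R k ^+ 24 * normc (fourier (toC f) k) <= A.
Hypothesis df : forall j x, (j < 3)%N -> derivable (derive1n j f) x 1.

Let a := fourier (toC f).
Let h : R := N.+1%:R^-1 ^+ 16.
Let v (x : R) : R := complex.Re (trigsum a N x).

Let A0 : 0 <= A.
Proof. by apply: le_trans (hA 0); rewrite mulr_ge0 ?normc_ge0 ?exprn_ge0 ?weight_ge0. Qed.

Let n1 : 1 <= N.+1%:R :> R.
Proof. by rewrite ler1n. Qed.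

Let tailbd_h m : (m <= 4)%N -> N.+1%:R ^+ m * tailbd A N <= 2 * A * h.
Proof.
move=> m4; rewrite /tailbd mulrCA ler_wpM2l ?mulr_ge0 // /h.
have n0 : 0 < N.+1%:R :> R by [].
rewrite !exprVn ler_pdivrMr ?exprn_gt0 // mulrC ler_pdivlMr ?exprn_gt0 // -exprD.
by rewrite ler_weXn2l //; lia.
Qed.

Let h1 : h <= 1.
Proof. by rewrite exprn_ile1 ?invr_ge0 // invf_le1. Qed.

Let h0 : 0 <= h.
Proof. by rewrite exprn_ge0 ?invr_ge0. Qed.

Let tailbd_le : tailbd A N <= 2 * A.
Proof.
have := @tailbd_h 0 isT; rewrite expr0 mul1r => t; apply: le_trans t _.
by rewrite ler_piMr ?mulr_ge0.
Qed.

Lemma sobolev_continuous : {within @cell R, continuous f}.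
Proof.
apply: (@within_derive R _ f (fun x => 'D_1 f x)) => x.
have d : derivable f x 1 := @df 0%N x isT.
exact: derivableP.
Qed.

Let herm_a : herm a := herm_fourier sobolev_continuous.

Let vE x : toC v x = trigsum a N x.
Proof. by rewrite /v [RHS]trigsum_real. Qed.

Let dc0 : deriv_coef 0 a = a.
Proof. by apply/funext => k; rewrite /deriv_coef expr0 mul1r. Qed.

Let v_deriv (x : R) : derive1 v x = complex.Re (trigsum (deriv_coef 1 a) N x).
Proof.
rewrite derive1E; have := is_derive_trigsum 0 a N x; rewrite dc0 => d.
by rewrite (@derive_val _ _ _ _ _ _ _ d).
Qed.

Let v_deriv3 (x : R) : derive1n 3 v x = complex.Re (trigsum (deriv_coef 3 a) N x).
Proof. by have [_ + _] := advection_trig vE => /(_ x) <-. Qed.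

Lemma dft_fourier k : (`|k| <= N)%N -> normc (dft N f k - fourier (toC f) k) <= tailbd A N.
Proof.
move=> kN; rewrite -/a -(dft_trigsum vE kN) -dftB; apply: dft_bound => m.
have := fourier_approx hA df N (isT : (0 <= 3)%N) (node_bound R m).
by rewrite /= -/a dc0.
Qed.

Lemma wnorm_dft_fourier m : (m <= 15)%N ->
  wnorm N m (fun k => dft N f k - fourier (toC f) k) <= 4 * A.
Proof.
move=> m15; apply: le_trans (wnorm_sup m dft_fourier) _.
have -> : 4 * A = 2 * (2 * A) by ring.
rewrite ler_wpM2l // /tailbd mulrCA ler_piMr ?mulr_ge0 // exprVn.
by rewrite ler_pdivrMr ?exprn_gt0 // mul1r ler_weXn2l //; lia.
Qed.

Let wnorm_rho m : (m <= 3)%N -> wnorm N m (fun k => dft N f k - a k) <= 4 * A * h.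
Proof.
move=> m3; apply: le_trans (wnorm_sup m dft_fourier) _.
have -> : 4 * A * h = 2 * (2 * A * h) by ring.
by rewrite ler_wpM2l // tailbd_h.
Qed.

Definition residual_bound : R := 4 * A * (8 * A + 1) + 4 * A + 24 * A ^+ 2 + 16 * A ^+ 2.

(** At the nodes, [ft] differs from the KdV field of [v] by a multiple of the tail
    bound; passing from the coefficients of [v] to those sampled from f changes the
    field by a term that loses three derivatives and one factor N + 1, whence
    16 = 20 - 4. *)
Lemma residual_le (ft : R -> R) :
  (forall x, ft x + f x * derive1 f x + derive1n 3 f x = 0) ->
  wnorm N 0 (fun k => dft N ft k - kdvF N (dft N f) k) <= residual_bound * h.
Proof.
move=> hft.
pose w x := - (v x * derive1 v x) - derive1n 3 v x.
pose de k := dft N (fun x => ft x - w x) k.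
pose rho k := dft N f k - a k.
have deB k : normc (de k) <= (8 * A + 1) * tailbd A N.
  apply: dft_bound => m; set x := node R m.
  have xI := node_bound R m.
  have f0 := fourier_approx hA df N (isT : (0 <= 3)%N) xI.
  have f1 := fourier_approx hA df N (isT : (1 <= 3)%N) xI.
  have f3 := fourier_approx hA df N (isT : (3 <= 3)%N) xI.
  rewrite -/x /= -/a dc0 -/(v x) in f0.
  rewrite -/x -/a -v_deriv in f1; rewrite -/x -/a -v_deriv3 in f3.
  have v0 : `|v x| <= 3 * A.
    rewrite /v -[in X in trigsum X]dc0; apply: le_trans (normc_re _) _.
    by apply: le_trans (trigsum_wnorm _ _ _ _) _; exact: wnorm_decay.
  have v1 : `|derive1 v x| <= 3 * A.
    rewrite v_deriv; apply: le_trans (normc_re _) _.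
    by apply: le_trans (trigsum_wnorm _ _ _ _) _; exact: wnorm_decay.
  have f1' : `|derive1 f x| <= 5 * A.
    have -> : derive1 f x = (derive1n 1 f x - derive1 v x) + derive1 v x by rewrite subrK.
    apply: le_trans (ler_normD _ _) _; have := lerD (le_trans f1 tailbd_le) v1; lra.
  have -> : ft x - w x = - ((f x - v x) * derive1 f x + v x * (derive1n 1 f x - derive1 v x))
      - (derive1n 3 f x - derive1n 3 v x).
    have : ft x = - (f x * derive1 f x) - derive1n 3 f x by have := hft x; lra.
    rewrite /w => ->; rewrite -[derive1n 1 f x]/(derive1 f x).
    move: (f x) (v x) (derive1 f x) (derive1 v x) (derive1n 3 f x) (derive1n 3 v x) => *.
    by ring.
  apply: le_trans (ler_normB _ _) _; rewrite normrN.
  have -> : (8 * A + 1) * tailbd A N = (tailbd A N * (5 * A) + 3 * A * tailbd A N) + tailbd A N by ring.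
  apply: lerD => //; apply: le_trans (ler_normD _ _) _; rewrite !normrM.
  by apply: lerD; apply: ler_pM.
have E k : (`|k| <= N)%N -> dft N ft k - kdvF N (dft N f) k =
    de k + (-1) * (dispersion rho k + (2 * advection N a rho k + advection N rho rho k)).
  move=> kN.
  have -> : dft N ft k = de k + kdvF N a k.
    by rewrite -(dft_kdv vE kN) /de dftB subrK.
  have -> : kdvF N (dft N f) k = kdvF N (fun l => a l + rho l) k.
    by congr kdvF; apply/funext => l; rewrite /rho addrC subrK.
  rewrite kdvF_add /dkdvF; move: (de k) (kdvF N a k) (dispersion rho k) (advection N a rho k) (advection N rho rho k) => *.
  by ring.
rewrite (eq_wnorm 0 E) {E}.
have n2 : normc (2 : C) <= 2 by rewrite -[2]/((2 : int)%:~R) normc_int ger0_norm.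
have nN1 : normc (-1 : C) <= 1 by rewrite normcN normc1.
have r1 := @wnorm_rho 1 isT; have r3 := @wnorm_rho 3 isT.
have a1 : wnorm N 1 a <= 3 * A by exact: wnorm_decay.
apply: le_trans (wnormD_le (wnorm_sup 0 (fun k _ => deB k)) (wnormZ_le nN1 (wnormD_le
   (le_trans (wnorm_dispersion _ _ _) r3) (wnormD_le (wnormZ_le n2 (wnorm_advection_le a1 r1)) (wnorm_advection_le r1 r1))))) _.
have t1 := @tailbd_h 1 isT.
have -> : residual_bound * h = 2 * ((8 * A + 1) * (2 * A * h)) +
   1 * (4 * A * h + (2 * (3 * A * (4 * A * h)) + 16 * A ^+ 2 * h)) by rewrite /residual_bound; ring.
apply: lerD.
  by rewrite ler_wpM2l // mulrCA ler_wpM2l // addr_ge0 ?mulr_ge0.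
rewrite !mul1r lerD2l lerD2l.
have -> : 4 * A * h * (4 * A * h) = 16 * A ^+ 2 * h * h by ring.
by rewrite ler_piMr // !mulr_ge0 ?sqr_ge0.
Qed.

End Residual.

(** The inverse inequality: an l2 error of order (N + 1)^-16 has a [wnorm] of index 15
    that is bounded, each weight being at most N + 1 and the number of frequencies
    at most 2 (N + 1). *)
Section SemidiscreteBound.
Variable R : realType.
Local Notation C := (R[i]).

Lemma normc_le_sqnorm N (a : int -> C) k : (`|k| <= N)%N -> normc (a k) <= Num.sqrt (sqnorm N a).
Proof.
move=> kN; have [j0 <-] := freq_surj kN.
rewrite -[leLHS]ger0_norm ?normc_ge0 // -sqrtr_sqr ler_wsqrtr //.
by rewrite /sqnorm (bigD1 j0) //= lerDl sumr_ge0 // => *; exact: sqr_ge0.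
Qed.

Lemma semidiscrete_bound (T mu : R) u0 (u : R -> R -> R) :
  0 < T -> 24 <= mu -> kdv_solution T mu u0 u ->
  exists2 K, 0 <= K & forall N uN, semidiscrete T N u0 uN ->
    forall t, t \in `[0, T] -> wnorm N 15 (dft N (uN t)) <= K.
Proof.
move=> T0 mu24 [uH uini ud utd ueq].
have df t (tT : t \in `[0, T]) j x (j3 : (j < 3)%N) : derivable (derive1n j (u t)) x 1 by exact: ud.
have cu t : t \in `[0, T] -> ccont (toC (u t)).
  by move=> tT; apply: ccont_toC; exact: (sobolev_continuous (df t tT)).
have [A hA] := uniform_decay mu24 uH cu.
have T0' : 0 \in `[0, T] by rewrite in_itv /= lexx ltW.
have A0 : 0 <= A.
  by apply: le_trans (hA 0 0 T0'); rewrite mulr_ge0 ?normc_ge0 ?exprn_ge0 ?weight_ge0.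
pose D := residual_bound A.
have D0 : 0 <= D by rewrite /D /residual_bound !addr_ge0 ?mulr_ge0 ?sqr_ge0 ?addr_ge0 ?mulr_ge0.
pose E2 := (8 * A ^+ 2 + D ^+ 2 * T) * expR ((2 * (7 * A) + 1) * T).
have E0 : 0 <= E2 by rewrite mulr_ge0 ?expR_ge0 // addr_ge0 ?mulr_ge0 ?sqr_ge0 // ltW.
exists (3 * A + 4 * A + 2 * Num.sqrt E2).
  by rewrite !addr_ge0 ?mulr_ge0 ?sqrtr_ge0.
move=> N uN sd t tT; have [uS duN _ uN0] := sd.
set h : R := N.+1%:R^-1 ^+ 16.
have h0 : 0 <= h by rewrite exprn_ge0 ?invr_ge0.
have n1 : 1 <= N.+1%:R :> R by rewrite ler1n.
pose ft s x := tderive T (u^~ x) s.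
pose r s k := dft N (ft s) k - kdvF N (dft N (u s)) k.
have sub s : s \in `]0, T[ -> s \in `[0, T].
  by rewrite !in_itv /= => /andP[? ?]; rewrite !ltW.
have curve_c : coef_curve N 0 T (fun s => dft N (uN s)) (fun s => kdvF N (dft N (uN s))).
  apply: (coef_curve_sub _ _ _ (coef_curve_dft duN)) => // s k sT kN.
  exact: galerkin_ode sd sT kN.
have curve_p : coef_curve N 0 T (fun s => dft N (u s)) (fun s k => kdvF N (dft N (u s)) k + r s k).
  apply: (coef_curve_sub _ _ _ (coef_curve_dft utd)) => // s k sT kN.
  by rewrite /r addrC subrK.
have wnorm_p s m : (m <= 15)%N -> s \in `[0, T] -> wnorm N m (dft N (u s)) <= 3 * A + 4 * A.
  move=> m15 sT.
  have -> : dft N (u s) = fun k => fourier (toC (u s)) k + (dft N (u s) k - fourier (toC (u s)) k).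
    by apply/funext => k; rewrite addrC subrK.
  apply: wnormD_le; first by apply: wnorm_decay; [exact: leq_trans m15 (isT : (15 <= 22)%N)|move=> k; exact: hA].
  by apply: wnorm_dft_fourier => //; [move=> k; exact: hA|exact: df].
have := @flow_stable R N 0 T (7 * A) (D * h) 1 _ _ r ltr01 _ _ _ curve_c curve_p _ _ t tT.
have Q0 : 0 <= 7 * A by rewrite mulr_ge0.
move=> /(_ Q0 (fun s _ => herm_dft N (uN s)) (fun s _ => herm_dft N (u s))).
have hQ s : s \in `]0, T[ -> wnorm N 1 (dft N (u s)) <= 7 * A.
  by move=> sT; apply: le_trans (wnorm_p s 1%N isT (sub s sT)) _; lra.
have hr s : s \in `]0, T[ -> wnorm N 0 (r s) <= D * h.
  move=> sT; have sT' := sub s sT.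
  apply: residual_le => //; [by move=> k; exact: hA|exact: df|by move=> x; exact: ueq].
move=> /(_ hQ hr); rewrite subr0 mul1r invr1 => hn.
have {hn} hn : sqnorm N (fun k => dft N (uN t) k - dft N (u t) k) <= E2 * h ^+ 2.
  apply: le_trans hn _.
  have i0 : sqnorm N (fun k => dft N (uN 0) k - dft N (u 0) k) <= 8 * A ^+ 2 * h ^+ 2.
    apply: le_trans (_ : 2 * (N.+1%:R * tailbd A N ^+ 2) <= _).
      apply: sqnorm_sup => k kN.
      have -> : dft N (uN 0) k = fourier (toC (u 0)) k.
        have -> : u 0 = u0 by apply/funext.
        exact: dft_trigsum uN0 kN.
      rewrite -normcN opprB; apply: dft_fourier => //; [by move=> l; exact: hA|exact: df].
    have -> : 2 * (N.+1%:R * tailbd A N ^+ 2) = 8 * A ^+ 2 * (N.+1%:R * (N.+1%:R^-1 ^+ 20) ^+ 2).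
      by rewrite /tailbd; ring.
    rewrite ler_wpM2l ?mulr_ge0 ?sqr_ge0 // /h -!exprM !exprVn ler_pdivrMr ?exprn_gt0 //.
    by rewrite mulrC ler_pdivlMr ?exprn_gt0 // -exprS ler_weXn2l.
  have /andP[t0 tT'] : 0 <= t <= T by move: tT; rewrite in_itv.
  have -> : E2 * h ^+ 2 = (8 * A ^+ 2 * h ^+ 2 + (D * h) ^+ 2 * T) * expR ((2 * (7 * A) + 1) * T).
    by rewrite /E2; ring.
  apply: ler_pM; rewrite ?expR_ge0 //.
  - by rewrite addr_ge0 ?sqnorm_ge0 // mulr_ge0 ?sqr_ge0.
  - by rewrite lerD // ler_wpM2l ?sqr_ge0.
  - by rewrite ler_expR ler_wpM2l // addr_ge0 // mulr_ge0.
have -> : dft N (uN t) = fun k => dft N (u t) k + (dft N (uN t) k - dft N (u t) k).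
  by apply/funext => k; rewrite addrC subrK.
apply: wnormD_le; first exact: wnorm_p.
apply: le_trans (_ : 2 * (N.+1%:R ^+ 16 * (Num.sqrt E2 * h)) <= _).
  apply: wnorm_sup => k kN; apply: le_trans (normc_le_sqnorm (fun k => dft N (uN t) k - dft N (u t) k) kN) _.
  apply: le_trans (ler_wsqrtr hn) _.
  by rewrite sqrtrM // sqrtr_sqr ger0_norm.
have n0 : N.+1%:R ^+ 16 != 0 :> R by rewrite expf_neq0 // pnatr_eq0.
by rewrite [X in 2 * X]mulrCA /h exprVn mulfV // mulr1.
Qed.

End SemidiscreteBound.

(** * The local temporal error *)

Section LocalError.
Variables (R : realType) (N : nat).
Local Notation C := (R[i]).
Implicit Types (a : int -> C).

Lemma coef_curve_poly4 (s e : R) (z0 z1 z2 z3 z4 : int -> C) :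
  coef_curve N s e (fun t k => z0 k + ((t - s)%:C * z1 k + (t - s)%:C ^+ 2 * z2 k
      + (t - s)%:C ^+ 3 * z3 k + (t - s)%:C ^+ 4 * z4 k))
    (fun t k => z1 k + (t - s)%:C * (2 * z2 k) + (t - s)%:C ^+ 2 * (3 * z3 k)
      + (t - s)%:C ^+ 3 * (4 * z4 k)).
Proof.
move=> k _.
have poly (p0 p1 p2 p3 p4 : R) (t : R) : is_derive t 1
    (fun t => p0 + (t - s) * (p1 + (t - s) * (p2 + (t - s) * (p3 + (t - s) * p4))))
    (p1 + (t - s) * (2 * p2) + (t - s) ^+ 2 * (3 * p3) + (t - s) ^+ 3 * (4 * p4)).
  by apply: is_derive_eq; rewrite /GRing.scale /=; ring.
have cont (p0 p1 p2 p3 p4 : R) : {within `[s, e], continuous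
    (fun t => p0 + (t - s) * (p1 + (t - s) * (p2 + (t - s) * (p3 + (t - s) * p4))))}.
  exact: (within_derive (poly p0 p1 p2 p3 p4)).
case: (z0 k) (z1 k) (z2 k) (z3 k) (z4 k) => [x0 y0] [x1 y1] [x2 y2] [x3 y3] [x4 y4].
have reE : (fun t : R => complex.Re ((x0 +i* y0) + ((t - s)%:C * (x1 +i* y1) + (t - s)%:C ^+ 2 * (x2 +i* y2)
      + (t - s)%:C ^+ 3 * (x3 +i* y3) + (t - s)%:C ^+ 4 * (x4 +i* y4)))) =
   (fun t => x0 + (t - s) * (x1 + (t - s) * (x2 + (t - s) * (x3 + (t - s) * x4)))).
  by apply/funext => t; rewrite -!rmorphXn /=; ring.
have imE : (fun t : R => complex.Im ((x0 +i* y0) + ((t - s)%:C * (x1 +i* y1) + (t - s)%:C ^+ 2 * (x2 +i* y2)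
      + (t - s)%:C ^+ 3 * (x3 +i* y3) + (t - s)%:C ^+ 4 * (x4 +i* y4)))) =
   (fun t => y0 + (t - s) * (y1 + (t - s) * (y2 + (t - s) * (y3 + (t - s) * y4)))).
  by apply/funext => t; rewrite -!rmorphXn /=; ring.
rewrite reE imE.
have cn (n : nat) : n%:R = (n%:R : R)%:C by rewrite rmorph_nat.
split => // t _; rewrite (cn 2%N) (cn 3%N) (cn 4%N) -!rmorphXn.
- rewrite (_ : complex.Re _ = x1 + (t - s) * (2 * x2) + (t - s) ^+ 2 * (3 * x3)
    + (t - s) ^+ 3 * (4 * x4)); first exact: poly.
  by rewrite /=; ring.
- rewrite (_ : complex.Im _ = y1 + (t - s) * (2 * y2) + (t - s) ^+ 2 * (3 * y3)
    + (t - s) ^+ 3 * (4 * y4)); first exact: poly.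
  by rewrite /=; ring.
Qed.

Lemma sqnormB a c : sqnorm N (fun k => a k - c k) <= 2 * sqnorm N a + 2 * sqnorm N c.
Proof.
rewrite /sqnorm !mulr_sumr -big_split /=; apply: ler_sum => j _; rewrite !normc2E.
case: (a _) (c _) => x y [x' y'] /=.
have := sqr_ge0 (x + x'); have := sqr_ge0 (y + y'); lra.
Qed.

Variables (v : int -> C) (K : R).
Hypotheses (K0 : 0 <= K) (hv : herm v) (vK : wnorm N 15 v <= K).

Lemma conj_flow_coef i : conjc (flow_coef R i) = flow_coef R i.
Proof.
have r1 (x : R) : conjc (x%:C) = x%:C by exact: conjc_real.
have h (n : nat) : conjc (1 / n%:R : C) = 1 / n%:R.
  by rewrite conjcM conjc1 conjc_inv conjc_nat.
by case: i => [|[|[|[|[|[|[|i]]]]]]]; rewrite /flow_coef ?h // conjc1.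
Qed.

Lemma normc_flow_coef i : normc (flow_coef R i) <= 1.
Proof.
have h (n : nat) : normc (1 / n.+1%:R : C) <= 1.
  rewrite normcM normc1 mul1r normcV.
  have -> : normc (n.+1%:R : C) = n.+1%:R.
    by rewrite -[n.+1%:R]/((n.+1%:Z)%:~R) normc_int ger0_norm // ler0z.
  by rewrite invf_le1 // ler1n.
by case: i => [|[|[|[|[|[|[|i]]]]]]]; rewrite /flow_coef ?normc1 // h.
Qed.

(** The Taylor polynomial starts at the same point as the curve [c] and solves its
    equation up to a residual of order k^4; [flow_stable] with [delta = k] gains the
    missing power of k. *)
Lemma taylor_flow_close (s k : R) (c : R -> int -> C) : 0 < k -> k <= 1 ->
  (forall t, t \in `]s, s + k[ -> herm (c t)) ->
  coef_curve N s (s + k) c (fun t => kdvF N (c t)) ->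
  (forall l, (`|l| <= N)%N -> c s l = v l) ->
  sqnorm N (fun l => c (s + k) l - series4 N v (flow_coef R) k%:C l) <=
    (k ^+ 5 * remainder_bound K 1) ^+ 2
      * expR (2 * (K + 7 * (1 * elem_diff_bound K)) + 1).
Proof.
move=> k0 k1 hc dc cs.
pose p t := series4 N v (flow_coef R) (t - s)%:C.
pose r t l := - ((t - s)%:C ^+ 4) * remainder N v (flow_coef R) (t - s)%:C l.
have E0 : 0 <= elem_diff_bound K by apply: le_trans (wnorm_elem_diff K0 vK (isT : (0 < 1)%N)); exact: wnorm_ge0.
have dp : coef_curve N s (s + k) p (fun t l => kdvF N (p t) l + r t l).
  have -> : (fun t l => kdvF N (p t) l + r t l) = (fun t l => elem_diff N v 1 l
      + (t - s)%:C * (2 * (1 / 2 * elem_diff N v 2 l))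
      + (t - s)%:C ^+ 2 * (3 * (1 / 3 * elem_diff N v 3 l + 1 / 6 * elem_diff N v 4 l))
      + (t - s)%:C ^+ 3 * (4 * (1 / 4 * elem_diff N v 5 l + 1 / 12 * elem_diff N v 6 l + 1 / 24 * elem_diff N v 7 l))).
    apply/funext => t; apply/funext => l; rewrite /p kdvF_series4 /r mulNr addrK /field_series /rate /flow_coef.
    move: (elem_diff N v 1 l) (elem_diff N v 2 l) (elem_diff N v 3 l) (elem_diff N v 4 l) (elem_diff N v 5 l) (elem_diff N v 6 l) (elem_diff N v 7 l) => *.
    by field.
  have -> : p = (fun t l => v l + ((t - s)%:C * elem_diff N v 1 l + (t - s)%:C ^+ 2 * (1 / 2 * elem_diff N v 2 l)
      + (t - s)%:C ^+ 3 * (1 / 3 * elem_diff N v 3 l + 1 / 6 * elem_diff N v 4 l)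
      + (t - s)%:C ^+ 4 * (1 / 4 * elem_diff N v 5 l + 1 / 12 * elem_diff N v 6 l + 1 / 24 * elem_diff N v 7 l))).
    apply/funext => t; apply/funext => l; rewrite /p /series4 /flow_coef.
    by rewrite mulr1 -[X in _ + (_ + X + _ + _)]mulrA.
  exact: coef_curve_poly4.
have nh t : t \in `]s, s + k[ -> normc (t - s)%:C <= k.
  by rewrite normcR in_itv /= => /andP[h1 h2]; rewrite ger0_norm; lra.
have hp t : t \in `]s, s + k[ -> herm (p t).
  by move=> _; apply: herm_series4 => //; [exact: conjc_real|exact: conj_flow_coef].
have Q0 : 0 <= K + 7 * (1 * elem_diff_bound K) by rewrite addr_ge0 // !mulr_ge0.
have hQ t : t \in `]s, s + k[ -> wnorm N 1 (p t) <= K + 7 * (1 * elem_diff_bound K).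
  move=> tI; apply: wnorm_series4 => //; first exact: normc_flow_coef.
  exact: le_trans (nh t tI) k1.
have hr t : t \in `]s, s + k[ -> wnorm N 0 (r t) <= k ^+ 4 * remainder_bound K 1.
  move=> tI; apply: wnormZ_le.
    rewrite normcN; have := nh t tI; move: ((t - s)%:C) => z hz.
    have hX n : normc (z ^+ n) <= k ^+ n.
      elim: n => [|n IH]; first by rewrite normc1.
      by rewrite exprS normcM exprS ler_pM ?normc_ge0.
    exact: hX.
  apply: wnorm_remainder => //; first exact: normc_flow_coef.
  exact: le_trans (nh t tI) k1.
have sk : s + k \in `[s, s + k] by rewrite in_itv /= lexx andbT lerDl ltW.
have := flow_stable k0 Q0 hc hp dc dp hQ hr sk.
rewrite addrAC subrr add0r.
have -> : sqnorm N (fun l => c s l - p s l) = 0.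
  rewrite /sqnorm big1 // => j _.
  have -> : p s (freq j) = v (freq j).
    rewrite /p subrr /series4 !exprS !mul0r; ring.
  by rewrite cs ?freq_le // subrr normc0 expr0n.
rewrite add0r [p _]/(series4 _ _ _ _) addrAC subrr add0r => h; apply: le_trans h _.
have -> : k * (k ^+ 4 * remainder_bound K 1) ^+ 2 * k = (k ^+ 5 * remainder_bound K 1) ^+ 2 by ring.
rewrite ler_wpM2l ?sqr_ge0 // ler_expR mulrDl mulVf ?gt_eqF // lerD2r.
by rewrite ler_piMr // mulr_ge0.
Qed.

(** Three uses of [midpoint_stable], from equal starting values; the residual of each
    is k times the remainder of order k^4.  The constant is 52 = 4 (1 + 3 + 9). *)
Lemma stages_close (A k B : R) (W : nat -> int -> C) :
  0 <= A ->
  (forall n i, (n <= 3)%N -> normc (stage_coef R n i) <= A) ->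
  (forall n i, (n < 3)%N -> normc (mean2 (stage_coef R n) (stage_coef R n.+1) i) <= A) ->
  (forall n, `|b R n| <= B) -> 0 < k -> k <= 1 ->
  k * (B * (K + 7 * (A * elem_diff_bound K))) <= 1 / 4 ->
  (forall n, (n <= 3)%N -> herm (W n)) ->
  (forall l, (`|l| <= N)%N -> W 0%N l = v l) ->
  (forall n l, (n < 3)%N -> (`|l| <= N)%N -> W n.+1 l = W n l +
     (k * b R n.+1)%:C * kdvF N (fun l => (W n.+1 l + W n l) / 2) l) ->
  sqnorm N (fun l => W 3%N l - series4 N v (flow_coef R) k%:C l) <=
    52 * (k ^+ 5 * (B * remainder_bound K A)) ^+ 2.
Proof.
move=> A0 sA mA hB k0 k1 kQ hW W0 WS.
have nk : normc (k%:C : C) <= 1 by rewrite normcR ger0_norm // ltW.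
have E0 : 0 <= elem_diff_bound K by apply: le_trans (wnorm_elem_diff K0 vK (isT : (0 < 1)%N)); exact: wnorm_ge0.
have B0 : 0 <= B by apply: le_trans (hB 0%N); exact: normr_ge0.
pose Z n := series4 N v (stage_coef R n) k%:C.
pose q := 4 * (k ^+ 5 * (B * remainder_bound K A)) ^+ 2.
have hZ n : herm (Z n).
  by apply: herm_series4 => //; [exact: conjc_real|exact: conj_stage_coef].
have step n : (n < 3)%N -> sqnorm N (fun l => W n.+1 l - Z n.+1 l) <=
    3 * sqnorm N (fun l => W n l - Z n l) + q.
  move=> n3.
  pose r l := k%:C ^+ 4 * remainder N v (mean2 (stage_coef R n) (stage_coef R n.+1)) k%:C l.
  have rb : wnorm N 0 r <= k ^+ 4 * remainder_bound K A.
    apply: wnormZ_le; first by rewrite -rmorphXn normcR ger0_norm // exprn_ge0 // ltW.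
    by apply: wnorm_remainder => // i; exact: mA.
  have ZS l : (`|l| <= N)%N -> Z n.+1 l = Z n l + (k * b R n.+1)%:C *
      (kdvF N (fun l => (Z n.+1 l + Z n l) / 2) l - r l).
    by move=> _; rewrite /Z series4_stage rmorphM.
  have mQ : wnorm N 1 (fun l => (Z n.+1 l + Z n l) / 2) <= K + 7 * (A * elem_diff_bound K).
    have -> : (fun l => (Z n.+1 l + Z n l) / 2) =
        series4 N v (mean2 (stage_coef R n) (stage_coef R n.+1)) k%:C.
      by apply/funext => l; rewrite /Z /series4 /mean2; field.
    by apply: wnorm_series4 => // i; exact: mA.
  have xQ : `|k * b R n.+1| * (K + 7 * (A * elem_diff_bound K)) <= 1 / 4.
    apply: le_trans kQ; rewrite normrM (gtr0_norm k0) -mulrA ler_pM2l //.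
    by rewrite ler_wpM2r // addr_ge0 // !mulr_ge0.
  have := midpoint_stable (hW n (ltnW n3)) (hW n.+1 n3) (hZ n) (hZ n.+1)
    (fun l lN => WS n l n3 lN) ZS mQ xQ.
  move=> h; apply: le_trans h _; rewrite lerD2l /q ler_wpM2l //.
  have kb : `|k * b R n.+1| <= k * B by rewrite normrM (gtr0_norm k0) ler_pM2l.
  have R0 : 0 <= k ^+ 4 * remainder_bound K A by exact: le_trans (wnorm_ge0 _ _ _) rb.
  have -> : k ^+ 5 * (B * remainder_bound K A) = (k * B) * (k ^+ 4 * remainder_bound K A) by ring.
  rewrite -(real_normK (num_real (k * b R n.+1 * _))) normrM (ger0_norm (wnorm_ge0 _ _ _)).
  have le1 : `|k * b R n.+1| * wnorm N 0 r <= (k * B) * (k ^+ 4 * remainder_bound K A).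
    by apply: ler_pM; rewrite ?wnorm_ge0 ?normr_ge0.
  have kB0 : 0 <= k * B by rewrite mulr_ge0 // ltW.
  apply: lerXn2r le1; rewrite nnegrE; first by apply: mulr_ge0; rewrite ?wnorm_ge0 ?normr_ge0.
  exact: mulr_ge0.
have s0 : sqnorm N (fun l => W 0%N l - Z 0%N l) = 0.
  rewrite /sqnorm big1 // => j _.
  have -> : Z 0%N (freq j) = v (freq j) by rewrite /Z /series4 /=; ring.
  by rewrite W0 ?freq_le // subrr normc0 expr0n.
have -> : series4 N v (flow_coef R) k%:C = Z 3%N.
  have E i : (0 < i <= 7)%N -> flow_coef R i = stage_coef R 3 i.
    by move=> h; rewrite stage_coef_order4.
  by apply/funext => l; rewrite /Z /series4 !E.
have st1 := step 0%N isT; have st2 := step 1%N isT; have st3 := step 2%N isT.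
rewrite s0 mulr0 add0r in st1.
have -> : 52 * (k ^+ 5 * (B * remainder_bound K A)) ^+ 2 = 13 * q by rewrite /q; ring.
lra.
Qed.

End LocalError.

Lemma elem_diff_bound_ge0 (R : realType) (K : R) : 0 <= K -> 0 <= elem_diff_bound K.
Proof.
move=> K0; have v0 : wnorm 0 15 (fun=> 0 : R[i]) <= K.
  by rewrite /wnorm big1 // => j _; rewrite normc0 mulr0.
by apply: le_trans (wnorm_elem_diff K0 v0 (isT : (0 < 1)%N)); exact: wnorm_ge0.
Qed.

Theorem proposition4p4 (R : realType) :
  exists mu0 : R,
  forall (T mu C1 : R) (u0 : R -> R) (u : R -> R -> R),
    0 < T -> mu0 <= mu -> kdv_solution T mu u0 u ->
  exists k0 C : R, 0 < k0 /\
    forall (N M : nat) (uN : R -> R -> R) (V : nat -> nat -> R -> R),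
      (1 <= N)%N -> (1 <= M)%N ->
      let k := T / M%:R in
      k <= k0 -> k * N%:R <= C1 ->
      semidiscrete T N u0 uN ->
      stages N k M uN V ->
      \big[Num.max/0]_(n < M) L2norm (toC (local_error k uN V n))
        <= C * k ^+ 5.
Proof.
exists 24 => T mu C1 u0 u T0 hmu sol.
have [K K0 hK] := semidiscrete_bound T0 hmu sol.
have [A A0 [sA mA]] := stage_coef_bounded R.
have E0 := elem_diff_bound_ge0 K0.
pose B : R := `|b1 R| + `|1 - 2 * b1 R|.
have B0 : 0 <= B by rewrite addr_ge0.
have hB n : `|b R n| <= B.
  by rewrite /b /B; case: eqP => _; [rewrite lerDr|rewrite lerDl].
(* A bound of the [wnorm] of index 1 of the expansions, which fixes the largest
   admissible step through [energy]. *)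
pose Q := K + 7 * (A * elem_diff_bound K).
have Q0 : 0 <= Q by rewrite addr_ge0 // !mulr_ge0.
have BQ0 : 0 <= B * Q by rewrite mulr_ge0.
pose C2 : R := 2 * (remainder_bound K 1 ^+ 2 * expR (2 * (K + 7 * (1 * elem_diff_bound K)) + 1))
  + 2 * (52 * (B * remainder_bound K A) ^+ 2).
have C20 : 0 <= C2.
  by apply: addr_ge0; do 2?[apply: mulr_ge0 => //]; rewrite ?expR_ge0 ?sqr_ge0.
have p2 : 0 <= pi *+ 2 :> R by rewrite mulrn_wge0 // pi_ge0.
exists (1 + 4 * (B * Q))^-1, (Num.sqrt (pi *+ 2 * C2)).
have d1 : 0 < 1 + 4 * (B * Q) by lra.
split; first by rewrite invr_gt0.
move=> N M uN V N1 M1 k kk0 _ sd st.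
have M0 : 0 < M%:R :> R by rewrite ltr0n.
have k0 : 0 < k by rewrite divr_gt0.
have kb : k * (1 + 4 * (B * Q)) <= 1 by rewrite -ler_pdivlMr // mul1r.
have kBQ : k * (B * Q) <= 1 / 4 by have := mulr_ge0 (ltW k0) BQ0; lra.
have k1 : k <= 1 by have := mulr_ge0 (ltW k0) BQ0; lra.
have [uS duN _ _] := sd.
apply/bigmax_leP; split; first by rewrite mulr_ge0 ?sqrtr_ge0 // exprn_ge0 // ltW.
move=> n _; have [VS V0 VE] := st n (ltn_ord n).
have tn0 : 0 <= n%:R * k by rewrite mulr_ge0 // ltW.
have tnE : n.+1%:R * k = n%:R * k + k by rewrite -natr1 mulrDl mul1r.
have tnT : n%:R * k + k <= T.
  have -> : T = M%:R * k by rewrite /k mulrC divfK // gt_eqF.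
  by rewrite -tnE ler_pM2r // ler_nat.
have tI : n%:R * k \in `[0, T] by rewrite in_itv /= tn0 /=; lra.
have tI1 : n%:R * k + k \in `[0, T] by rewrite in_itv /= tnT andbT; lra.
pose c t := dft N (uN t).
pose W i := dft N (V n i).
have hv : herm (c (n%:R * k)) by exact: herm_dft.
have vK : wnorm N 15 (c (n%:R * k)) <= K by exact: hK sd _ tI.
have dc : coef_curve N (n%:R * k) (n%:R * k + k) c (fun t => kdvF N (c t)).
  apply: (coef_curve_sub tn0 tnT _ (coef_curve_dft duN)) => t l tt lN.
  apply: (galerkin_ode sd) => //; move: tt; rewrite !in_itv /= => /andP[h1 h2].
  by rewrite (le_lt_trans tn0 h1) (lt_le_trans h2 tnT).
have near1 := taylor_flow_close K0 hv vK k0 k1 (fun t _ => herm_dft N (uN t)) dc (fun l _ => erefl).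
have W0 l : (`|l| <= N)%N -> W 0%N l = c (n%:R * k) l.
  by move=> _; rewrite /W /c; congr (dft N _ l); apply/funext => x; exact: V0.
have WS i l : (i < 3)%N -> (`|l| <= N)%N -> W i.+1 l = W i l +
     (k * b R i.+1)%:C * kdvF N (fun l => (W i.+1 l + W i l) / 2) l.
  move=> i3 lN; apply: stage_coefs => //; [by apply: VS; exact: ltnW|exact: VS|].
  by move=> x; apply: VE.
have near2 := stages_close K0 hv vK A0 sA mA hB k0 k1 kBQ (fun i _ => herm_dft N (V n i)) W0 WS.
have sqnorm_th : sqnorm N (fun l => c (n%:R * k + k) l - W 3%N l) <= C2 * (k ^+ 5) ^+ 2.
  set s := series4 N (c (n%:R * k)) (flow_coef R) k%:C in near1 near2.
  have -> : (fun l => c (n%:R * k + k) l - W 3%N l) =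
      (fun l => (c (n%:R * k + k) l - s l) - (W 3%N l - s l)).
    by apply/funext => l; ring.
  apply: le_trans (sqnormB _ _ _) _.
  have -> : C2 * (k ^+ 5) ^+ 2 =
    2 * ((k ^+ 5 * remainder_bound K 1) ^+ 2 * expR (2 * (K + 7 * (1 * elem_diff_bound K)) + 1))
    + 2 * (52 * (k ^+ 5 * (B * remainder_bound K A)) ^+ 2).
    by rewrite /C2; move: (remainder_bound K 1) (remainder_bound K A) (expR _) => *; ring.
  by apply: lerD; rewrite ler_wpM2l.
have thE x : toC (local_error k uN V n) x =
    sumZ N (fun l => (c (n%:R * k + k) l - W 3%N l) * expi l x).
  have -> : toC (local_error k uN V n) x = toC (uN (n%:R * k + k)) x - toC (V n 3%N) x.
    by rewrite /toC /local_error tnE; exact: (rmorphB (real_complex R)).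
  rewrite (inS_dft (uS _ tI1)) (inS_dft (VS 3%N isT)) /trigsum /sumZ -sumrB.
  by apply: eq_bigr => j _; rewrite mulrBl.
rewrite (L2norm_trig thE).
have k5 : 0 <= k ^+ 5 by rewrite exprn_ge0 // ltW.
rewrite -[X in _ <= _ * X](ger0_norm k5) -sqrtr_sqr -sqrtrM ?mulr_ge0 //.
by rewrite ler_wsqrtr // -mulrA ler_wpM2l.
Qed.
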